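(* Let $F_{\mathbb Z}$ be a skew-periodic interval map without reflective boundary, with base map $F_0$ and step length function $\psi$ as in the context. Then $F_{\mathbb Z}$ exhibits a dimension gap, i.e. $\dim_H(R(F_{\mathbb Z}))<\dim_H(\mathfrak R(F_{\mathbb Z}))$, if and only if either $\alpha_{\max}>0$, or $$\alpha_{\max}<0\quad\text{and}\quad \exists\, q>0:\ \sum_{x\in \mathrm{Per}_1(F_0)}\exp\big(\delta_0\varphi(x)+q\psi(x)\big)<\infty .$$
   Context: Conventions: $\mathbb N=\{0,1,2,\dots\}$; $\dim_H$ is Hausdorff dimension. Base map. $I\subset\mathbb N$ with $\mathrm{card}(I)\ge 2$ (finite or countably infinite), $(J_i)_{i\in I}$ are non-empty pairwise disjoint open subintervals of $(0,1)$, $\Delta_0=\bigcup_{i\in I}J_i$, and $F_0:\Delta_0\to(0,1)$ satisfies: $F_0(J_i)=(0,1)$ for every $i$; each $F_0|_{J_i}$ has a $C^2$-extension to a neighbourhood of $\overline{J_i}$; $\inf_{\Delta_0}|F_0'|>1$; $\sup_{\Delta_0}|F_0''|/(F_0')^2<\infty$. Step length function. $\psi:\Delta_0\to\mathbb Z$ is constant on each $J_i$, with $\inf\psi=-1<0<\sup\psi\le\infty$. Extension. $F_{\mathbb Z}:\Delta_0+\mathbb Z\to\mathbb R$, $F_{\mathbb Z}(x)=F_0(x-\lfloor x\rfloor)+\psi(x-\lfloor x\rfloor)+\lfloor x\rfloor$. For a map $f$ with domain $\Delta\subset\mathbb R$: the repeller is $\mathfrak R(f)=\bigcap_{n\ge0}f^{-n}(\Delta)$;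 $\mathrm{Per}_n(f)=\{x\in\mathfrak R(f):f^n(x)=x\}$; the recurrent set is $R(f)=\{x\in\mathfrak R(f):\liminf_{n\to\infty}|f^n(x)|<\infty\}$. It is assumed that $F_{\mathbb Z}:\mathfrak R(F_{\mathbb Z})\to\mathfrak R(F_{\mathbb Z})$ is topologically transitive (for all non-empty relatively open $U,V\subset\mathfrak R(F_{\mathbb Z})$ there is $n\in\mathbb N$ with $F_{\mathbb Z}^n(U)\cap V\ne\emptyset$). Pressure and Gibbs measures on the base. Write $\mathfrak R_0=\mathfrak R(F_0)$. A function $g:\mathfrak R_0\to\mathbb R$ is called Hölder continuous if its restrictions to $\mathfrak R_0\cap J_i$ are Hölder continuous with exponent and constant independent of $i$. With $S_ng=\sum_{k=0}^{n-1}g\circ F_0^k$ put $\mathcal P(g)=\limsup_{n\to\infty}\frac1n\log\sum_{x\in\mathrm{Per}_n(F_0)\cap J_i}\exp(S_ng(x))$ (independent of $i\in I$). If $\mathcal P(g)<\infty$, $\mu_g$ denotes the unique $F_0$-invariant Borel probability measure on $\mathfrak R_0$ for which there is $C\ge1$ with $C^{-1}\le \mu_g(J_\omega)/\exp(S_\omega g-n\mathcal P(g))\le C$ for all $n\ge1$, $\omega\in I^n$, where $J_\omega=\{x: F_0^k(x)\in J_{\omega_k},\,0\le k<n\}$ and $S_\omega g=\sup_{J_\omega\cap\mathfrak R_0}S_ng$ (Gibbs measure for $g$). Geometric potential: $\varphi=-\log|F_0'|$. $F_0$ is assumed strongly regular: there is $s>0$ with $0<\mathcal P(s\varphi)<\infty$.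 Set $\delta_0=\dim_H(\mathfrak R_0)$; then $\delta_0=\inf\{s\ge0:\mathcal P(s\varphi)\le 0\}$ and $\mathcal P(\delta_0\varphi)=0$. It is assumed that $\int(-\varphi)\,d\mu_{\delta_0\varphi}<\infty$. Finally $\alpha_{\max}=\int\psi\,d\mu_{\delta_0\varphi}\in\mathbb R\cup\{+\infty\}$. *)

(* Defs.v *)
From HB Require Import structures.
From mathcomp Require Import all_boot all_order all_algebra.
From mathcomp Require Import all_classical all_reals all_analysis.

Set Implicit Arguments.
Unset Strict Implicit.
Unset Printing Implicit Defensive.

Import Order.TTheory GRing.Theory Num.Theory.
Import numFieldNormedType.Exports.

Local Open Scope classical_set_scope.
Local Open Scope ring_scope.

(* A partial map f : D -> R is encoded by a total function f : R -> R together
   with its domain D : set R; every notion below only depends on f on D. *)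

Section Hausdorff.
Context {R : realType}.
Implicit Types (A U : set R) (s d : R).

Definition diam U : \bar R :=
  ereal_sup [set (`|xy.1 - xy.2|)%:E | xy in U `*` U].

(* The empty set has weight 0 also for s = 0, while 0 `^ 0 = 1; the guard also
   avoids diam set0 = -oo. *)
Definition hausdorff_weight s U : \bar R :=
  if U == set0 then 0%E else (diam U `^ s)%E.

Definition hausdorff_premeasure s d A : \bar R :=
  ereal_inf [set (\sum_(0 <= n <oo) hausdorff_weight s (U n))%E |
    U in [set U : nat -> set R |
      A `<=` \bigcup_n U n /\ forall n, (diam (U n) <= d%:E)%E]].

(* The premeasure is nonincreasing in d, so its limit as d -> 0+ is a sup. *)
Definition hausdorff_measure s A : \bar R :=
  ereal_sup [set hausdorff_premeasure s d A | d in [set d | 0 < d]].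

Definition hausdorff_dim A : \bar R :=
  ereal_inf [set s%:E | s in [set s | 0 <= s /\ hausdorff_measure s A = 0%E]].

End Hausdorff.

Section Dynamics.
Context {R : realType}.
Implicit Types (D A : set R) (f g : R -> R).

(* The points all of whose iterates are defined; values of f outside D are
   never used, since iter n f x is only relevant once
   x, f x, ..., iter n.-1 f x all lie in D. *)
Definition repeller D f : set R := [set x | forall n, D (iter n f x)].

Definition Per D f n : set R := [set x | repeller D f x /\ iter n f x = x].

Definition recurrent_set D f : set R :=
  [set x | repeller D f x /\
           (limn_einf (fun n => (`|iter n f x|)%:E) < +oo)%E].

Definition topologically_transitive A f : Prop :=
  forall U V : set R, open U -> open V ->
    U `&` A !=set0 -> V `&` A !=set0 ->
    exists n : nat, (iter n f @` (U `&` A)) `&` (V `&` A) !=set0.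

Definition C2_on A f : Prop :=
  forall x, A x ->
    [/\ derivable f x 1, derivable (derive1 f) x 1 &
        {for x, continuous (derive1n 2 f)}].

Definition birkhoff_sum f g (n : nat) (x : R) : R :=
  \sum_(k < n) g (iter k f x).

End Dynamics.

Section SkewPeriodic.
Context {R : realType}.
Variables (I : set nat) (J : nat -> set R).

(* Only the J i with i in I are meaningful. *)
Definition Delta0 : set R := \bigcup_(i in I) J i.

Record base_map (F0 : R -> R) : Prop := BaseMap {
  base_card : (`I_2 #<= I)%card ;
  base_interval : forall i, I i ->
    [/\ open (J i), is_interval (J i), J i !=set0 & J i `<=` `]0, 1[%classic] ;
  base_disjoint : trivIset I J ;
  base_full : forall i, I i -> F0 @` J i = `]0, 1[%classic ;
  base_C2 : forall i, I i -> exists (G : R -> R) (U : set R),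
    [/\ open U, closure (J i) `<=` U, C2_on U G & forall x, J i x -> G x = F0 x] ;
  base_expanding :
    (1 < ereal_inf [set (`|derive1 F0 x|)%:E | x in Delta0])%E ;
  base_distortion :
    (ereal_sup [set (`|derive1n 2 F0 x| / (derive1 F0 x) ^+ 2)%:E | x in Delta0]
       < +oo)%E }.

Record step_length (psi : R -> int) : Prop := StepLength {
  step_const : forall i x y, I i -> J i x -> J i y -> psi x = psi y ;
  step_inf : ereal_inf [set ((psi x)%:~R : R)%:E | x in Delta0] = (-1)%:E ;
  step_sup : (0 < ereal_sup [set ((psi x)%:~R : R)%:E | x in Delta0])%E }.

Definition DeltaZ : set R := [set x + m%:~R | x in Delta0 & m in [set: int]].

Definition FZ (F0 : R -> R) (psi : R -> int) (x : R) : R :=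
  let y := x - (Num.floor x)%:~R in
  F0 y + (psi y)%:~R + (Num.floor x)%:~R.

Variable F0 : R -> R.

Local Notation R0 := (repeller Delta0 F0).

Definition geom_potential (x : R) : R := - ln `|derive1 F0 x|.

(* Pressure computed with the reference interval J i. *)
Definition pressure (i : nat) (g : R -> R) : \bar R :=
  limn_esup (fun n => ((n%:R^-1)%:E *
    lne (\esum_(x in Per Delta0 F0 n `&` J i)
           (expR (birkhoff_sum F0 g n x))%:E))%E).

Definition strongly_regular (i : nat) : Prop :=
  exists s : R, [/\ 0 < s,
    (0 < pressure i (fun x => s * geom_potential x)%R)%E &
    (pressure i (fun x => s * geom_potential x)%R < +oo)%E].

Definition cylinder (w : seq nat) : set R :=
  [set x | forall k, (k < size w)%N -> J (nth 0%N w k) (iter k F0 x)].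

(* A Borel probability measure on R0 is encoded as one on the line giving full
   mass to the Borel set R0.  All quantities are extended reals; the two-sided
   bound forces exp(S_w g - n P(g)) to be neither 0 nor +oo. *)
Definition gibbs_measure (i : nat) (g : R -> R)
    (mu : probability (measurableTypeR R) R) : Prop :=
  [/\ mu R0 = 1%E,
      forall A : set (measurableTypeR R), measurable A ->
        mu (R0 `&` F0 @^-1` A) = mu (R0 `&` A) &
      exists C : R, 1 <= C /\
        forall w : seq nat, (0 < size w)%N -> (forall k, k \in w -> I k) ->
          let Sw := ereal_sup [set (birkhoff_sum F0 g (size w) x)%:E |
                                x in cylinder w `&` R0] in
          let q := (mu (cylinder w) /
                    expeR (Sw - (size w)%:R%:E * pressure i g))%E in
          ((C^-1)%:E <= q)%E /\ (q <= C%:E)%E].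

(* The Hausdorff dimension of a subset of the line lies in [0, 1], so fine
   loses no information. *)
Definition delta0 : R := fine (hausdorff_dim R0).

End SkewPeriodic.

(* Main.v *)
(** Code points of the repeller of F0 by words over I and let Z n s q be the sum of
    |J_w|^s exp (q psi(w)) over the words w of length n. Bounded distortion makes
    Z almost multiplicative and turns the Gibbs measure into weights comparable to
    |J_w|^delta; comparing covers by cylinders with finite subsystems shows that
    the pressure at delta vanishes. A point is recurrent iff it lies in
    infinitely many cylinders with bounded psi(w), up to integer translation.

    Gap: if the mean drift is positive, or negative with exponential moments, a
    weak law of large numbers makes Z n delta q small for some n and some q of the
    sign opposite to the drift. Interpolating with a finite partition sum at an
    exponent below delta yields s < delta with a finite sum over all words, so by
    Borel-Cantelli the recurrent set has zero s-dimensional measure.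

    No gap: if the drift is zero, or negative without exponential moments, the
    words of length n with |psi(w)| <= e n have total weight at least exp (- e n);
    in the second case one long jump compensates the drift. Correcting them by
    short words to psi(w) = 0 gives, for each s < delta, a finite subsystem of
    recurrent points of dimension at least s. *)

Require Import Defs.
From HB Require Import structures.
From mathcomp Require Import all_boot all_order all_algebra.
From mathcomp Require Import all_classical all_reals all_analysis.
From mathcomp Require Import measurable_realfun.
From mathcomp Require Import ring lra zify.
Set Implicit Arguments.
Unset Strict Implicit.
Unset Printing Implicit Defensive.
Import Order.TTheory GRing.Theory Num.Theory.
Import numFieldNormedType.Exports.
Local Open Scope classical_set_scope.
Local Open Scope ring_scope.

(** * Sums over words *)

Section Esum.
Context {R : realType}.
Local Open Scope ereal_scope.

(** Three obstacles shape the proof. First, cylinders are open intervals: nested ones can shrink to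
    a missing endpoint, and different ones can touch. Ending every block with a fixed inner word,
    whose cylinder stays away from 0 and 1, cures both defects at the price of a bounded factor.
    Second, [psi] may have infinite mean. Everything is therefore stated for [psi + 1 >= 0] with
    sums in the extended half-line, and a drift compared with 0 becomes a mean compared with 1.
    Third, the pressure need not be finite for any [q] other than 0 on one side, so it cannot be
    differentiated in [q]. The tilt is instead taken of order [1 / n] on words of length [n]:
    [expR (q * psi(w))] then only sees whether the average step is above or below its threshold, and
    a law of large numbers at scale [n] suffices. One small partition sum is enough, because
    almost-multiplicativity turns it into geometric decay. The weak law itself comes from
    stationarity and the inequality [c * (p u * p v) <= p (u ++ v)], by an elementary L2
    argument. *)

Lemma esum_exchange (T U : choiceType) (A : set T) (B : set U)
    (a : T -> U -> \bar R) : (forall i j, 0 <= a i j) ->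
  \esum_(i in A) \esum_(j in B) a i j = \esum_(j in B) \esum_(i in A) a i j.
Proof.
move=> a0; rewrite !esum_esum//.
rewrite (reindex_esum (B `*`` fun=> A) _ (fun x => (x.2, x.1)))//; split=> //=.
- by move=> [i j] [/=].
- by move=> [i1 i2] [j1 j2] /= _ _ [] -> ->.
- by move=> [i1 i2] [Pi1 Qi2] /=; exists (i2, i1).
Qed.

Lemma esumZl (T : choiceType) (A : set T) (c : R) (a : T -> \bar R) :
  (0 <= c)%R -> (forall i, 0 <= a i) ->
  \esum_(i in A) (c%:E * a i) = c%:E * \esum_(i in A) a i.
Proof.
move=> c0 a0; rewrite /esum -ereal_supZl//; last first.
  apply/set0P; exists 0; exists set0; last by rewrite fsbig_set0.
  by split => //; exact: finite_set0.
congr ereal_sup; apply/seteqP; split => x /=.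
  move=> [F FA <-]; exists (\sum_(i \in F) a i); first by exists F.
  by rewrite ge0_mule_fsumr.
by move=> [_ [F FA <-] <-]; exists F => //; rewrite ge0_mule_fsumr.
Qed.

Lemma esum_sub (T : choiceType) (A B : set T) (a : T -> \bar R) :
  (forall i, 0 <= a i) -> A `<=` B ->
  \esum_(i in A) a i <= \esum_(i in B) a i.
Proof.
move=> a0 AB; rewrite esum_mkcond [leRHS]esum_mkcond; apply: le_esum => i _.
case: ifPn => [/[!inE] /AB iB|_]; first by rewrite ifT// inE.
by case: ifP.
Qed.

Lemma esum_gt_seq (T : choiceType) (A : set T) (a : T -> \bar R) x :
  x < \esum_(i in A) a i ->
  exists r : seq T, [/\ uniq r, (forall i, i \in r -> A i) &
    x < \sum_(i <- r) a i].
Proof.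
move=> /ereal_sup_gt[_ [F [/finite_seqP[r ->] FA] <-]] xF.
exists (undup r); split; first exact: undup_uniq.
- by move=> i; rewrite mem_undup => /FA.
- rewrite fsbig_seq ?undup_uniq// (_ : [set` undup r] = [set` r])//.
  by apply/seteqP; split => i /=; rewrite mem_undup.
Qed.

Lemma esum_ge_seq (T : choiceType) (A : set T) (a : T -> \bar R) (r : seq T) :
  uniq r -> (forall i, i \in r -> A i) ->
  \sum_(i <- r) a i <= \esum_(i in A) a i.
Proof.
move=> ur rA; apply: esum_ge; exists [set` r].
  by split => //; exact: finite_seq.
by rewrite -fsbig_seq.
Qed.

Lemma esum_le_seq (T : choiceType) (A : set T) (a : T -> \bar R) x :
  (forall r, uniq r -> (forall i, i \in r -> A i) -> \sum_(i <- r) a i <= x) ->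
  \esum_(i in A) a i <= x.
Proof.
move=> H; rewrite leNgt; apply/negP => /esum_gt_seq[r [ur rA]].
by rewrite ltNge H.
Qed.

Lemma esum_term (T : choiceType) (A : set T) (a : T -> \bar R) i :
  A i -> 0 <= a i -> a i <= \esum_(i in A) a i.
Proof.
move=> Ai ai; have := @esum_ge_seq _ A a [:: i].
by rewrite big_seq1; apply => // j; rewrite inE => /eqP ->.
Qed.

Lemma esum_mul (T U : choiceType) (A : set T) (B : set U) (a : T -> R)
    (b : U -> R) : (forall i, 0 <= a i)%R -> (forall j, 0 <= b j)%R ->
  \esum_(j in B) (b j)%:E < +oo ->
  \esum_(i in A) \esum_(j in B) (a i * b j)%:E =
  (\esum_(i in A) (a i)%:E) * (\esum_(j in B) (b j)%:E).
Proof.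
move=> a0 b0 bfin.
have bE : \esum_(j in B) (b j)%:E = (fine (\esum_(j in B) (b j)%:E))%:E.
  by rewrite fineK// ge0_fin_numE// esum_ge0// => j _; rewrite lee_fin.
rewrite bE muleC -esumZl; last 2 first.
- by rewrite fine_ge0// esum_ge0// => j _; rewrite lee_fin.
- by move=> i; rewrite lee_fin.
by apply: eq_esum => i Ai; rewrite -bE muleC -esumZl.
Qed.

End Esum.

Section Words.
Variable I : set nat.

Definition words n : set (seq nat) :=
  [set w | size w = n /\ forall k, k \in w -> I k].

Lemma words0 : words 0 = [set [::]].
Proof.
by apply/seteqP; split => [w [/size0nil ->]//|_ -> /=]; split.
Qed.

Lemma words_cat n m u v : size u = n ->
  words (n + m) (u ++ v) <-> words n u /\ words m v.
Proof.
move=> su; split => [[]|[[_ uI] [sv vI]]].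
  rewrite size_cat su => /addnI sv uvI; split; split => // k ku; apply: uvI;
  by rewrite mem_cat ku ?orbT.
split; first by rewrite size_cat su sv.
by move=> k; rewrite mem_cat => /orP[/uI|/vI].
Qed.

Lemma words_take n m w : words (n + m) w -> words n (take n w).
Proof.
move=> [sw wI]; split; first by rewrite size_takel// sw leq_addr.
by move=> k /mem_take; exact: wI.
Qed.

Lemma words_drop n m w : words (n + m) w -> words m (drop n w).
Proof.
move=> [sw wI]; split; first by rewrite size_drop sw addKn.
by move=> k /mem_drop; exact: wI.
Qed.

Lemma words_nseq n i : I i -> words n (nseq n i).
Proof.
by move=> Ii; split; [rewrite size_nseq|move=> k; rewrite mem_nseq => /andP[_ /eqP ->]].
Qed.

Lemma words1 i : words 1 [:: i] <-> I i.
Proof.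
split=> [[_]|Ii]; first by apply; rewrite inE.
exact: (words_nseq 1).
Qed.

Context {R : realType}.
Local Open Scope ereal_scope.

Lemma esum_words_cat n m (f : seq nat -> \bar R) : (forall w, 0 <= f w) ->
  \esum_(w in words (n + m)) f w =
  \esum_(u in words n) \esum_(v in words m) f (u ++ v).
Proof.
move=> f0; rewrite esum_esum//.
rewrite (reindex_esum (words n `*`` fun=> words m) _ (fun k => k.1 ++ k.2))//.
split=> /=.
- by move=> [u v] /= [[su uI] [sv vI]]; apply/words_cat => //.
- move=> [u v] [u' v'] /=; rewrite !inE /= => -[[su _] _] [[su' _] _].
  by move/eqP; rewrite eqseq_cat ?su//= => /andP[/eqP -> /eqP ->].
- move=> w ww; exists (take n w, drop n w); last by rewrite /= cat_take_drop.
  by split; [exact: words_take ww|exact: words_drop ww].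
Qed.

Lemma esum_words1 (f : seq nat -> \bar R) : (forall w, 0 <= f w) ->
  \esum_(w in words 1) f w = \esum_(i in I) f [:: i].
Proof.
move=> f0; rewrite (reindex_esum I _ (fun i => [:: i]))//; split => /=.
- by move=> i Ii; apply/words1.
- by move=> i j _ _ [].
- move=> w [sw wI]; case: w sw wI => [|i [|]]//= _ wI.
  by exists i => //; apply: wI; rewrite inE.
Qed.

Lemma esum_words_cons n (f : seq nat -> \bar R) : (forall w, 0 <= f w) ->
  \esum_(w in words n.+1) f w =
  \esum_(i in I) \esum_(v in words n) f (i :: v).
Proof.
move=> f0; rewrite -add1n esum_words_cat// esum_words1//.
by move=> w; exact: esum_ge0.
Qed.

Lemma esum_words_rcons n (f : seq nat -> \bar R) : (forall w, 0 <= f w) ->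
  \esum_(w in words n.+1) f w =
  \esum_(u in words n) \esum_(i in I) f (rcons u i).
Proof.
move=> f0; rewrite -addn1 esum_words_cat//; apply: eq_esum => u _.
by rewrite esum_words1//; apply: eq_esum => i _; rewrite cats1.
Qed.

End Words.

(** * Weak law for quasi-Bernoulli weights on words *)

Section Weights.
Context {R : realType} (I : set nat) (p : seq nat -> R).
Local Open Scope ereal_scope.

(** Under the consistency hypotheses below, [p w] is the probability of the cylinder [w] for a
    stationary process with values in [I], and this is the expectation of a function of [n]
    consecutive letters. *)
Definition mean n (X : seq nat -> R) : \bar R :=
  \esum_(w in words I n) (p w * X w)%:E.

Definition wsum (f : nat -> R) (w : seq nat) : R := (\sum_(i <- w) f i)%R.

Lemma wsum_cat f u v : wsum f (u ++ v) = (wsum f u + wsum f v)%R.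
Proof. by rewrite /wsum big_cat. Qed.

Lemma wsum1 f i : wsum f [:: i] = f i.
Proof. by rewrite /wsum big_seq1. Qed.

Lemma wsum_ge0 f w : (forall i, 0 <= f i)%R -> (0 <= wsum f w)%R.
Proof. by move=> f0; exact: sumr_ge0. Qed.

Hypothesis p0 : forall w, (0 <= p w)%R.

Lemma mean_ge0 n X : (forall w, words I n w -> 0 <= X w)%R -> 0 <= mean n X.
Proof. by move=> X0; apply: esum_ge0 => w ww; rewrite lee_fin mulr_ge0// X0. Qed.

Lemma le_mean n X Y : (forall w, words I n w -> X w <= Y w)%R ->
  mean n X <= mean n Y.
Proof. by move=> XY; apply: le_esum => w ww; rewrite lee_fin ler_wpM2l// XY. Qed.

Lemma eq_mean n X Y : (forall w, words I n w -> X w = Y w) -> mean n X = mean n Y.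
Proof. by move=> XY; apply: eq_esum => w ww; rewrite XY. Qed.

Lemma meanD n X Y : (forall w, words I n w -> 0 <= X w)%R ->
  (forall w, words I n w -> 0 <= Y w)%R ->
  mean n (fun w => X w + Y w)%R = mean n X + mean n Y.
Proof.
move=> X0 Y0; rewrite /mean -esumD; last 2 first.
- by move=> w ww; rewrite lee_fin mulr_ge0// X0.
- by move=> w ww; rewrite lee_fin mulr_ge0// Y0.
by apply: eq_esum => w _; rewrite mulrDr.
Qed.

Lemma meanZl n a X : (0 <= a)%R -> (forall w, 0 <= X w)%R ->
  mean n (fun w => a * X w)%R = a%:E * mean n X.
Proof.
move=> a0 X0; rewrite /mean -esumZl//.
  by apply: eq_esum => w _; rewrite mulrCA EFinM.
by move=> w; rewrite lee_fin mulr_ge0.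
Qed.

Hypothesis p_nil : p [::] = 1%R.
Hypothesis p_rcons : forall n w, words I n w ->
  \esum_(i in I) (p (rcons w i))%:E = (p w)%:E.
Hypothesis p_cons : forall n w, words I n w ->
  \esum_(i in I) (p (i :: w))%:E = (p w)%:E.

Lemma esum_p_catr n m u : words I n u ->
  \esum_(v in words I m) (p (u ++ v))%:E = (p u)%:E.
Proof.
move=> uW; elim: m => [|m IH].
  by rewrite words0 esum_set1 ?cats0// lee_fin.
rewrite esum_words_rcons; last by move=> w; rewrite lee_fin.
rewrite -IH; apply: eq_esum => v vW.
under eq_esum do rewrite -rcons_cat.
by apply: (@p_rcons (n + m)); apply/words_cat => //; case: uW.
Qed.

Lemma esum_p_catl n m v : words I m v ->
  \esum_(u in words I n) (p (u ++ v))%:E = (p v)%:E.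
Proof.
move=> vW; elim: n => [|n IH].
  by rewrite words0 esum_set1 ?cats0// lee_fin.
rewrite esum_words_cons; last by move=> w; rewrite lee_fin.
rewrite esum_exchange; last by move=> i j; rewrite lee_fin.
rewrite -IH; apply: eq_esum => u uW.
under eq_esum do rewrite cat_cons.
by apply: (@p_cons (n + m)); apply/words_cat => //; case: uW.
Qed.

Lemma mean_take n m X : (forall w, 0 <= X w)%R ->
  mean (n + m) (X \o take n) = mean n X.
Proof.
move=> X0; rewrite /mean esum_words_cat; last first.
  by move=> w; rewrite lee_fin mulr_ge0//; exact: X0.
apply: eq_esum => u uW; under eq_esum => v vW.
  rewrite /= take_size_cat//; last by case: uW.
  rewrite mulrC EFinM.
  over.
rewrite esumZl//; last by move=> i; rewrite lee_fin.
by rewrite (@esum_p_catr n)// -EFinM mulrC.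
Qed.

(** Stationarity: consistency in the first letter enters here, consistency in the last letter in
    [mean_take]. *)
Lemma mean_drop n m X : (forall w, 0 <= X w)%R ->
  mean (n + m) (X \o drop n) = mean m X.
Proof.
move=> X0; rewrite /mean esum_words_cat; last first.
  by move=> w; rewrite lee_fin mulr_ge0//; exact: X0.
rewrite esum_exchange; last by move=> i j; rewrite lee_fin mulr_ge0//; exact: X0.
apply: eq_esum => v vW; under eq_esum => u uW.
  rewrite /= drop_size_cat//; last by case: uW.
  rewrite mulrC EFinM.
  over.
rewrite esumZl//; last by move=> i; rewrite lee_fin.
by rewrite (@esum_p_catl n m)// -EFinM mulrC.
Qed.

Lemma mean_cst n a : (0 <= a)%R -> mean n (fun=> a) = a%:E.
Proof.
move=> a0; rewrite /mean; under eq_esum do rewrite mulrC EFinM.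
rewrite esumZl//.
have := @esum_p_catr 0 n [::]; rewrite p_nil => ->; rewrite ?mule1//.
Qed.

Lemma mean1 f : (forall i, 0 <= f i)%R ->
  mean 1 (wsum f) = \esum_(i in I) (p [:: i] * f i)%:E.
Proof.
move=> f0; rewrite /mean esum_words1; last first.
  by move=> w; rewrite lee_fin mulr_ge0// wsum_ge0.
by apply: eq_esum => i _; rewrite wsum1.
Qed.

Lemma mean_wsum f (b : R) n : (forall i, 0 <= f i)%R ->
  mean 1 (wsum f) = b%:E -> mean n (wsum f) = (n%:R * b)%:E.
Proof.
move=> f0 fb; elim: n => [|n IH].
  rewrite mul0r /mean words0 esum_set1 /wsum ?big_nil ?mulr0//.
have -> : mean n.+1 (wsum f) = mean (n + 1)
    (fun w => (wsum f \o take n) w + (wsum f \o drop n) w)%R.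
  by rewrite addn1; apply: eq_mean => w _ /=; rewrite -wsum_cat cat_take_drop.
rewrite meanD/=; last 2 first.
- by move=> *; exact: wsum_ge0.
- by move=> *; exact: wsum_ge0.
rewrite mean_take ?mean_drop ?IH ?fb//; try by move=> w; exact: wsum_ge0.
by rewrite -EFinD -[n.+1]addn1 natrD mulrDl mul1r.
Qed.

Definition deviation f (b : R) n : \bar R :=
  mean n (fun w => `|wsum f w - n%:R * b|)%R.

Lemma deviationD f b n m :
  deviation f b (n + m) <= deviation f b n + deviation f b m.
Proof.
rewrite /deviation -(@mean_take n m)// -(@mean_drop n m)//.
rewrite -meanD; [|by move=> w _; exact: normr_ge0..].
apply: le_mean => w ww /=.
rewrite -{1}(cat_take_drop n w) wsum_cat natrD mulrDl opprD addrACA.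
exact: ler_normD.
Qed.

Lemma deviation_mul f b m k : deviation f b (k * m) <= k%:R%:E * deviation f b m.
Proof.
elim: k => [|k IH].
  rewrite mul0n mul0e /deviation /mean words0 esum_set1 /wsum ?big_nil.
    by rewrite mul0r subr0 normr0 mulr0.
  by rewrite lee_fin mulr_ge0.
rewrite mulSn (le_trans (deviationD _ _ _ _))//.
rewrite -natr1 addrC EFinD ge0_muleDl ?lee_fin// mul1e.
by rewrite leeD2r.
Qed.

Lemma deviation_add f g (a b : R) n :
  deviation (fun i => f i + g i)%R (a + b) n <= deviation f a n + deviation g b n.
Proof.
rewrite /deviation -meanD//; apply: le_mean => w _.
rewrite /wsum big_split/= mulrDr opprD addrACA; exact: ler_normD.
Qed.

Lemma deviation_le f b n : (forall i, 0 <= f i)%R -> mean 1 (wsum f) = b%:E ->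
  deviation f b n <= (2 * (n%:R * b))%:E.
Proof.
move=> f0 fb.
have b0 : (0 <= b)%R.
  by rewrite -lee_fin -fb mean_ge0// => w _; exact: wsum_ge0.
have nb0 : (0 <= n%:R * b)%R by rewrite mulr_ge0.
apply: (@le_trans _ _ (mean n (fun w => wsum f w + n%:R * b)%R)).
  apply: le_mean => w _; rewrite (le_trans (ler_normB _ _))//.
  by rewrite !ger0_norm// wsum_ge0.
rewrite meanD//; last by move=> *; exact: wsum_ge0.
by rewrite mean_cst// (mean_wsum n f0 fb) -EFinD lee_fin; lra.
Qed.

Variable c : R.
Hypothesis c0 : (0 < c)%R.
Hypothesis p_cat : forall n m u v, words I n u -> words I m v ->
  (c * (p u * p v) <= p (u ++ v))%R.

(* The parallelogram law turns the decrease of the L2 norms of the averages over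
   2^k letters into smallness of the distance between the two halves. *)
Lemma exists_close_halves f (M eta : R) : (forall i, 0 <= f i <= M)%R ->
  (0 < eta)%R -> exists2 m, (0 < m)%N &
  mean (m + m) (fun w => (wsum f (take m w) - wsum f (drop m w)) ^+ 2)%R
    <= (eta * m%:R ^+ 2)%:E.
Proof.
move=> fM eta0.
have f0 i : (0 <= f i)%R by have /andP[] := fM i.
pose D m := mean (m + m)
  (fun w => (wsum f (take m w) - wsum f (drop m w)) ^+ 2)%R.
pose S m := mean m (fun w => wsum f w ^+ 2)%R.
have DS m : D m + S (m + m)%N = 4%:E * S m.
  rewrite /D /S -meanD; [|by move=> *; exact: sqr_ge0..].
  transitivity (mean (m + m) (fun w =>
      2 * ((fun u => wsum f u ^+ 2) \o take m) w +
      2 * ((fun u => wsum f u ^+ 2) \o drop m) w)%R).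
    apply: eq_mean => w _ /=.
    by rewrite -{3}(cat_take_drop m w) wsum_cat; ring.
  rewrite meanD; [|by move=> *; rewrite mulr_ge0// sqr_ge0..].
  rewrite meanZl ?mean_take//; [|by move=> *; exact: sqr_ge0..].
  rewrite meanZl ?mean_drop//; [|by move=> *; exact: sqr_ge0..].
  rewrite -ge0_muleDl ?lee_fin// -EFinD; congr (_%:E * _); lra.
have D0 m : 0 <= D m by apply: mean_ge0 => *; exact: sqr_ge0.
have S0 m : 0 <= S m by apply: mean_ge0 => *; exact: sqr_ge0.
pose T k := fine (S (2 ^ k)%N).
have Sfin k : S (2 ^ k)%N \is a fin_num.
  rewrite ge0_fin_numE//; elim: k => [|k IH].
    rewrite expn0 (@le_lt_trans _ _ (mean 1 (fun=> M ^+ 2)%R))//.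
      apply: le_mean => w [sw _]; case: w sw => [|i []]//= _; rewrite wsum1.
      by have /andP[fi0 fiM] := fM i; rewrite lerXn2r// nnegrE (le_trans fi0).
    by rewrite mean_cst ?ltry// sqr_ge0.
  rewrite expnS mul2n -addnn.
  apply: (@le_lt_trans _ _ (4%:E * S (2 ^ k)%N)).
    by rewrite -DS leeDr.
  by rewrite lte_mul_pinfty// lee_fin.
(* Otherwise [T k / 4 ^+ k] would lose at least [eta / 4] at every step and become negative. *)
have [k Dk] : exists k, (D (2 ^ k)%N <= (eta * ((2 ^ k)%N)%:R ^+ 2)%:E)%E.
  apply: contrapT => /forallNP H.
  have dec k : (T k.+1 <= 4 * T k - eta * ((2 ^ k)%N)%:R ^+ 2)%R.
    have /negP := H k; rewrite -ltNge => Dk.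
    have := DS (2 ^ k)%N; rewrite addnn -mul2n -expnS.
    rewrite -[S (2 ^ k)%N]fineK// -[S (2 ^ k.+1)%N]fineK// -/(T _) -/(T _).
    case: (D _) Dk (D0 (2 ^ k)%N) => [d||]//; rewrite lte_fin => + _.
    by rewrite -EFinD -EFinM => + [<-]; lra.
  have bound k : (T k <= 4 ^+ k * (T 0%N - k%:R * (eta / 4)))%R.
    elim: k => [|k IH]; first by rewrite expr0 mul1r mul0r subr0.
    apply: (le_trans (dec k)).
    have -> : (((2 ^ k)%N)%:R ^+ 2 = 4 ^+ k :> R)%R.
      by rewrite natrX -exprM mulnC exprM -natrX.
    rewrite exprS -[k.+1%:R]natr1.
    have : (4 * T k <= 4 * (4 ^+ k * (T 0%N - k%:R * (eta / 4))))%R.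
      by rewrite ler_pM2l.
    lra.
  have [k Hk] : exists k : nat, (T 0%N < k%:R * (eta / 4))%R.
    exists (Num.truncn (T 0%N / (eta / 4))).+1.
    by rewrite -ltr_pdivrMr ?divr_gt0// truncnS_gt.
  have : (0 <= T k)%R by rewrite fine_ge0.
  apply/negP; rewrite -ltNge (le_lt_trans (bound k))//.
  by rewrite pmulr_rlt0 ?exprn_gt0// subr_lt0.
by exists (2 ^ k)%N; rewrite ?expn_gt0.
Qed.

(** Since [m%:R * b] is the average of [wsum f v], the deviation is at most the average of
    [|wsum f u - wsum f v|] over independent [u] and [v]. By [p_cat] the product weight of a pair is
    at most [c^-1] times the weight of its concatenation, so the two halves of a word of length
    [m + m] control the pairs, and [exists_close_halves] applies with [eta = c * eps ^+ 2]. *)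
Lemma weak_law_bounded f (M b eps : R) : (forall i, 0 <= f i <= M)%R ->
  mean 1 (wsum f) = b%:E -> (0 < eps)%R ->
  exists2 m, (0 < m)%N & deviation f b m <= (eps * m%:R)%:E.
Proof.
move=> fM fb eps0.
have f0 i : (0 <= f i)%R by have /andP[] := fM i.
have eta0 : (0 < c * eps ^+ 2)%R by rewrite mulr_gt0// exprn_gt0.
have [m m0 Hm] := exists_close_halves fM eta0.
exists m => //.
have mp : (0 < m%:R :> R)%R by rewrite ltr0n.
pose t := (eps * m%:R)%R.
have tp : (0 < t)%R by rewrite mulr_gt0.
pose d u v := `|wsum f u - wsum f v|%R.
have d0 u v : (0 <= d u v)%R by exact: normr_ge0.
have pointwise u : words I m u ->
    (`|wsum f u - m%:R * b|)%:E <= \esum_(v in words I m) (p v * d u v)%:E.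
  move=> uW.
  have := mean_wsum m f0 fb; rewrite /mean => mE.
  have mu : \esum_(v in words I m) (p v * wsum f u)%:E = (wsum f u)%:E.
    by rewrite -[LHS](_ : mean m (fun=> wsum f u) = _)// mean_cst// wsum_ge0.
  have sp (X : seq nat -> R) : (forall v, 0 <= X v)%R ->
      forall v, words I m v -> 0 <= (p v * X v)%:E.
    by move=> X0 v _; rewrite lee_fin mulr_ge0.
  have S0 v : (0 <= wsum f v)%R by exact: wsum_ge0.
  (* The two sides are estimated separately, so that only sums of nonnegative terms occur. *)
  have h1 : (wsum f u)%:E <= (m%:R * b)%:E + \esum_(v in words I m) (p v * d u v)%:E.
    rewrite -mu -mE -esumD ?sp//; last 2 first.
    - exact: sp.
    - exact: (sp (d u)).
    apply: le_esum => v _; rewrite -EFinD lee_fin -mulrDr ler_wpM2l// -lerBlDl.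
    exact: ler_norm.
  have h2 : (m%:R * b)%:E <= (wsum f u)%:E + \esum_(v in words I m) (p v * d u v)%:E.
    rewrite -{1}mE -[X in _ <= X + _]mu -esumD ?sp//; last 2 first.
    - exact: (sp (fun=> wsum f u)).
    - exact: (sp (d u)).
    apply: le_esum => v _; rewrite -EFinD lee_fin -mulrDr ler_wpM2l// -lerBlDl.
    by rewrite /d distrC ler_norm.
  case: (\esum_(v in _) (p v * d u v)%:E) h1 h2 => [r||]; rewrite ?leey//.
  rewrite -!EFinD !lee_fin => h1 h2.
  by rewrite ler_norml; apply/andP; split; lra.
have pairs : c%:E * (\esum_(u in words I m) \esum_(v in words I m)
    (p u * p v * d u v ^+ 2)%:E) <= (c * eps ^+ 2 * m%:R ^+ 2)%:E.
  apply: le_trans Hm.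
  rewrite /mean esum_words_cat; last by move=> w; rewrite lee_fin mulr_ge0// sqr_ge0.
  rewrite -esumZl ?(ltW c0)//; last first.
    by move=> u; apply: esum_ge0 => v _; rewrite lee_fin !mulr_ge0.
  apply: le_esum => u uW; rewrite -esumZl ?(ltW c0)//; last first.
    by move=> v; rewrite lee_fin !mulr_ge0.
  apply: le_esum => v vW; rewrite -EFinM lee_fin.
  rewrite take_size_cat ?drop_size_cat//; [|by case: uW..].
  rewrite /d real_normK ?num_real// mulrA ler_wpM2r ?sqr_ge0//.
  exact: p_cat uW vW.
have pairs' : \esum_(u in words I m) \esum_(v in words I m)
    (p u * p v * d u v ^+ 2)%:E <= (t ^+ 2)%:E.
  move: pairs; rewrite -mulrA -exprMn -/t EFinM.
  by rewrite lee_pmul2l// ?lte_fin.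
apply: (@le_trans _ _ (\esum_(u in words I m) \esum_(v in words I m)
    (p u * p v * d u v)%:E)).
  apply: le_esum => u uW; rewrite EFinM.
  apply: (@le_trans _ _ ((p u)%:E * \esum_(v in words I m) (p v * d u v)%:E)).
    by rewrite lee_wpmul2l ?lee_fin ?pointwise.
  rewrite -esumZl//; last by move=> v; rewrite lee_fin mulr_ge0// normr_ge0.
  by apply: le_esum => v _; rewrite -EFinM mulrA.
(* Prepares for [x <= (2 * t)^-1 * x ^+ 2 + t / 2], averaged over the pairs with [x = d u v]. *)
have -> : (eps * m%:R)%:E = ((2 * t)^-1)%:E * (t ^+ 2)%:E + (t / 2)%:E.
  by rewrite -EFinM -EFinD; congr EFin; rewrite -/t; field; rewrite gt_eqF.
apply: (@le_trans _ _ (((2 * t)^-1)%:E * (\esum_(u in words I m)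
   \esum_(v in words I m) (p u * p v * d u v ^+ 2)%:E) + (t / 2)%:E)); last first.
  by rewrite leeD2r// lee_wpmul2l// lee_fin invr_ge0 mulr_ge0// ltW.
have it0 : (0 <= (2 * t)^-1)%R by rewrite invr_ge0 mulr_ge0// ltW.
have q0 u v : 0 <= (p u * p v * d u v ^+ 2)%:E.
  by rewrite lee_fin !mulr_ge0.
have t20 : (0 <= t / 2)%R by rewrite divr_ge0// ltW.
have tE : (t / 2)%:E = \esum_(u in words I m) \esum_(v in words I m)
    (p u * p v * (t / 2))%:E.
  rewrite -(mean_cst m t20); apply: eq_esum => u uW.
  rewrite EFinM -{1}(mean_cst m t20) -esumZl//; last first.
    by move=> v; rewrite lee_fin mulr_ge0.
  by apply: eq_esum => v _; rewrite -EFinM; congr EFin; ring.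
rewrite [in leRHS]tE -esumZl//; last by move=> u; exact: esum_ge0.
rewrite -esumD; last 2 first.
- by move=> u _; rewrite mule_ge0// ?lee_fin//; exact: esum_ge0.
- by move=> u _; apply: esum_ge0 => v _; rewrite lee_fin mulr_ge0// mulr_ge0.
apply: le_esum => u _; rewrite -esumZl// -esumD; last 2 first.
- by move=> v _; rewrite mule_ge0// ?lee_fin.
- by move=> v _; rewrite lee_fin mulr_ge0// mulr_ge0.
apply: le_esum => v _; rewrite -EFinM -EFinD lee_fin.
set P := (p u * p v)%R; set x := d u v.
have -> : ((2 * t)^-1 * (P * x ^+ 2) + P * (t / 2) =
    P * x + P * ((2 * t)^-1 * (x - t) ^+ 2))%R.
  by field; rewrite gt_eqF.
rewrite lerDl; apply: mulr_ge0; first exact: mulr_ge0.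
by apply: mulr_ge0 => //; exact: sqr_ge0.
Qed.

(** Truncation at [M] leaves a remainder of mean at most [eps / 8], whose deviation over [n] letters
    is at most [2 * n] times that mean. For the bounded part the estimate at one length [m] passes
    to all large [n] by subadditivity and Euclidean division of [n] by [m]. *)
Lemma weak_law f (b eps : R) : (forall i, 0 <= f i)%R ->
  mean 1 (wsum f) = b%:E -> (0 < eps)%R ->
  exists N, forall n, (N <= n)%N -> deviation f b n <= (eps * n%:R)%:E.
Proof.
move=> f0 fb eps0.
have e8 : (0 < eps / 8)%R by rewrite divr_gt0.
have b0 : (0 <= b)%R.
  by rewrite -lee_fin -fb mean_ge0// => w _; exact: wsum_ge0.
have [M M0 [gb gbE]] : exists2 M : R, (0 <= M)%R &
    exists2 gb : R, mean 1 (wsum (fun i => f i - Num.min (f i) M)%R) = gb%:E &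
                    (gb <= eps / 8)%R.
  have : (b - eps / 8)%:E < \esum_(i in I) (p [:: i] * f i)%:E.
    by rewrite -mean1// fb lte_fin ltrBlDr ltrDl.
  move=> /esum_gt_seq[r [ur rI Hr]].
  (* Truncating at the sum over [r] leaves the values on [r] unchanged, and these already carry all
     but [eps / 8] of the mean. *)
  pose M := (\sum_(i <- r) f i)%R.
  have M0 : (0 <= M)%R by exact: sumr_ge0.
  have fg i : (0 <= f i - Num.min (f i) M)%R by rewrite subr_ge0 ge_min lexx.
  have m0 i : (0 <= Num.min (f i) M)%R by rewrite le_min f0.
  exists M => //.
  have split : mean 1 (wsum (fun i => f i - Num.min (f i) M)%R) +
     mean 1 (wsum (fun i => Num.min (f i) M)) = b%:E.
    rewrite -fb -meanD; [|by move=> *; exact: wsum_ge0..].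
    apply: eq_mean => w _; rewrite /wsum -big_split/=.
    by apply: eq_bigr => i _; rewrite subrK.
  have low : (b - eps / 8)%:E <= mean 1 (wsum (fun i => Num.min (f i) M)).
    rewrite mean1// (le_trans (ltW Hr))//.
    apply: (@le_trans _ _ (\sum_(i <- r) (p [:: i] * Num.min (f i) M)%:E)).
      rewrite big_seq [leRHS]big_seq; apply: lee_sum => i ir.
      rewrite lee_fin ler_wpM2l// le_min lexx/=.
      by rewrite /M (big_rem i ir)/= lerDl sumr_ge0.
    exact: esum_ge_seq.
  have := mean_ge0 (n := 1) (X := wsum (fun i => f i - Num.min (f i) M)%R)
    (fun w _ => wsum_ge0 w fg).
  case: (mean 1 (wsum (fun i => f i - Num.min (f i) M)%R)) split => [gb||]//.
  - case: (mean 1 _) low => [m||]//; rewrite lee_fin => low.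
    rewrite -EFinD => -[gbm] _; exists gb => //; lra.
  - by case: (mean 1 _) low.
move=> gb8.
have fg i : (0 <= f i - Num.min (f i) M)%R by rewrite subr_ge0 ge_min lexx.
have m0 i : (0 <= Num.min (f i) M <= M)%R.
  by rewrite le_min f0 M0 ge_min lexx orbT.
have m0' i : (0 <= Num.min (f i) M)%R by have /andP[] := m0 i.
have mb : mean 1 (wsum (fun i => Num.min (f i) M)) = (b - gb)%:E.
  have : mean 1 (wsum (fun i => f i - Num.min (f i) M)%R) +
     mean 1 (wsum (fun i => Num.min (f i) M)) = b%:E.
    rewrite -fb -meanD; [|by move=> *; exact: wsum_ge0..].
    apply: eq_mean => w _; rewrite /wsum -big_split/=.
    by apply: eq_bigr => i _; rewrite subrK.
  rewrite gbE; case: (mean 1 _) => [m||]//; rewrite -EFinD => -[<-].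
  by congr EFin; ring.
have [m mp Hm] := weak_law_bounded m0 mb e8.
set f1 := (fun i => Num.min (f i) M) in mb Hm m0 m0' *.
set g := (fun i => f i - Num.min (f i) M)%R in gbE fg *.
pose b1 := (b - gb)%R.
(* The incomplete block costs at most [2 * m * b1], which is below [eps * n / 8] for such [n]. *)
exists (Num.truncn (8 / eps * (m%:R * (2 * b1)))).+1 => n Nn.
have -> : deviation f b n = deviation (fun i => f1 i + g i)%R (b1 + gb)%R n.
  suff <- : f = (fun i => f1 i + g i)%R by rewrite /b1 subrK.
  by apply/funext => i; rewrite /f1 /g addrC subrK.
apply: (le_trans (deviation_add _ _ _ _ _)).
have hg : deviation g gb n <= (2 * (n%:R * gb))%:E by exact: deviation_le.
have b10 : (0 <= b1)%R.
  by rewrite -lee_fin -mb mean_ge0// => w _; exact: wsum_ge0.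
have h1 : deviation f1 b1 n <= (n%:R * (eps / 8) + m%:R * (2 * b1))%:E.
  rewrite {1}(divn_eq n m) (le_trans (deviationD _ _ _ _))// EFinD leeD//.
    rewrite (le_trans (deviation_mul _ _ _ _))//.
    apply: (@le_trans _ _ ((n %/ m)%:R%:E * (eps / 8 * m%:R)%:E)).
      by rewrite lee_wpmul2l// lee_fin.
    rewrite -EFinM lee_fin mulrCA mulrC -natrM ler_wpM2r ?(ltW e8)//.
    by rewrite ler_nat leq_trunc_div.
  rewrite (le_trans (deviation_le _ m0' mb))// lee_fin mulrCA.
  by rewrite ler_wpM2r ?mulr_ge0// ler_nat ltnW// ltn_pmod.
apply: le_trans (leeD h1 hg) _; rewrite -EFinD lee_fin.
have : (8 / eps * (m%:R * (2 * b1)) < n%:R)%R.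
  by rewrite (lt_le_trans (truncnS_gt _))// ler_nat.
rewrite mulrAC ltr_pdivrMr// => h2.
have : (n%:R * gb <= n%:R * (eps / 8))%R by rewrite ler_wpM2l.
have : (0 <= n%:R * eps)%R by rewrite mulr_ge0// ltW.
lra.
Qed.

Lemma expRN_le (x : R) : (0 < x)%R -> (expR (- x) <= x^-1)%R.
Proof.
move=> x0; rewrite expRN lef_pV2 ?posrE ?expR_gt0//.
by rewrite (le_trans _ (expR_ge1Dx x))// lerDr.
Qed.

(** With [q = - t / n] the integrand is at most [expR (- (t * k))] when the truncated sum is at
    least [n * (1 + k)], and at most [expR t] otherwise; the weak law makes the second case rare.
    Since [q < 0], a lower bound on [wsum f] is what is needed, so [f] may be truncated and its mean
    may be infinite. *)
Lemma exists_small_mean_pos f (tau : R) : (forall i, 0 <= f i)%R ->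
  1 < \esum_(i in I) (p [:: i] * f i)%:E -> (0 < tau)%R ->
  exists n (q : R), [/\ (0 < n)%N,
    mean n (fun w => expR (q * (wsum f w - n%:R))) <= tau%:E &
    mean 1 (fun w => expR (q * (wsum f w - 1))) < +oo].
Proof.
move=> f0 /esum_gt_seq[r [ur rI Hr]] tau0.
pose M := (\sum_(i <- r) f i)%R.
have M0 : (0 <= M)%R by exact: sumr_ge0.
pose f1 i := Num.min (f i) M.
have f1M i : (0 <= f1 i <= M)%R by rewrite /f1 le_min f0 M0 ge_min lexx orbT.
have f10 i : (0 <= f1 i)%R by have /andP[] := f1M i.
have f1f i : (f1 i <= f i)%R by rewrite /f1 ge_min lexx.
have b1fin : mean 1 (wsum f1) \is a fin_num.
  rewrite ge0_fin_numE; last by apply: mean_ge0 => *; exact: wsum_ge0.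
  rewrite (@le_lt_trans _ _ (mean 1 (fun=> M)))//.
    apply: le_mean => w [sw _]; case: w sw => [|i []]//= _; rewrite wsum1.
    by have /andP[] := f1M i.
  by rewrite mean_cst ?ltry.
pose b1 := fine (mean 1 (wsum f1)).
have f1b : mean 1 (wsum f1) = b1%:E by rewrite fineK.
have b1gt : (1 < b1)%R.
  rewrite -lte_fin -f1b mean1// (lt_le_trans Hr)//.
  apply: (@le_trans _ _ (\sum_(i <- r) (p [:: i] * f1 i)%:E)).
    rewrite big_seq [leRHS]big_seq; apply: lee_sum => i ir.
    rewrite lee_fin ler_wpM2l// le_min lexx/=.
    by rewrite /M (big_rem i ir)/= lerDl sumr_ge0.
  exact: esum_ge_seq.
pose k := ((b1 - 1) / 2)%R.
have k0 : (0 < k)%R by rewrite divr_gt0// subr_gt0.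
have kE : (b1 = 1 + 2 * k)%R by rewrite /k; lra.
pose t := (2 / tau / k)%R.
have t0 : (0 < t)%R by apply: divr_gt0 => //; exact: divr_gt0.
have etk : (expR (- (t * k)) <= tau / 2)%R.
  have -> : (t * k = 2 / tau)%R by rewrite /t divfK ?gt_eqF.
  by rewrite (le_trans (expRN_le _)) ?divr_gt0// invf_div.
clearbody t k.
(* By Markov's inequality the rare case weighs at most [eps / k]; times [expR t] this is
   [tau / 2]. *)
pose eps := (tau / 2 * k * expR (- t))%R.
have eps0 : (0 < eps)%R.
  by apply: mulr_gt0; [apply: mulr_gt0 => //; exact: divr_gt0|exact: expR_gt0].
have [N HN] := weak_law f10 f1b eps0.
pose n := N.+1.
have n0 : (0 < n%:R :> R)%R by rewrite ltr0n.
have dev := HN n (leqnSn N).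
exists n, (- (t / n%:R))%R; split => //; last first.
  apply: (@le_lt_trans _ _ (mean 1 (fun=> expR (t / n%:R)))); last first.
    by rewrite mean_cst ?ltry// expR_ge0.
  apply: le_mean => w _; rewrite ler_expR mulNr -mulrN opprB.
  have : (0 <= t / n%:R * wsum f w)%R.
    by apply: mulr_ge0; [rewrite divr_ge0// ltW|exact: wsum_ge0].
  by rewrite mulrBr mulr1; lra.
apply: (@le_trans _ _ (mean n (fun w => expR (- (t * k)) +
    (expR t / (n%:R * k)) * `|wsum f1 w - n%:R * b1|)%R)).
  apply: le_mean => w ww.
  have F1F : (wsum f1 w <= wsum f w)%R by exact: ler_sum.
  have F10 : (0 <= wsum f1 w)%R by exact: wsum_ge0.
  apply: (@le_trans _ _ (expR (- (t / n%:R) * (wsum f1 w - n%:R)))).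
    rewrite ler_expR !mulNr lerN2; apply: ler_wpM2l; first by rewrite divr_ge0// ltW.
    by rewrite lerB.
  have [big|small] := leP (n%:R * (1 + k))%R (wsum f1 w).
    apply: (@le_trans _ _ (expR (- (t * k)))).
      rewrite ler_expR mulNr lerN2 mulrAC ler_pdivlMr//.
      rewrite -mulrA ler_wpM2l ?(ltW t0)//; lra.
    by rewrite lerDl mulr_ge0// divr_ge0 ?expR_ge0// mulr_ge0// ltW.
  apply: (@le_trans _ _ (expR t)).
    rewrite ler_expR mulNr lerNl mulrAC ler_pdivlMr//.
    have : (0 <= t * wsum f1 w)%R by rewrite mulr_ge0// ltW.
    by rewrite mulrBr; lra.
  have far : (1 <= (n%:R * k)^-1 * `|wsum f1 w - n%:R * b1|)%R.
    rewrite mulrC ler_pdivlMr ?mul1r ?mulr_gt0//.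
    rewrite distrC (le_trans _ (ler_norm _))// kE; lra.
  rewrite -mulrA -[leLHS]mulr1 ler_wpDl ?expR_ge0//.
  by rewrite ler_wpM2l// expR_ge0.
have cst0 : (0 <= expR t / (n%:R * k))%R.
  by rewrite divr_ge0 ?expR_ge0// mulr_ge0// ltW.
rewrite meanD; last 2 first.
- by move=> *; exact: expR_ge0.
- by move=> *; exact: mulr_ge0.
rewrite mean_cst ?expR_ge0// meanZl//.
apply: (@le_trans _ _ ((tau / 2)%:E +
    (expR t / (n%:R * k))%:E * (eps * n%:R)%:E)).
  by rewrite leeD ?lee_fin// lee_wpmul2l// lee_fin.
rewrite -EFinM -EFinD lee_fin /eps expRN le_eqVlt; apply/orP; left; apply/eqP.
have := expR_gt0 t; set e := expR t => e0.
by field; rewrite !gt_eqF.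
Qed.

Variable c' : R.
Hypothesis c'0 : (0 < c')%R.
Hypothesis p_cat_le : forall n m u v, words I n u -> words I m v ->
  (p (u ++ v) <= c' * (p u * p v))%R.

Lemma mean_expR_cat f a n m :
  mean m (fun w => expR (a * wsum f w)) < +oo ->
  mean (n + m) (fun w => expR (a * wsum f w)) <=
  c'%:E * (mean n (fun w => expR (a * wsum f w)) *
           mean m (fun w => expR (a * wsum f w))).
Proof.
move=> fin; rewrite {1}/mean esum_words_cat; last first.
  by move=> w; rewrite lee_fin mulr_ge0// expR_ge0.
rewrite -esum_mul//; last 2 first.
- by move=> w; rewrite mulr_ge0// expR_ge0.
- by move=> w; rewrite mulr_ge0// expR_ge0.
rewrite -esumZl ?(ltW c'0)//; last first.
  by move=> u; apply: esum_ge0 => v _; rewrite lee_fin mulr_ge0// mulr_ge0// expR_ge0.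
apply: le_esum => u uW; rewrite -esumZl ?(ltW c'0)//; last first.
  by move=> v; rewrite lee_fin mulr_ge0// mulr_ge0// expR_ge0.
apply: le_esum => v vW; rewrite -EFinM lee_fin wsum_cat mulrDr expRD.
rewrite [leRHS](_ : _ = c' * (p u * p v) *
   (expR (a * wsum f u) * expR (a * wsum f v)))%R; last by ring.
by rewrite ler_wpM2r ?mulr_ge0 ?expR_ge0// (p_cat_le uW vW).
Qed.

(** The arithmetic-geometric inequality for the two halves, then stationarity. No multiplicative
    constant appears, so the step can be iterated arbitrarily often. *)
Lemma mean_expR_double f a m :
  mean (m + m) (fun w => expR (a / 2 * wsum f w)) <=
  mean m (fun w => expR (a * wsum f w)).
Proof.
pose X w := expR (a * wsum f w).
have X0 w : (0 <= X w)%R by exact: expR_ge0.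
apply: (@le_trans _ _ (mean (m + m) (fun w => 2^-1 * (X \o take m) w +
    2^-1 * (X \o drop m) w)%R)).
  apply: le_mean => w ww; rewrite -{1}(cat_take_drop m w) wsum_cat /X /=.
  set x := (a * wsum f (take m w))%R; set y := (a * wsum f (drop m w))%R.
  have -> : (a / 2 * (wsum f (take m w) + wsum f (drop m w)) = x / 2 + y / 2)%R.
    by rewrite /x /y; ring.
  rewrite expRD.
  have ex : (expR x = expR (x / 2) ^+ 2)%R by rewrite -expRM_natl; congr expR; lra.
  have ey : (expR y = expR (y / 2) ^+ 2)%R by rewrite -expRM_natl; congr expR; lra.
  rewrite ex ey.
  have : (0 <= (expR (x / 2) - expR (y / 2)) ^+ 2)%R by exact: sqr_ge0.
  by rewrite sqrrB; lra.
rewrite meanD; last 2 first.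
- by move=> *; rewrite mulr_ge0//=.
- by move=> *; rewrite mulr_ge0//=.
rewrite meanZl//; last by move=> w; exact: X0.
rewrite meanZl//; last by move=> w; exact: X0.
rewrite mean_take// mean_drop// -ge0_muleDl ?lee_fin//.
have -> : (2^-1)%:E + (2^-1)%:E = 1 :> \bar R by rewrite -EFinD; congr EFin; lra.
by rewrite mul1e.
Qed.

Lemma mean_expR_pow2 f a j :
  mean (2 ^ j) (fun w => expR (a / (2 ^ j)%:R * wsum f w)) <=
  mean 1 (fun w => expR (a * wsum f w)).
Proof.
elim: j => [|j IH].
  by rewrite expn0 divr1.
apply: le_trans IH.
apply: le_trans (mean_expR_double _ _ _).
have -> : (a / (2 ^ j.+1)%:R = a / (2 ^ j)%:R / 2)%R.
  by rewrite expnS mulnC natrM invfM mulrA.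
by rewrite expnS mul2n -addnn.
Qed.

(** The lengths are [n = k * 2 ^ N] with [k] fixed such that [t / k <= q0]. Doubling is free, so the
    constant [c'] is paid only [k] times and the bound does not depend on [N]. *)
Lemma mean_expR_bound f (q0 t : R) : (0 < q0)%R -> (0 <= t)%R ->
  (forall i, 0 <= f i)%R ->
  mean 1 (fun w => expR (q0 * wsum f w)) < +oo ->
  exists Q : R, forall N, exists2 n, (N < n)%N &
    mean n (fun w => expR (t / n%:R * wsum f w)) <= Q%:E.
Proof.
move=> q00 t0 f0 fin.
pose k := (Num.truncn (t / q0)).+1.
have tk : (t / k%:R <= q0)%R.
  by rewrite ler_pdivrMr ?ltr0n// mulrC -ler_pdivrMr// ltW// truncnS_gt.
set A := mean 1 _ in fin.
have A0 : 0 <= A by apply: mean_ge0 => *; exact: expR_ge0.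
have Afin : A \is a fin_num by rewrite ge0_fin_numE.
exists ((c' * fine A) ^+ k)%R => N.
pose m := (2 ^ N)%N.
exists (k * m)%N.
  by rewrite (leq_trans (ltn_expl N (ltnSn 1)))// leq_pmull.
have a0 : (0 <= t / (k * m)%:R)%R by rewrite divr_ge0.
set a := (t / _)%R in a0 *.
have Am : mean m (fun w => expR (a * wsum f w)) <= A.
  have -> : a = (t / k%:R / (2 ^ N)%:R)%R by rewrite /a natrM invfM mulrA.
  apply: (le_trans (mean_expR_pow2 _ _ _)).
  by apply: le_mean => w _; rewrite ler_expR ler_wpM2r// wsum_ge0.
suff gen i : mean (i * m) (fun w => expR (a * wsum f w)) <=
    ((c' * fine A) ^+ i)%:E by exact: gen.
elim: i => [|i IH].
  rewrite mul0n expr0 /mean words0 esum_set1.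
    by rewrite p_nil /wsum big_nil mulr0 expR0 mulr1.
  by rewrite lee_fin mulr_ge0// expR_ge0.
rewrite mulSn (le_trans (mean_expR_cat _ _))//.
  by rewrite (le_lt_trans IH)// ltry.
rewrite exprS -!mulrA EFinM EFinM fineK//.
rewrite lee_wpmul2l ?lee_fin ?(ltW c'0)//.
by rewrite lee_pmul//; apply: mean_ge0 => *; exact: expR_ge0.
Qed.

(* With q = t / n for a fixed large t, the weak law controls the words with
   wsum f w below n (1 - k); the others are few, and 2 x <= d x^2 + d^-1 with the
   exponential moment at 2 t / n bounds their contribution. *)
Lemma exists_small_mean_neg f (b q0 tau : R) : (forall i, 0 <= f i)%R ->
  mean 1 (wsum f) = b%:E -> (b < 1)%R -> (0 < q0)%R ->
  mean 1 (fun w => expR (q0 * wsum f w)) < +oo -> (0 < tau)%R ->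
  exists n (q : R), [/\ (0 < n)%N,
    mean n (fun w => expR (q * (wsum f w - n%:R))) <= tau%:E &
    mean 1 (fun w => expR (q * (wsum f w - 1))) < +oo].
Proof.
move=> f0 fb b1 q00 fin tau0.
pose k := ((1 - b) / 2)%R.
have k0 : (0 < k)%R by rewrite divr_gt0// subr_gt0.
have kE : (b = 1 - 2 * k)%R by rewrite /k; lra.
pose t := (3 / tau / k)%R.
have t0 : (0 < t)%R by apply: divr_gt0 => //; exact: divr_gt0.
have etk : (expR (- (t * k)) <= tau / 3)%R.
  have -> : (t * k = 3 / tau)%R by rewrite /t divfK ?gt_eqF.
  by rewrite (le_trans (expRN_le _)) ?divr_gt0// invf_div.
have t20 : (0 <= 2 * t)%R by rewrite mulr_ge0// ltW.
have [Q HQ] := mean_expR_bound q00 t20 f0 fin.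
(* Three terms share [tau] equally: [expR (- (t * k))] by the choice of [t], [d] times the
   exponential moment by this choice, and the deviation term by the choice of [eps] below. *)
pose d := (tau / 3 / (`|Q| + 1))%R.
have Q1 : (0 < `|Q| + 1)%R by rewrite ltr_pwDr.
have d0 : (0 < d)%R by rewrite !divr_gt0.
have dQ : (d * Q <= tau / 3)%R.
  rewrite /d mulrAC ler_pdivrMr// ler_wpM2l ?divr_ge0 ?(ltW tau0)//.
  by rewrite (le_trans (ler_norm _))// lerDl.
clearbody t k d.
pose eps := (d * k * (tau / 3))%R.
have eps0 : (0 < eps)%R.
  by apply: mulr_gt0; [exact: mulr_gt0|exact: divr_gt0].
have [N HN] := weak_law f0 fb eps0.
have [n Nn Hn] := HQ (maxn N (Num.truncn (t / q0))).
move: Nn; rewrite gtn_max => /andP[Nn tn].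
have n0' : (0 < n)%N by exact: leq_ltn_trans Nn.
have n0 : (0 < n%:R :> R)%R by rewrite ltr0n.
have dev := HN n (ltnW Nn).
have dnk0 : (0 < d * (n%:R * k))%R by rewrite !mulr_gt0.
exists n, (t / n%:R)%R; split => //; last first.
  apply: le_lt_trans fin; apply: le_mean => w _; rewrite ler_expR.
  have S0 := wsum_ge0 w f0.
  have tn0 : (0 <= t / n%:R)%R by rewrite divr_ge0// ltW.
  apply: (@le_trans _ _ (t / n%:R * wsum f w)%R).
    by rewrite ler_wpM2l// gerBl.
  rewrite ler_wpM2r// ler_pdivrMr// mulrC -ler_pdivrMr//.
  by rewrite (le_trans (ltW (truncnS_gt _)))// ler_nat.
apply: (@le_trans _ _ (mean n (fun w => expR (- (t * k)) +
    (d * expR (2 * t / n%:R * wsum f w) +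
    (d * (n%:R * k))^-1 * `|wsum f w - n%:R * b|))%R)).
  apply: le_mean => w ww.
  have F0 : (0 <= wsum f w)%R by exact: wsum_ge0.
  have P1 : (0 <= d * expR (2 * t / n%:R * wsum f w))%R.
    by rewrite mulr_ge0 ?expR_ge0// ltW.
  have P2 : (0 <= (d * (n%:R * k))^-1 * `|wsum f w - n%:R * b|)%R.
    by rewrite mulr_ge0// invr_ge0 ltW.
  have [small|big] := leP (wsum f w) (n%:R * (1 - k))%R.
    apply: (@le_trans _ _ (expR (- (t * k)))).
      rewrite ler_expR mulrAC ler_pdivrMr// -mulrN -mulrA ler_wpM2l ?(ltW t0)//; lra.
    by rewrite lerDl addr_ge0.
  set y := expR (t / n%:R * (wsum f w - n%:R))%R.
  have y0 : (0 < y)%R by exact: expR_gt0.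
  have y2 : (y ^+ 2 <= expR (2 * t / n%:R * wsum f w))%R.
    rewrite /y -expRM_natl ler_expR -!mulrA ler_wpM2l// ler_wpM2l ?(ltW t0)//.
    by rewrite ler_wpM2l// ?invr_ge0// gerBl.
  have far : (d^-1 <= (d * (n%:R * k))^-1 * `|wsum f w - n%:R * b|)%R.
    rewrite invfM -mulrA ler_peMr ?invr_ge0 ?(ltW d0)//.
    rewrite mulrC ler_pdivlMr ?mul1r ?mulr_gt0//.
    rewrite (le_trans _ (ler_norm _))// kE; lra.
  have : (d * y ^+ 2 <= d * expR (2 * t / n%:R * wsum f w))%R.
    by rewrite ler_wpM2l// ltW.
  have : (y <= d * y ^+ 2 + d^-1)%R.
    have -> : (d * y ^+ 2 + d^-1 = y + d * ((y - d^-1 / 2) ^+ 2 + 3 / 4 * d^-1 ^+ 2))%R.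
      by field; rewrite gt_eqF.
    rewrite lerDl mulr_ge0 ?(ltW d0)// addr_ge0 ?sqr_ge0//.
    by rewrite mulr_ge0 ?sqr_ge0.
  have := expR_ge0 (- (t * k)); lra.
have ic0 : (0 <= (d * (n%:R * k))^-1)%R by rewrite invr_ge0 ltW.
rewrite meanD; last 2 first.
- by move=> *; exact: expR_ge0.
- move=> w _; apply: addr_ge0; last exact: mulr_ge0.
  by rewrite mulr_ge0 ?expR_ge0// ltW.
rewrite meanD; last 2 first.
- by move=> *; rewrite mulr_ge0 ?expR_ge0// ltW.
- by move=> *; exact: mulr_ge0.
rewrite mean_cst ?expR_ge0// meanZl ?(ltW d0)//.
rewrite meanZl//.
apply: (@le_trans _ _ ((tau / 3)%:E + (d%:E * Q%:E +
    ((d * (n%:R * k))^-1)%:E * (eps * n%:R)%:E))).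
  rewrite leeD ?lee_fin// leeD//.
    by rewrite lee_wpmul2l ?lee_fin ?(ltW d0).
  by rewrite lee_wpmul2l// lee_fin.
rewrite -!EFinM -!EFinD lee_fin.
have -> : ((d * (n%:R * k))^-1 * (eps * n%:R) = tau / 3)%R.
  by rewrite /eps; field; rewrite !gt_eqF.
lra.
Qed.

End Weights.

(** * Branches, cylinders and bounded distortion *)

Section Branches.
Context {R : realType} (I : set nat) (J : nat -> set R) (F : R -> R).
Hypothesis HB : base_map I J F.

Let itvJ i : I i -> is_interval (J i).
Proof. by move=> Ii; have [] := base_interval HB Ii. Qed.

Let openJ i : I i -> open (J i).
Proof. by move=> Ii; have [] := base_interval HB Ii. Qed.

Lemma base_sub01 i x : I i -> J i x -> 0 < x < 1.
Proof.
move=> Ii Jx; have [_ _ _ /(_ _ Jx)] := base_interval HB Ii.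
by rewrite /= in_itv.
Qed.

Lemma base_img01 i x : I i -> J i x -> 0 < F x < 1.
Proof.
move=> Ii Jx; have : (F @` J i) (F x) by exists x.
by rewrite (base_full HB Ii) /= in_itv.
Qed.

Lemma base_derivable i x : I i -> J i x ->
  derivable F x 1 /\ derivable (derive1 F) x 1.
Proof.
move=> Ii Jx.
have [G [U [oU JU C2 GF]]] := base_C2 HB Ii.
have nJ (y : R) : J i y -> \forall z \near y, G z = F z.
  move=> Jy; have := open_nbhs_nbhs (conj (openJ Ii) Jy).
  by apply: filterS => z; exact: GF.
have [dG ddG _] := C2 x (JU _ (subset_closure Jx)).
split; first exact: near_eq_derivable (nJ x Jx) dG.
apply: near_eq_derivable ddG.
have := open_nbhs_nbhs (conj (openJ Ii) Jx).
apply: filterS => y Jy; rewrite !derive1E.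
exact: near_eq_derive (nJ y Jy).
Qed.

Lemma base_constants : exists lam B : R, [/\ 1 < lam, 0 <= B,
  (forall i x, I i -> J i x -> lam <= `|derive1 F x|) &
  (forall i x, I i -> J i x ->
     `|derive1 (derive1 F) x| <= B * (derive1 F x) ^+ 2)].
Proof.
have [i0 Ii0] : I !=set0.
  apply/set0P/eqP => I0; have := base_card HB; rewrite I0 card_le0.
  by move=> /eqP/seteqP[/(_ 0%N) + _]; apply.
have [x0 Jx0] : J i0 !=set0 by have [] := base_interval HB Ii0.
have [lam lam1 Hlam] : exists2 lam : R, 1 < lam &
    forall i x, I i -> J i x -> lam <= `|derive1 F x|.
  have := base_expanding HB.
  set S := [set _ | _ in _].
  have SP i x : I i -> J i x -> S (`|derive1 F x|)%:E.
    by move=> Ii Jx; exists x => //; exists i.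
  have := ereal_inf_lbound (SP i0 x0 Ii0 Jx0).
  case E : (ereal_inf S) => [r||]// _; rewrite lte_fin => r1; exists r => // i x Ii Jx.
  by rewrite -lee_fin -E; exact: ereal_inf_lbound (SP i x Ii Jx).
have := base_distortion HB.
set S := [set _ | _ in _].
have SP i x : I i -> J i x -> S (`|derive1n 2 F x| / (derive1 F x) ^+ 2)%:E.
  by move=> Ii Jx; exists x => //; exists i.
have := ereal_sup_ubound (SP i0 x0 Ii0 Jx0).
case E : (ereal_sup S) => [r||]// _ _.
exists lam, `|r|; split => // i x Ii Jx.
have := ereal_sup_ubound (SP i x Ii Jx); rewrite E lee_fin.
have d0 : 0 < derive1 F x ^+ 2.
  rewrite exprn_even_gt0//= -normr_gt0 (lt_le_trans _ (Hlam i x Ii Jx))//.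
  by rewrite (lt_trans _ lam1).
rewrite ler_pdivrMr// => H; apply: (le_trans H).
by rewrite ler_wpM2r ?(ltW d0)// ler_norm.
Qed.

Variables lam B : R.
Hypothesis lam1 : 1 < lam.
Hypothesis B0 : 0 <= B.
Hypothesis Hlam : forall i x, I i -> J i x -> lam <= `|derive1 F x|.
Hypothesis HBd : forall i x, I i -> J i x ->
  `|derive1 (derive1 F) x| <= B * (derive1 F x) ^+ 2.

Let lam0 : 0 < lam. Proof. exact: lt_trans lam1. Qed.

Lemma derive1F_neq0 i x : I i -> J i x -> derive1 F x != 0.
Proof.
by move=> Ii Jx; rewrite -normr_gt0 (lt_le_trans lam0)// (Hlam Ii Jx).
Qed.

Let Jbetween i x y z : I i -> J i x -> J i y -> x <= z <= y -> J i z.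
Proof. by move=> Ii Jx Jy; exact: (itvJ Ii Jx Jy). Qed.

Let Jin i x y z : I i -> J i x -> J i y -> z \in `[x, y] -> J i z.
Proof. by move=> Ii Jx Jy; rewrite in_itv/=; exact: Jbetween. Qed.

Let Joo i x y z : I i -> J i x -> J i y -> z \in `]x, y[ -> J i z.
Proof.
move=> Ii Jx Jy; rewrite in_itv/= => /andP[xz zy].
by apply: (Jbetween Ii Jx Jy); rewrite (ltW xz) (ltW zy).
Qed.

Let isderF i x : I i -> J i x -> is_derive x 1 F (derive1 F x).
Proof.
by move=> Ii Jx; rewrite derive1E; apply: DeriveDef => //;
  have [] := base_derivable Ii Jx.
Qed.

Let isderF' i x : I i -> J i x ->
  is_derive x 1 (derive1 F) (derive1 (derive1 F) x).
Proof.
by move=> Ii Jx; rewrite [X in is_derive _ _ _ X]derive1E; apply: DeriveDef => //;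
  have [] := base_derivable Ii Jx.
Qed.

Lemma base_MVT i x y : I i -> J i x -> J i y -> x < y ->
  exists2 c, x < c < y & F y - F x = derive1 F c * (y - x).
Proof.
move=> Ii Jx Jy xy; have [||c + ->] := @MVT _ F (derive1 F) x y xy.
- by move=> z zxy; apply: isderF (Joo Ii Jx Jy zxy).
- apply: derivable_within_continuous => z zxy.
  by have [] := base_derivable Ii (Jin Ii Jx Jy zxy).
- by rewrite in_itv; exists c.
Qed.

Lemma base_sign i x y : I i -> J i x -> J i y -> 0 < derive1 F x * derive1 F y.
Proof.
move=> Ii.
wlog xy : x y / x <= y.
  move=> H Jx Jy; have [xy|/ltW yx] := leP x y; first exact: H.
  by rewrite mulrC H.
move=> Jx Jy; rewrite ltNge; apply/negP => sg.
have [||c cxy Fc] := @IVT _ (derive1 F) x y 0 xy.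
- apply: derivable_within_continuous => z zxy.
  by have [] := base_derivable Ii (Jin Ii Jx Jy zxy).
- rewrite ge_min le_max.
  have [fx|fx] := leP (derive1 F x) 0; have [fy|fy] := leP (derive1 F y) 0;
    rewrite /= ?(ltW fx) ?(ltW fy) ?orbT//.
  + have fx' : derive1 F x < 0 by rewrite lt_neqAle fx (derive1F_neq0 Ii).
    have fy' : derive1 F y < 0 by rewrite lt_neqAle fy (derive1F_neq0 Ii).
    by move: sg; rewrite leNgt nmulr_rgt0// fy'.
  + by move: sg; rewrite leNgt mulr_gt0.
have := derive1F_neq0 Ii (Jin Ii Jx Jy cxy).
by rewrite Fc eqxx.
Qed.

Lemma base_mono i : I i ->
  (forall x y, J i x -> J i y -> x < y -> F x < F y) \/
  (forall x y, J i x -> J i y -> x < y -> F y < F x).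
Proof.
move=> Ii; have [x0 Jx0] : J i !=set0 by have [] := base_interval HB Ii.
have [pos|neg] := ltP 0 (derive1 F x0); [left|right] => x y Jx Jy xy;
  have [c cxy E] := base_MVT Ii Jx Jy xy;
  have Jc : J i c by (apply: (Joo Ii Jx Jy); rewrite in_itv).
- rewrite -subr_gt0 E mulr_gt0 ?subr_gt0//.
  by rewrite -(pmulr_rgt0 _ pos) (base_sign Ii).
- rewrite -subr_lt0 E pmulr_llt0 ?subr_gt0//.
  have neg' : derive1 F x0 < 0 by rewrite lt_neqAle neg (derive1F_neq0 Ii).
  by rewrite -(nmulr_rgt0 _ neg') (base_sign Ii).
Qed.

Lemma base_expand i x y : I i -> J i x -> J i y ->
  lam * `|x - y| <= `|F x - F y|.
Proof.
move=> Ii; wlog xy : x y / x < y.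
  move=> H Jx Jy; have [xy|yx|->] := ltgtP x y; first exact: H.
    by rewrite distrC (distrC (F x)) H.
  by rewrite !subrr normr0 mulr0.
move=> Jx Jy; have [c cxy E] := base_MVT Ii Jx Jy xy.
rewrite distrC (distrC (F x)) E normrM ler_wpM2r//.
by apply: (Hlam Ii); apply: (Joo Ii Jx Jy); rewrite in_itv.
Qed.

(** Cauchy's mean value theorem for [h], the logarithm of the squared derivative, against [F],
    obtained by applying [MVT] to [k]. The quotient of the derivatives is twice the distortion ratio
    bounded by [B]. The square stands in for the absolute value because it is differentiable. *)
Lemma base_log_distortion i x y : I i -> J i x -> J i y ->
  `|ln `|derive1 F x| - ln `|derive1 F y| | <= B * `|F x - F y|.
Proof.
move=> Ii; wlog xy : x y / x < y.
  move=> H Jx Jy; have [xy|yx|->] := ltgtP x y; first exact: H.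
    by rewrite distrC (distrC (F x)) H.
  by rewrite !subrr normr0 mulr0.
move=> Jx Jy.
pose h z := ln (derive1 F z ^+ 2).
have lnsq z : J i z -> h z = 2 * ln `|derive1 F z|.
  move=> Jz; rewrite /h -[_ ^+ 2]real_normK ?num_real// lnXn ?normr_gt0 ?(derive1F_neq0 Ii)//.
  by rewrite mulr_natl.
pose dh z := 2 * derive1 (derive1 F) z / derive1 F z.
have hder z : J i z -> is_derive z 1 h (dh z).
  move=> Jz; have nz := derive1F_neq0 Ii Jz.
  have sq0 : 0 < derive1 F z ^+ 2 by rewrite exprn_even_gt0.
  have D1 := isderF' Ii Jz.
  have D2 : is_derive z 1 (fun t => derive1 F t ^+ 2)
     (2 * derive1 F z * derive1 (derive1 F) z).
    have := is_deriveX 2 D1; rewrite /GRing.scale/= expr1 => D.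
    by apply: is_derive_eq D _; rewrite -mulr_natl; ring.
  have D3 := @is_derive1_ln R (derive1 F z ^+ 2) sq0.
  have D4 := @is_derive1_comp _ (@ln R) (fun t => derive1 F t ^+ 2) z _ _ D3 D2.
  apply: is_derive_eq D4 _.
  by rewrite /dh; field.
pose k z := h z * (F y - F x) - F z * (h y - h x).
have kder z : J i z -> is_derive z 1 k (dh z * (F y - F x) - derive1 F z * (h y - h x)).
  move=> Jz; have D1 := hder z Jz; have D2 := isderF Ii Jz.
  rewrite /k.
  have E1 : is_derive z 1 (fun t => h t * (F y - F x)) (dh z * (F y - F x)).
    have := is_deriveZ (F y - F x) D1; rewrite /GRing.scale/= => D.
    have -> : (fun t => h t * (F y - F x)) = (F y - F x) \*: h.
      by apply/funext => t /=; rewrite /GRing.scale/= mulrC.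
    by apply: is_derive_eq D _; rewrite mulrC.
  have E2 : is_derive z 1 (fun t => F t * (h y - h x)) (derive1 F z * (h y - h x)).
    have := is_deriveZ (h y - h x) D2; rewrite /GRing.scale/= => D.
    have -> : (fun t => F t * (h y - h x)) = (h y - h x) \*: F.
      by apply/funext => t /=; rewrite /GRing.scale/= mulrC.
    by apply: is_derive_eq D _; rewrite mulrC.
  exact: is_deriveB E1 E2.
have [||c cxy] := @MVT _ k (fun z => dh z * (F y - F x) - derive1 F z * (h y - h x)) x y xy.
- by move=> z zxy; apply: kder; exact: Joo Ii Jx Jy zxy.
- apply: derivable_within_continuous => z zxy.
  by have [] := kder z (Jin Ii Jx Jy zxy).
have Jc := Joo Ii Jx Jy cxy.
have -> : k y - k x = 0 by rewrite /k; ring.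
move=> /esym/eqP; rewrite mulf_eq0 => /orP[]; last by rewrite subr_eq0 gt_eqF.
rewrite subr_eq0 => /eqP E.
have nc := derive1F_neq0 Ii Jc.
have hE : h y - h x = dh c / derive1 F c * (F y - F x).
  by apply: (mulfI nc); rewrite -E; field.
have : h x - h y = - (dh c / derive1 F c * (F y - F x)) by rewrite -hE opprB.
rewrite !lnsq// -mulrBr => hE'.
have -> : ln `|derive1 F x| - ln `|derive1 F y| =
   (derive1 (derive1 F) c / derive1 F c ^+ 2) * (F x - F y).
  apply: (@mulfI _ (2 : R)) => //; rewrite hE' /dh; field.
  by rewrite nc.
rewrite normrM ler_wpM2r// normrM normfV.
have c0 : 0 < derive1 F c ^+ 2 by rewrite exprn_even_gt0.
by rewrite (gtr0_norm c0) ler_pdivrMr// (HBd Ii).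
Qed.

Lemma base_between i x y z : I i -> J i x -> J i y ->
  x <= z <= y -> `|F z - F x| <= `|F y - F x| /\ `|F z - F y| <= `|F y - F x|.
Proof.
move=> Ii Jx Jy xzy; have Jz := Jbetween Ii Jx Jy xzy.
move: xzy => /andP[xz zy].
have [mono|mono] := base_mono Ii.
- have h a b : J i a -> J i b -> a <= b -> F a <= F b.
    move=> Ja Jb; rewrite le_eqVlt => /orP[/eqP ->//|ab].
    by rewrite ltW// mono.
  have := h _ _ Jx Jz xz; have := h _ _ Jz Jy zy => h1 h2.
  by rewrite (distrC (F z) (F y)) !ger0_norm ?subr_ge0//; [split; lra|lra].
- have h a b : J i a -> J i b -> a <= b -> F b <= F a.
    move=> Ja Jb; rewrite le_eqVlt => /orP[/eqP ->//|ab].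
    by rewrite ltW// mono.
  have := h _ _ Jx Jz xz; have := h _ _ Jz Jy zy => h1 h2.
  rewrite (distrC (F z) (F x)) (distrC (F y) (F x)).
  by rewrite !ger0_norm ?subr_ge0//; [split; lra|lra].
Qed.

Lemma base_step i x y : I i -> J i x -> J i y -> x != y ->
  `|ln `|F x - F y| - ln `|x - y| + geom_potential F x| <= B * `|F x - F y|.
Proof.
move=> Ii Jx Jy xy.
have [c [Jc E Ec]] : exists c, [/\ J i c,
    `|F x - F y| = `|derive1 F c| * `|x - y| &
    `|F c - F x| <= `|F x - F y|].
  have [lxy|lyx] : x < y \/ y < x.
    by move: xy; rewrite neq_lt => /orP[]; [left|right].
  - have [c cxy E] := base_MVT Ii Jx Jy lxy.
    have cxy' : x <= c <= y by move: cxy => /andP[? ?]; rewrite !ltW.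
    exists c; split; first exact: Jbetween cxy'.
      by rewrite distrC E normrM (distrC x).
    by rewrite (distrC (F x)); have [] := base_between Ii Jx Jy cxy'.
  - have [c cxy E] := base_MVT Ii Jy Jx lyx.
    have cxy' : y <= c <= x by move: cxy => /andP[? ?]; rewrite !ltW.
    exists c; split; first exact: Jbetween cxy'.
      by rewrite E normrM.
    by have [] := base_between Ii Jy Jx cxy'.
rewrite {1}E lnM ?posrE ?normr_gt0 ?subr_eq0 ?(derive1F_neq0 Ii)// addrK.
rewrite /geom_potential (le_trans (base_log_distortion Ii Jc Jx))//.
by rewrite ler_wpM2l.
Qed.

End Branches.

Definition word (I : set nat) (w : seq nat) : Prop := forall k, k \in w -> I k.

Lemma word_cons I i w : word I (i :: w) <-> I i /\ word I w.
Proof.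
split=> [H|[Ii Iw] k]; last by rewrite inE => /orP[/eqP ->|/Iw].
by split; [apply: H; rewrite mem_head|move=> k kw; apply: H; rewrite inE kw orbT].
Qed.

Lemma word_cat I u v : word I (u ++ v) <-> word I u /\ word I v.
Proof.
split=> [H|[Iu Iv] k]; last by rewrite mem_cat => /orP[/Iu|/Iv].
by split=> k kw; apply: H; rewrite mem_cat kw ?orbT.
Qed.

Lemma word_nil I : word I [::]. Proof. by []. Qed.

Section Cylinders.
Context {R : realType} (J : nat -> set R) (F : R -> R).

(* Unlike [cylinder], the empty word gives the unit interval, so that every
   cylinder is mapped onto it by its branch. *)
Fixpoint cyl (w : seq nat) : set R :=
  if w is i :: w' then J i `&` F @^-1` cyl w' else `]0, 1[%classic.

Definition len (w : seq nat) : R := fine (diam (cyl w)).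

Local Notation br w := (iter (size w) F).

(** Bounded distortion with one constant [D]: the length of the cylinder, the contraction of
    distances by the inverse branch and the exponential of the Birkhoff sum of the potential agree
    up to [D]. The bound [2 <= D] makes the ratios [len b / D] at most 1/2, so that [mass] decays
    with the number of blocks. *)
Record cyl_geometry (I : set nat) (D lam : R) : Prop := CylGeometry {
  geo_D : 2 <= D ;
  geo_lam : 1 < lam ;
  geo_expand : forall w x y, word I w -> cyl w x -> cyl w y ->
    lam ^+ size w * `|x - y| <= `|br w x - br w y| ;
  geo_lower : forall w x y, word I w -> cyl w x -> cyl w y ->
    len w * `|br w x - br w y| <= D * `|x - y| ;
  geo_upper : forall w x y, word I w -> cyl w x -> cyl w y ->
    `|x - y| <= D * (len w * `|br w x - br w y|) ;
  geo_pot_le : forall w x, word I w -> cyl w x ->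
    expR (birkhoff_sum F (geom_potential F) (size w) x) <= D * len w ;
  geo_pot_ge : forall w x, word I w -> cyl w x ->
    len w <= D * expR (birkhoff_sum F (geom_potential F) (size w) x) }.

Variable I : set nat.
Hypothesis HB : base_map I J F.

Lemma cyl01 w x : word I w -> cyl w x -> 0 < x < 1.
Proof.
case: w => [_|i w /word_cons[Ii _] [Jx _]]; first by rewrite /= in_itv.
exact: base_sub01 HB _ _ Ii Jx.
Qed.

Lemma cyl_cat u v x : word I v ->
  cyl (u ++ v) x <-> cyl u x /\ cyl v (br u x).
Proof.
move=> Iv; elim: u x => [|i u IH] x /=.
  split=> [vx|[]//]; split => //.
  by have := cyl01 Iv vx; rewrite in_itv.
rewrite -iterS iterSr; split=> [[Jx /IH[]]//|[[Jx uF] vF]]; split => //.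
by apply/IH.
Qed.

Lemma cyl_br01 w x : cyl w x -> 0 < br w x < 1.
Proof.
by elim: w x => [|i w IH] x; [rewrite /= in_itv|move=> [_ /IH]; rewrite -iterSr].
Qed.

Lemma cyl_surj w y : word I w -> 0 < y < 1 -> exists2 x, cyl w x & br w x = y.
Proof.
move=> + y01; elim: w => [_|i w IH /word_cons[Ii Iw]].
  by exists y => //; rewrite /= in_itv.
have [x' wx' <-] := IH Iw.
have : (F @` J i) x' by rewrite (base_full HB Ii) /= in_itv /= (cyl01 Iw wx').
by move=> [x Jx Fx]; exists x; rewrite /= -?iterS ?iterSr /= ?Fx//; split; rewrite /= ?Fx.
Qed.

Lemma cyl_inj u v x : word I u -> word I v -> size u = size v ->
  cyl u x -> cyl v x -> u = v.
Proof.
elim: u v x => [|i u IH] [|j v] x //= /word_cons[Ii Iu] /word_cons[Ij Iv].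
move=> [suv] [Ji Fu] [Jj Fv].
have -> : i = j by apply: (base_disjoint HB Ii Ij); exists x.
by rewrite (IH v (F x)).
Qed.

Lemma cyl_mono w : word I w ->
  (forall x y, cyl w x -> cyl w y -> x < y -> br w x < br w y) \/
  (forall x y, cyl w x -> cyl w y -> x < y -> br w y < br w x).
Proof.
elim: w => [_|i w IH /word_cons[Ii Iw]]; first by left.
have [lam [B [lam1 B0 Hlam HBd]]] := base_constants HB.
have [mi|mi] := base_mono HB lam1 Hlam Ii; have [mw|mw] := IH Iw;
  [left|right|right|left] => x y [Jx wx] [Jy wy] xy; rewrite [size _]/= !iterSr;
  by apply: mw => //; apply: mi.
Qed.

Lemma cyl_itv w : word I w -> is_interval (cyl w).
Proof.
elim: w => [_|i w IH /word_cons[Ii Iw]].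
  by move=> x y /=; rewrite !in_itv/= => /andP[x0 _] /andP[_ y1] z /andP[xz zy];
    rewrite in_itv/= (lt_le_trans x0 xz) (le_lt_trans zy y1).
move=> x y [Jx wx] [Jy wy] z xzy.
have [_ itvJ _ _] := base_interval HB Ii.
have Jz : J i z by exact: itvJ xzy.
split=> //=.
have [lam [B [lam1 B0 Hlam HBd]]] := base_constants HB.
move: xzy => /andP[]; rewrite le_eqVlt => /orP[/eqP <- //|xz].
rewrite le_eqVlt => /orP[/eqP -> //|zy].
have [mi|mi] := base_mono HB lam1 Hlam Ii.
  by apply: (IH Iw (F x) (F y)) => //; rewrite !ltW// mi.
by apply: (IH Iw (F y) (F x)) => //; rewrite !ltW// mi.
Qed.

Lemma cyl_open w : word I w -> open (cyl w).
Proof.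
elim: w => [_|i w IH /word_cons[Ii Iw]]; first exact: interval_open.
have [oJ _ _ _] := base_interval HB Ii.
rewrite openE => x [Jx wx].
have [dF _] := base_derivable HB Ii Jx.
have cF : {for x, continuous F}.
  by apply: differentiable_continuous; apply/derivable1_diffP.
apply: filterI; first exact: open_nbhs_nbhs.
by apply: cF; apply: open_nbhs_nbhs; split => //; exact: IH.
Qed.

Lemma cyl_diam w : word I w -> diam (cyl w) = (len w)%:E.
Proof.
move=> Iw; rewrite /len fineK// ge0_fin_numE.
  apply: (@le_lt_trans _ _ 1%:E); last by rewrite ltry.
  apply: ge_ereal_sup => _ [[x y] [/= wx wy] <-]; rewrite lee_fin.
  have := cyl01 Iw wx; have := cyl01 Iw wy; rewrite ler_norml => /andP[? ?] /andP[? ?].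
  by apply/andP; split; lra.
have [|x wx _] := @cyl_surj w (2^-1) Iw.
  by rewrite invr_gt0 ltr0n/= invf_lt1// ltr1n.
by apply: ereal_sup_ubound; exists (x, x) => //=; rewrite subrr normr0.
Qed.

Lemma len_ub w x y : word I w -> cyl w x -> cyl w y -> `|x - y| <= len w.
Proof.
move=> Iw wx wy; rewrite -lee_fin -cyl_diam//.
by apply: ereal_sup_ubound; exists (x, y).
Qed.

Lemma len_le w (c : R) : word I w ->
  (forall x y, cyl w x -> cyl w y -> `|x - y| <= c) -> len w <= c.
Proof.
move=> Iw H; rewrite -lee_fin -cyl_diam//.
by apply: ge_ereal_sup => _ [[x y] [/= wx wy] <-]; rewrite lee_fin H.
Qed.

Lemma birkhoff_sumS (g : R -> R) n x :
  birkhoff_sum F g n.+1 x = g x + birkhoff_sum F g n (F x).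
Proof.
rewrite /birkhoff_sum big_ord_recl/=; congr (_ + _); apply: eq_bigr => k _.
by rewrite /bump/= add0n -iterS iterSr.
Qed.

Lemma cyl_geometryP : exists D lam, cyl_geometry I D lam.
Proof.
have [lam [B [lam1 B0 Hlam HBd]]] := base_constants HB.
have lam0 : 0 < lam by exact: lt_trans lam1.
(* [La] solves [La * (b - b / lam) = b]. A one-step error [B * b], where [b] is the new distance and
   [c <= b / lam] the old one, is therefore at most [B * La * (b - c)], and these bounds telescope
   along the orbit. *)
pose La := lam / (lam - 1).
have lam10 : 0 < lam - 1 by rewrite subr_gt0.
have La0 : 0 <= La by rewrite divr_ge0 ?ltW.
pose E := expR (B * La).
have E1 : 1 <= E by rewrite -expR0 ler_expR mulr_ge0.
have expand w x y : word I w -> cyl w x -> cyl w y ->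
    lam ^+ size w * `|x - y| <= `|br w x - br w y|.
  elim: w x y => [|i w IH] x y; first by rewrite expr0 mul1r.
  move=> /word_cons[Ii Iw] [Jx wx] [Jy wy].
  rewrite [size _]/= !iterSr exprS mulrAC mulrC.
  apply: le_trans (IH _ _ Iw wx wy); rewrite ler_wpM2l ?exprn_ge0 ?(ltW lam0)//.
  by apply: (base_expand HB Hlam Ii).
have logd w x y : word I w -> cyl w x -> cyl w y -> x != y ->
    `|ln `|br w x - br w y| - ln `|x - y| +
      birkhoff_sum F (geom_potential F) (size w) x| <=
    B * La * (`|br w x - br w y| - `|x - y|).
  elim: w x y => [|i w IH] x y.
    by rewrite /= !subrr /birkhoff_sum big_ord0 addr0 normr0 mulr0.
  move=> /word_cons[Ii Iw] [Jx wx] [Jy wy] xy.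
  have ex := base_expand HB Hlam Ii Jx Jy.
  have xy0 : 0 < `|x - y| by rewrite normr_gt0 subr_eq0.
  have Fxy : F x != F y.
    by rewrite -subr_eq0 -normr_gt0 (lt_le_trans _ ex)// mulr_gt0.
  rewrite [size _]/= !iterSr birkhoff_sumS.
  have := IH _ _ Iw wx wy Fxy.
  have := base_step HB lam1 B0 Hlam HBd Ii Jx Jy xy.
  set a := `|br w (F x) - _|; set b := `|F x - F y| in ex *.
  set c := `|x - y| in ex *.
  set S := birkhoff_sum _ _ _ _; set g := geom_potential F x => h1 h2.
  have -> : ln a - ln c + (g + S) = (ln b - ln c + g) + (ln a - ln b + S) by ring.
  apply: (le_trans (ler_normD _ _)); apply: (le_trans (lerD h1 h2)).
  have -> : B * La * (a - c) = B * La * (b - c) + B * La * (a - b) by ring.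
  rewrite lerD2r -mulrA ler_wpM2l//.
  have cb : c <= b / lam by rewrite ler_pdivlMr// mulrC.
  have : La * (b - b / lam) <= La * (b - c) by rewrite ler_wpM2l// lerB.
  by apply: le_trans; rewrite le_eqVlt; apply/orP; left; apply/eqP;
    rewrite /La; field; rewrite !gt_eqF.
clearbody La.
have dist w x y : word I w -> cyl w x -> cyl w y ->
    let S := expR (birkhoff_sum F (geom_potential F) (size w) x) in
    `|br w x - br w y| * S <= E * `|x - y| /\
    `|x - y| <= E * (`|br w x - br w y| * S).
  move=> Iw wx wy S; have [->|xy] := eqVneq x y.
    by rewrite !subrr !normr0 mul0r !mulr0.
  have xy0 : 0 < `|x - y| by rewrite normr_gt0 subr_eq0.
  have ex := expand w x y Iw wx wy.
  have Fxy : 0 < `|br w x - br w y|.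
    by rewrite (lt_le_trans _ ex)// mulr_gt0// exprn_gt0.
  have Fxy1 : `|br w x - br w y| <= 1.
    have := cyl_br01 wx; have := cyl_br01 wy; rewrite ler_norml => /andP[? ?] /andP[? ?].
    by apply/andP; split; lra.
  have : `|ln `|br w x - br w y| - ln `|x - y| +
      birkhoff_sum F (geom_potential F) (size w) x| <= B * La.
    apply: (le_trans (logd w x y Iw wx wy xy)); rewrite ler_piMr ?mulr_ge0//.
    by rewrite lerBlDr (le_trans Fxy1)// lerDl ltW.
  rewrite /S; set s := birkhoff_sum _ _ _ _.
  rewrite -[in X in _ -> X](lnK Fxy) -[in X in _ -> X](lnK xy0).
  set p := ln `|br w x - br w y|; set q := ln `|x - y|.
  rewrite ler_norml => /andP[h1 h2].
  by rewrite /E -!expRD !ler_expR; split; lra.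
(* A point whose image is at distance at least 1/4 from that of [x]: evaluating [dist] there bounds
   the exponential of the Birkhoff sum by the length of the cylinder. *)
have pick w x : word I w -> cyl w x ->
    exists2 y, cyl w y & 4^-1 <= `|br w x - br w y|.
  move=> Iw wx; have /andP[b0 b1] := cyl_br01 wx.
  have [h|h] := leP (br w x) (2^-1).
  - have [|y wy yE] := @cyl_surj w (3 / 4) Iw; first by apply/andP; split; lra.
    exists y => //; rewrite yE distrC (le_trans _ (ler_norm _))//; lra.
  - have [|y wy yE] := @cyl_surj w (1 / 4) Iw; first by apply/andP; split; lra.
    exists y => //; rewrite yE (le_trans _ (ler_norm _))//; lra.
have pot_le w x : word I w -> cyl w x ->
    expR (birkhoff_sum F (geom_potential F) (size w) x) <= 4 * E * len w.
  move=> Iw wx; have [y wy far] := pick w x Iw wx.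
  have [h _] := dist w x y Iw wx wy.
  move: h; set S := expR _ => h.
  have S0 : 0 < S by exact: expR_gt0.
  have : 4^-1 * S <= E * len w.
    apply: (@le_trans _ _ (`|br w x - br w y| * S)); first by rewrite ler_pM2r.
    apply: (le_trans h); rewrite ler_wpM2l ?(le_trans _ E1)//.
    exact: len_ub.
  by move=> h'; lra.
have pot_ge w x : word I w -> cyl w x ->
    len w <= 2 * E * expR (birkhoff_sum F (geom_potential F) (size w) x).
  move=> Iw wx; apply: len_le => // y z wy wz.
  set S := expR _.
  have S0 : 0 < S by exact: expR_gt0.
  have h t : cyl w t -> `|x - t| <= E * S.
    move=> wt; have [_ /le_trans -> //] := dist w x t Iw wx wt.
    rewrite ler_wpM2l ?(le_trans _ E1)// ler_piMl ?(ltW S0)//.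
    have := cyl_br01 wx; have := cyl_br01 wt; rewrite ler_norml => /andP[? ?] /andP[? ?].
    by apply/andP; split; lra.
  have : `|y - z| <= `|x - y| + `|x - z|.
    by rewrite (distrC x y) -[y - z](subrKA x) ler_normD.
  by have := h y wy; have := h z wz; lra.
exists (4 * E ^+ 2), lam.
have EE : E <= E ^+ 2 by rewrite expr2 ler_peMl// (le_trans _ E1).
have E0 : 0 < E by exact: expR_gt0.
split => //.
- by lra.
- move=> w x y Iw wx wy.
  have := pot_ge w x Iw wx; have [] := dist w x y Iw wx wy.
  set S := expR _; set d := `|br w x - br w y| => h1 h2 h3.
  have d0 : 0 <= d by exact: normr_ge0.
  apply: (@le_trans _ _ (2 * E * S * d)); first by rewrite ler_wpM2r.
  have -> : 2 * E * S * d = 2 * E * (d * S) by ring.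
  apply: (@le_trans _ _ (2 * E * (E * `|x - y|))); first by rewrite ler_wpM2l// mulr_ge0// ltW.
  have : 0 <= E ^+ 2 * `|x - y| by rewrite mulr_ge0// sqr_ge0.
  by rewrite expr2; lra.
- move=> w x y Iw wx wy.
  have := pot_le w x Iw wx; have [] := dist w x y Iw wx wy.
  set S := expR _; set d := `|br w x - br w y| => h1 h2 h3.
  have d0 : 0 <= d by exact: normr_ge0.
  apply: (le_trans h2).
  have -> : 4 * E ^+ 2 * (len w * d) = E * (d * (4 * E * len w)) by ring.
  by rewrite ler_wpM2l ?(ltW E0)// ler_wpM2l.
- move=> w x Iw wx; apply: (le_trans (pot_le w x Iw wx)).
  rewrite ler_wpM2r ?ler_pM2l//.
  by have := len_ub Iw wx wx; rewrite subrr normr0.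
- move=> w x Iw wx; apply: (le_trans (pot_ge w x Iw wx)).
  by rewrite ler_wpM2r ?expR_ge0//; lra.
Qed.

End Cylinders.

(** * Hausdorff measure and dimension *)

Section HausdorffNull.
Context {R : realType}.
Implicit Types (A U : set R) (s d : R).
Local Open Scope ereal_scope.

Lemma hausdorff_weight_ge0 s U : 0 <= hausdorff_weight s U.
Proof. by rewrite /hausdorff_weight; case: ifP => // _; exact: poweR_ge0. Qed.

Lemma hausdorff_weight0 s : hausdorff_weight s (@set0 R) = 0.
Proof. by rewrite /hausdorff_weight eqxx. Qed.

Lemma diam_ge0 U : U !=set0 -> 0 <= diam U.
Proof.
move=> [x Ux]; apply: ereal_sup_ubound; exists (x, x) => //=.
by rewrite subrr normr0.
Qed.

Lemma diam0_le d : diam (@set0 R) <= d%:E.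
Proof. by apply: ge_ereal_sup => r [[x y] [] []]. Qed.

Lemma hausdorff_nullP s A : hausdorff_measure s A = 0 <->
  (forall d e : R, (0 < d)%R -> (0 < e)%R -> exists U : nat -> set R,
    [/\ A `<=` \bigcup_n U n, forall n, diam (U n) <= d%:E &
        \sum_(0 <= n <oo) hausdorff_weight s (U n) <= e%:E]).
Proof.
have w0 (U : nat -> set R) : 0 <= \sum_(0 <= n <oo) hausdorff_weight s (U n).
  by apply: nneseries_ge0 => n _ _; exact: hausdorff_weight_ge0.
split=> [H d e d0 e0|H].
  have : hausdorff_premeasure s d A < e%:E.
    rewrite (@le_lt_trans _ _ 0)// -H.
    by apply: ereal_sup_ubound; exists d.
  move=> /ereal_inf_lt[_ [U [AU Ud] <-]] /ltW We.
  by exists U; split.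
apply/eqP; rewrite eq_le; apply/andP; split; last first.
  apply: (@le_trans _ _ (hausdorff_premeasure s 1 A)).
    by apply: le_ereal_inf_tmp => _ [U _ <-]; exact: w0.
  by apply: ereal_sup_ubound; exists 1%R => //=; rewrite ltr01.
apply: ge_ereal_sup => _ [d d0 <-].
apply/lee_addgt0Pr => e e0; rewrite add0e.
have [U [AU Ud We]] := H d e d0 e0.
by apply: le_trans We; apply: ereal_inf_lbound; exists U.
Qed.

Lemma hausdorff_null_sub s A B : A `<=` B -> hausdorff_measure s B = 0 ->
  hausdorff_measure s A = 0.
Proof.
move=> AB /hausdorff_nullP H; apply/hausdorff_nullP => d e d0 e0.
have [U [BU Ud We]] := H d e d0 e0; exists U; split => //.
exact: subset_trans BU.
Qed.

Lemma hausdorff_null_le s t A : (0 <= s)%R -> (s <= t)%R -> hausdorff_measure s A = 0 ->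
  hausdorff_measure t A = 0.
Proof.
move=> s0 st /hausdorff_nullP H; apply/hausdorff_nullP => d e d0 e0.
have md0 : (0 < Num.min d 1)%R by rewrite lt_min d0 ltr01.
have [U [AU Ud We]] := H _ e md0 e0; exists U; split => //.
  by move=> n; rewrite (le_trans (Ud n))// lee_fin ge_min lexx.
apply: le_trans We; apply: lee_nneseries => n.
  by move=> _ _; exact: hausdorff_weight_ge0.
move=> _; rewrite /hausdorff_weight; case: ifPn => // /set0P U0.
have := diam_ge0 U0; have : diam (U n) <= 1%:E.
  by rewrite (le_trans (Ud n))// lee_fin ge_min lexx orbT.
case: (diam (U n)) => [r||]//; rewrite !lee_fin => r1 r0.
(* A set of diameter 0 is treated apart: its weight is 1 at exponent 0 and 0 at every positive
   exponent. *)
have [->|rn0] := eqVneq r 0%R.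
  have [<-|tn0] := eqVneq s t; first by [].
  rewrite [leLHS]powR0; first exact: powR_ge0.
  by rewrite gt_eqF// (le_lt_trans s0)// lt_neqAle tn0.
by apply: ger_powR => //; rewrite r1 andbT lt_neqAle eq_sym rn0.
Qed.

(** The covers of the definition are sequences; indices that encode no element of [S] receive the
    empty set, of weight 0 at every exponent. *)
Lemma hausdorff_null_countable (T : countType) s A :
  (forall d e : R, (0 < d)%R -> (0 < e)%R -> exists (S : set T) (U : T -> set R),
    [/\ A `<=` \bigcup_(x in S) U x, forall x, S x -> diam (U x) <= d%:E &
        \esum_(x in S) hausdorff_weight s (U x) <= e%:E]) ->
  hausdorff_measure s A = 0.
Proof.
move=> H; apply/hausdorff_nullP => d e d0 e0.
have [S [U [AU Ud We]]] := H d e d0 e0.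
pose W k := if pickle_inv k is Some x then if x \in S then U x else set0
            else set0.
have WE x : S x -> W (pickle x) = U x by move=> Sx; rewrite /W pickleK_inv mem_set.
exists W; split.
- by move=> y /AU[x Sx Uy]; exists (pickle x) => //; rewrite WE.
- move=> k; rewrite /W; case: pickle_inv => [x|]; last exact: diam0_le.
  by case: ifPn => [/set_mem/Ud//|_]; exact: diam0_le.
apply: le_trans We.
rewrite nneseries_esumT; last by move=> k; exact: hausdorff_weight_ge0.
have -> : \esum_(k in [set: nat]) hausdorff_weight s (W k) =
   \esum_(k in [set pickle x | x in S]) hausdorff_weight s (W k).
  rewrite [RHS]esum_mkcond; apply: eq_esum => k _.
  case: ifPn => // /negP kN; rewrite /W.
  have := @pickle_invK T k.
  case E : (pickle_inv k) => [x|]/= xk; last exact: hausdorff_weight0.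
  case: ifPn => [/set_mem Sx|_]; last exact: hausdorff_weight0.
  by exfalso; apply: kN; rewrite inE; exists x.
rewrite esum_image; last by move=> a b _ _ /(pcan_inj pickleK).
by apply: le_esum => x Sx; rewrite WE.
Qed.

Lemma hausdorff_null_bigcup s (A : nat -> set R) :
  (forall n, hausdorff_measure s (A n) = 0) ->
  hausdorff_measure s (\bigcup_n A n) = 0.
Proof.
move=> H; apply: (@hausdorff_null_countable (nat * nat)%type) => d e d0 e0.
have /choice[V HV] : forall n, exists U : nat -> set R,
    [/\ A n `<=` \bigcup_m U m, forall m, diam (U m) <= d%:E &
      \sum_(0 <= m <oo) hausdorff_weight s (U m) <= (e / (2 ^ n.+1)%:R)%:E].
  move=> n; apply/(hausdorff_nullP s (A n)).1 => //.
  by rewrite divr_gt0// ltr0n expn_gt0.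
exists ([set: nat] `*`` (fun=> [set: nat])), (fun nm => V nm.1 nm.2); split.
- move=> x [n _ Anx]; have [/(_ x Anx)[m _ Vx] _ _] := HV n.
  by exists (n, m).
- by move=> [n m] _; have [_ /(_ m)] := HV n.
rewrite -(@esum_esum _ _ _ _ _ (fun n m => hausdorff_weight s (V n m))); last first.
  by move=> *; exact: hausdorff_weight_ge0.
under eq_esum => n _.
  rewrite -nneseries_esumT; last by move=> m; exact: hausdorff_weight_ge0.
  over.
rewrite -nneseries_esumT; last first.
  by move=> n; apply: nneseries_ge0 => *; exact: hausdorff_weight_ge0.
apply: (@le_trans _ _ (\sum_(0 <= n <oo) (0 + (e / (2 ^ n.+1)%:R)%:E))).
  apply: lee_nneseries => n.
    by move=> _ _; apply: nneseries_ge0 => *; exact: hausdorff_weight_ge0.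
  by move=> _; rewrite add0e; have [] := HV n.
have := @epsilon_trick R (fun=> 0) e xpredT (fun=> lexx 0) (ltW e0).
by rewrite [X in _ <= X + _]eseries0// add0e.
Qed.

Lemma hausdorff_null_shift s A (c : R) : hausdorff_measure s A = 0 ->
  hausdorff_measure s [set (x + c)%R | x in A] = 0.
Proof.
move=> /hausdorff_nullP H; apply/hausdorff_nullP => d e d0 e0.
have [U [AU Ud We]] := H d e d0 e0.
have dE n : diam [set (x + c)%R | x in U n] = diam (U n).
  rewrite /diam; congr ereal_sup; apply/seteqP; split => r /=.
    move=> [[_ _] [/= [x Ux <-] [y Uy <-]] <-]; exists (x, y) => //=.
    by rewrite opprD addrACA subrr addr0.
  move=> [[x y] [/= Ux Uy] <-]; exists (x + c, y + c)%R => /=.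
    by split; [exists x|exists y].
  by rewrite opprD addrACA subrr addr0.
exists (fun n => [set (x + c)%R | x in U n]); split.
- by move=> _ [x Ax <-]; have [n _ Unx] := AU x Ax; exists n => //; exists x.
- by move=> n; rewrite dE.
apply: le_trans We; rewrite le_eqVlt; apply/orP; left; apply/eqP.
apply: eq_eseriesr => n _; rewrite /hausdorff_weight dE.
case: (eqVneq (U n) set0) => [->|/set0P [x Ux]].
  by rewrite image_set0 eqxx.
rewrite ifF//; apply/negbTE/set0P; exists (x + c)%R; by exists x.
Qed.

Lemma hausdorff_dim_le s A : (0 <= s)%R -> hausdorff_measure s A = 0 ->
  hausdorff_dim A <= s%:E.
Proof. by move=> s0 H; apply: ereal_inf_lbound; exists s. Qed.

Lemma hausdorff_dim_ge0 A : 0 <= hausdorff_dim A.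
Proof. by apply: le_ereal_inf_tmp => _ [s [s0 _] <-]; rewrite lee_fin. Qed.

Lemma hausdorff_dim_ltP s A : hausdorff_dim A < s%:E ->
  hausdorff_measure s A = 0.
Proof.
move=> /ereal_inf_lt[_ [t [t0 Ht] <-]]; rewrite lte_fin => /ltW ts.
exact: hausdorff_null_le t0 ts Ht.
Qed.

Lemma hausdorff_dim_sub A B : A `<=` B -> hausdorff_dim A <= hausdorff_dim B.
Proof.
move=> AB; apply: le_ereal_inf => _ [s [s0 Hs] <-]; exists s => //.
by split => //; exact: hausdorff_null_sub Hs.
Qed.

End HausdorffNull.

(** [N] intervals of length [1 / N] have total weight [1 / N] at exponent 2. The lemma serves to
    show that the dimension of the repeller is finite, so that [fine] in [delta0] is harmless. *)
Lemma hausdorff_null_unit (R : realType) :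
  hausdorff_measure (2 : R) [set x : R | 0 < x < 1] = 0%E.
Proof.
apply: (@hausdorff_null_countable _ nat) => d e d0 e0.
pose m := Num.min d e; have m0 : 0 < m by rewrite lt_min d0.
pose N := (Num.truncn m^-1).+1.
have N0 : 0 < N%:R :> R by rewrite ltr0n.
have Nm : N%:R^-1 <= m.
  by rewrite -[leRHS]invrK lef_pV2 ?posrE ?invr_gt0// ltW// truncnS_gt.
pose U (k : nat) := [set x : R | k%:R / N%:R <= x <= k.+1%:R / N%:R].
have Ud k : (diam (U k) <= (N%:R^-1)%:E)%E.
  apply: ge_ereal_sup => _ [[x y] [/= /andP[x1 x2] /andP[y1 y2]] <-].
  have h : k.+1%:R / N%:R = k%:R / N%:R + N%:R^-1 :> R by rewrite -natr1 mulrDl mul1r.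
  by rewrite lee_fin ler_norml; move: x2 y2; rewrite h; lra.
exists `I_N, U; split.
- move=> x /= /andP[x0 x1].
  have tN : (Num.truncn (x * N%:R) < N)%N.
    rewrite -(ltr_nat R) (le_lt_trans (_ : _ <= x * N%:R))//.
      by rewrite truncn_le// mulr_ge0// ltW.
    by rewrite gtr_pMl.
  exists (Num.truncn (x * N%:R)) => //=; apply/andP; split.
    by rewrite ler_pdivrMr// truncn_le// mulr_ge0// ltW.
  by rewrite ler_pdivlMr// ltW// truncnS_gt.
- move=> k _; apply: (le_trans (Ud k)); rewrite lee_fin (le_trans Nm)//.
  by rewrite ge_min lexx.
apply: esum_le_seq => r ur rN.
apply: (@le_trans _ _ (\sum_(k <- r) ((N%:R^-1) ^+ 2)%:E)%E).
  apply: lee_sum => k _; rewrite /hausdorff_weight; case: ifP => [_|/negbT U0].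
    by rewrite lee_fin sqr_ge0.
  have dk : (0 <= diam (U k))%E by apply: diam_ge0; apply/set0P.
  have := Ud k; case: (diam _) dk => [t||]//; rewrite !lee_fin => t0 tN.
  rewrite -powR_mulrn ?invr_ge0 ?ler0n//.
  by apply: ge0_ler_powR; rewrite ?nnegrE ?invr_ge0 ?ler0n.
rewrite sumEFin lee_fin big_const_seq count_predT iter_addr addr0 -[leLHS]mulr_natl.
apply: (@le_trans _ _ (N%:R * N%:R^-1 ^+ 2)).
  rewrite ler_wpM2r ?sqr_ge0// ler_nat -(size_iota 0 N); apply: uniq_leq_size => // k kr.
  by rewrite mem_iota; exact: rN.
rewrite expr2 mulrA mulfV ?gt_eqF// mul1r (le_trans Nm)//.
by rewrite ge_min lexx orbT.
Qed.

(** * Dimension bounds from cylinder covers and from separated codes *)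

Section Dimension.
Context {R : realType} (J : nat -> set R) (F : R -> R) (I : set nat).
Variables D lam : R.
Hypothesis HB : base_map I J F.
Hypothesis HG : cyl_geometry J F I D lam.

Local Notation br w := (iter (size w) F).
Local Notation cyl := (cyl J F).
Local Notation len := (len J F).

Lemma geo_D0 : 0 < D. Proof. by rewrite (lt_le_trans _ (geo_D HG)). Qed.

Lemma geo_lam0 : 0 < lam. Proof. by rewrite (lt_trans _ (geo_lam HG)). Qed.

Lemma cyl_nonempty w : word I w -> exists x, cyl w x.
Proof.
by move=> Iw; have [|x wx _] := cyl_surj HB (y := 2^-1) Iw; [lra|exists x].
Qed.

Lemma len_gt0 w : word I w -> 0 < len w.
Proof.
move=> Iw; have [x wx] := cyl_nonempty Iw.
by rewrite -(pmulr_rgt0 _ geo_D0) (lt_le_trans _ (geo_pot_le HG Iw wx))// expR_gt0.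
Qed.

Lemma len_ge0 w : 0 <= len w.
Proof.
rewrite /Defs.diam /len; have [[x wx]|E] := pselect (cyl w !=set0).
  by apply: fine_ge0; apply: diam_ge0; exists x.
have -> : cyl w = set0 by apply/eqP; apply: contrapT => /negP/set0P.
rewrite /diam (_ : [set _ | _ in _] = set0) ?ereal_sup0//.
by apply/seteqP; split => // r [[x y] [] []].
Qed.

Lemma cyl_dist1 w x y : word I w -> cyl w x -> cyl w y -> `|x - y| <= 1.
Proof.
move=> Iw wx wy; have := cyl01 HB Iw wx; have := cyl01 HB Iw wy.
by rewrite ler_norml => /andP[? ?] /andP[? ?]; apply/andP; split; lra.
Qed.

Lemma br_dist1 w x y : cyl w x -> cyl w y -> `|br w x - br w y| <= 1.
Proof.
move=> wx wy; have := cyl_br01 wx; have := cyl_br01 wy.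
by rewrite ler_norml => /andP[? ?] /andP[? ?]; apply/andP; split; lra.
Qed.

Lemma len_le1 w : word I w -> len w <= 1.
Proof. by move=> Iw; apply: (len_le HB) => // x y; exact: cyl_dist1. Qed.

Lemma len_lam w : word I w -> len w <= (lam ^+ size w)^-1.
Proof.
move=> Iw; have l0 : 0 < lam ^+ size w by rewrite exprn_gt0// geo_lam0.
apply: (len_le HB) => // x y wx wy.
rewrite -[leRHS]mul1r ler_pdivlMr// mulrC.
exact: le_trans (geo_expand HG Iw wx wy) (br_dist1 wx wy).
Qed.

Lemma len_cat_le u v : word I u -> word I v ->
  len (u ++ v) <= D * (len u * len v).
Proof.
move=> Iu Iv; apply: (len_le HB); first by apply/word_cat.
move=> x y /(cyl_cat HB _ _ Iv)[ux vx] /(cyl_cat HB _ _ Iv)[uy vy].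
apply: (le_trans (geo_upper HG Iu ux uy)).
rewrite ler_wpM2l ?(ltW geo_D0)// ler_wpM2l ?len_ge0//.
exact: (len_ub HB).
Qed.

Lemma len_cat_ge u v : word I u -> word I v ->
  len u * len v <= D * len (u ++ v).
Proof.
move=> Iu Iv; rewrite mulrC -ler_pdivlMr ?len_gt0//.
apply: (len_le HB) => // x' y' vx vy.
have [x ux xE] := cyl_surj HB Iu (cyl01 HB Iv vx).
have [y uy yE] := cyl_surj HB Iu (cyl01 HB Iv vy).
rewrite ler_pdivlMr ?len_gt0// mulrC -xE -yE.
apply: (le_trans (geo_lower HG Iu ux uy)); rewrite ler_wpM2l ?(ltW geo_D0)//.
apply: (len_ub HB); first by apply/word_cat.
- by apply/(cyl_cat HB _ _ Iv); rewrite xE.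
- by apply/(cyl_cat HB _ _ Iv); rewrite yE.
Qed.

Lemma hausdorff_weight_cyl s w : word I w ->
  hausdorff_weight s (cyl w) = (len w `^ s)%:E.
Proof.
move=> Iw; have [x wx] := cyl_nonempty Iw.
rewrite /hausdorff_weight ifF; last by apply/negbTE/set0P; exists x.
by rewrite (cyl_diam HB)// poweR_EFin.
Qed.

(** Borel-Cantelli: after removal of a finite set [X] of words the cylinders still cover [A], since
    each point lies in arbitrarily long ones, and the remaining sum is small. If it is at most [d]
    to the power [s], each remaining diameter is at most [d]. *)
Lemma hausdorff_null_limsup (G : set (seq nat)) s (A : set R) : 0 < s ->
  (forall w, G w -> word I w) ->
  (\esum_(w in G) (len w `^ s)%:E < +oo)%E ->
  (forall x, A x -> forall N, exists w, [/\ G w, (N <= size w)%N & cyl w x]) ->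
  hausdorff_measure s A = 0%E.
Proof.
move=> s0 GI fin HA; apply: hausdorff_null_countable => d e d0 e0.
have f0 w : (0 <= (len w `^ s)%:E)%E by rewrite lee_fin powR_ge0.
have de0 : 0 < Num.min e (d `^ s) by rewrite lt_min e0 powR_gt0.
have Sfin : (\esum_(w in G) (len w `^ s)%:E \is a fin_num)%E.
  by rewrite ge0_fin_numE// esum_ge0.
have [X [uX XG HX]] : exists X : seq (seq nat), [/\ uniq X,
    (forall w, w \in X -> G w) &
    (\esum_(w in G) (len w `^ s)%:E - (Num.min e (d `^ s))%:E <
     \sum_(w <- X) (len w `^ s)%:E)%E].
  by apply: esum_gt_seq; rewrite lteBlDr// lteDl// lte_fin.
have tail : (\esum_(w in G `&` ~` [set` X]) (len w `^ s)%:E <=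
    (Num.min e (d `^ s))%:E)%E.
  have := esumID [set` X] G (fun w => (len w `^ s)%:E) (fun w _ => f0 w).
  have XX : (\sum_(w <- X) (len w `^ s)%:E <=
      \esum_(w in G `&` [set` X]) (len w `^ s)%:E)%E.
    by apply: esum_ge_seq => // w wX; split => //; exact: XG.
  set P := (\esum_(w in G `&` [set` X]) _)%E in XX *.
  set T := (\esum_(w in G `&` ~` _) _)%E => ST.
  have := Sfin; rewrite ST fin_numD => /andP[Pf Tf].
  have := lt_le_trans HX XX; rewrite ST -(fineK Pf) -(fineK Tf).
  by rewrite -?EFinD -?EFinB lte_fin lee_fin; lra.
exists (G `&` ~` [set` X]), cyl; split.
- move=> x /HA /(_ (\max_(w <- X) size w).+1)[w [Gw sw wx]].
  exists w => //; split => //= wX.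
  by move: sw; rewrite ltnNge (big_rem w wX)/= leq_max leqnn.
- move=> w [Gw wX]; rewrite (cyl_diam HB) ?lee_fin; last exact: GI.
  have := le_trans (esum_term (conj Gw wX : (G `&` ~` [set` X]) w) (f0 w)) tail.
  rewrite lee_fin le_min => /andP[_].
  move=> h; rewrite leNgt; apply/negP => dl; move: h; rewrite leNgt.
  by rewrite gt0_ltr_powR// nnegrE ?len_ge0// ltW.
- apply: (@le_trans _ _ (\esum_(w in G `&` ~` [set` X]) (len w `^ s)%:E)%E).
    by apply: le_esum => w [Gw _]; rewrite hausdorff_weight_cyl//; exact: GI.
  by apply: le_trans tail _; rewrite lee_fin ge_min lexx.
Qed.

(** The bounds are strict against 0 and 1, so the cylinder lies in a compact part of the open unit
    interval. This gives nested intersections a point and disjoint cylinders a positive distance. *)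
Definition inner (w : seq nat) : Prop :=
  exists a b, [/\ 0 < a, b < 1 & forall x, cyl w x -> a <= x <= b].

Lemma inner_core u v : word I u -> word I v -> inner v ->
  exists a b, [/\ cyl u a, cyl u b & forall x, cyl (u ++ v) x -> a <= x <= b].
Proof.
move=> Iu Iv [a [b [a0 b1 vab]]].
have [x0 vx0] := cyl_nonempty Iv.
have /andP[ax0 x0b] := vab x0 vx0.
have [|a' ua' a'E] := cyl_surj HB (y := a) Iu; first by apply/andP; split; lra.
have [|b' ub' b'E] := cyl_surj HB (y := b) Iu; first by apply/andP; split; lra.
have [mono|mono] := cyl_mono HB Iu.
- exists a', b'; split => // x /(cyl_cat HB _ _ Iv)[ux vx].
  have := vab _ vx; rewrite -a'E -b'E => /andP[h1 h2].
  rewrite !leNgt; apply/andP; split; apply/negP => h.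
    by have := mono _ _ ux ua' h; rewrite ltNge h1.
  by have := mono _ _ ub' ux h; rewrite ltNge h2.
- exists b', a'; split => // x /(cyl_cat HB _ _ Iv)[ux vx].
  have := vab _ vx; rewrite -a'E -b'E => /andP[h1 h2].
  rewrite !leNgt; apply/andP; split; apply/negP => h.
    by have := mono _ _ ux ub' h; rewrite ltNge h2.
  by have := mono _ _ ua' ux h; rewrite ltNge h1.
Qed.

Lemma inner_cat u v : word I u -> word I v -> inner v -> inner (u ++ v).
Proof.
move=> Iu Iv inv; have [a [b [ua ub ab]]] := inner_core Iu Iv inv.
exists a, b; have /andP[a0 _] := cyl01 HB Iu ua.
by have /andP[_ b1] := cyl01 HB Iu ub.
Qed.

Definition prefixes (b : nat -> seq nat) k : seq (seq nat) :=
  [seq b i | i <- iota 0 k].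

Lemma prefixesS b k : prefixes b k.+1 = rcons (prefixes b k) (b k).
Proof. by rewrite /prefixes -addn1 iotaD map_cat/= add0n cats1. Qed.

Lemma flatten_prefixesS b k :
  flatten (prefixes b k.+1) = flatten (prefixes b k) ++ b k.
Proof. by rewrite prefixesS flatten_rcons. Qed.

Lemma word_flatten (v : seq (seq nat)) :
  (forall b, b \in v -> word I b) -> word I (flatten v).
Proof. by move=> H k /flattenP[b bv kb]; exact: H kb. Qed.

Lemma word_prefixes b k : (forall i, word I (b i)) -> word I (flatten (prefixes b k)).
Proof. by move=> H; apply: word_flatten => c /mapP[i _ ->]. Qed.

(** By [inner_core] each cylinder contains a compact interval that contains the next one; the
    supremum of the left ends of these intervals lies in all of them. *)
Lemma limit_point (b : nat -> seq nat) : (forall k, word I (b k)) ->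
  (forall k, inner (b k)) -> exists x, forall k, cyl (flatten (prefixes b k)) x.
Proof.
move=> Ib inb; pose pre k := flatten (prefixes b k).
have Ipre k : word I (pre k) by exact: word_prefixes.
have preS k : pre k.+1 = pre k ++ b k by exact: flatten_prefixesS.
have /choice[al /choice[be Hab]] : forall k, exists a c, [/\ cyl (pre k) a,
    cyl (pre k) c & forall x, cyl (pre k.+1) x -> a <= x <= c].
  by move=> k; rewrite preS; exact: inner_core.
have sub k m x : (k <= m)%N -> cyl (pre m) x -> cyl (pre k) x.
  move=> /subnK <-; elim: (m - k)%N => // n IH.
  by rewrite addSn preS => /(cyl_cat HB _ _ (Ib _))[/IH].
have ab k : al k <= be k.
  have [y yk] := cyl_nonempty (Ipre k.+1).
  by have [_ _ /(_ y yk)/andP[]] := Hab k; exact: le_trans.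
have bnd k m : al m <= be k.
  have [_ _ Hk] := Hab k; have [_ _ Hm] := Hab m.
  have [km|] := ltnP k m.
    by have [am _ _] := Hab m; have /andP[] := Hk _ (sub _ _ _ km am).
  rewrite leq_eqVlt => /orP[/eqP ->//|mk].
  have [ak _ _] := Hab k; have /andP[amk _] := Hm _ (sub _ _ _ mk ak).
  exact: le_trans amk (ab k).
have supA : has_sup (range al).
  by split; [exists (al 0%N); exists 0%N|exists (be 0%N) => _ [m _ <-]; exact: bnd].
exists (sup (range al)) => k; have [ak bk _] := Hab k.
apply: (cyl_itv HB (Ipre k) ak bk); apply/andP; split.
  by apply: sup_upper_bound => //; exists k.
by apply: ge_sup; [exists (al 0%N); exists 0%N|move=> _ [m _ <-]; exact: bnd].
Qed.

Lemma cyl_prefix_code (K : seq (seq nat)) (eta : R) u v x :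
  (forall b, b \in K -> word I b) -> 0 < eta ->
  (forall b b' x y, b \in K -> b' \in K -> b != b' -> cyl b x -> cyl b' y ->
    eta <= `|x - y|) ->
  (forall b, b \in u -> b \in K) -> (forall b, b \in v -> b \in K) ->
  size u = size v -> cyl (flatten u) x -> cyl (flatten v) x -> u = v.
Proof.
move=> KI eta0 gap; elim: u v x => [|b u IH] [|b' v] x //= uK vK [suv].
have bK : b \in K by apply: uK; rewrite mem_head.
have b'K : b' \in K by apply: vK; rewrite mem_head.
have uK' c : c \in u -> c \in K by move=> cu; apply: uK; rewrite inE cu orbT.
have vK' c : c \in v -> c \in K by move=> cu; apply: vK; rewrite inE cu orbT.
have Iu : word I (flatten u) by apply: word_flatten => c /uK'/KI.
have Iv : word I (flatten v) by apply: word_flatten => c /vK'/KI.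
move=> /(cyl_cat HB _ _ Iu)[bx ux] /(cyl_cat HB _ _ Iv)[b'x vx].
have bb' : b = b'.
  apply/eqP; apply: contraTT eta0 => nbb'.
  by rewrite -leNgt (le_trans (gap _ _ _ _ bK b'K nbb' bx b'x))// subrr normr0.
by move: vx; rewrite -bb' => vx; rewrite (IH v (br b x)).
Qed.

Section LowerBound.
Variables (s : R) (K : seq (seq nat)) (eta : R) (A : set R).
Hypothesis s0 : 0 < s.
Hypothesis uK : uniq K.
Hypothesis KI : forall b, b \in K -> word I b.
Hypothesis Kin : forall b, b \in K -> inner b.
Hypothesis eta0 : 0 < eta.
Hypothesis gap : forall b b' x y, b \in K -> b' \in K -> b != b' ->
  cyl b x -> cyl b' y -> eta <= `|x - y|.
Hypothesis Kbig : 1 <= \sum_(b <- K) (len b / D) `^ s.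

Definition coded x := exists2 b : nat -> seq nat, (forall k, b k \in K) &
  forall k, cyl (flatten (prefixes b k)) x.

Hypothesis KA : coded `<=` A.

(* The mass of the subtree of codes below v. A set of small diameter meets only
   one subtree of comparable mass, so a cheap cover would remove less than the
   total mass and leave a code, hence a point of A, uncovered. *)
Definition mass (v : seq (seq nat)) : R := \prod_(b <- v) (len b / D) `^ s.

Lemma mass_ge0 v : 0 <= mass v.
Proof. by apply: prodr_ge0 => b _; exact: powR_ge0. Qed.

Lemma mass_rcons v b : mass (rcons v b) = mass v * (len b / D) `^ s.
Proof. by rewrite /mass -cats1 big_cat big_seq1. Qed.

Let KE (v : seq (seq nat)) : (forall b, b \in v -> b \in K) -> forall b, b \in v -> word I b.
Proof. by move=> vK b /vK/KI. Qed.

(** Dividing every block length by [D] in [mass] absorbs the factor [D] that [len_cat_ge] costs at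
    each concatenation, so a single [D] remains whatever the number of blocks. *)
Lemma mass_le_len v : (forall b, b \in v -> b \in K) ->
  mass v <= (D * len (flatten v)) `^ s.
Proof.
move=> vK.
have -> : mass v = (\prod_(b <- v) (len b / D)) `^ s.
  rewrite /mass; elim: v {vK} => [|b v IH]; first by rewrite !big_nil powR1.
  rewrite !big_cons IH [in RHS]powRM ?divr_ge0 ?len_ge0 ?(ltW geo_D0)//.
  by apply: prodr_ge0 => c _; rewrite divr_ge0 ?len_ge0// (ltW geo_D0).
apply: ge0_ler_powR; rewrite ?(ltW s0)// ?nnegrE.
- by apply: prodr_ge0 => c _; rewrite divr_ge0 ?len_ge0// (ltW geo_D0).
- by rewrite mulr_ge0 ?len_ge0// (ltW geo_D0).
elim: v vK => [_|b v IH vK].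
  rewrite big_nil; have [x x01] := cyl_nonempty (word_nil I).
  have := geo_pot_le HG (word_nil I) x01.
  by rewrite /birkhoff_sum big_ord0 expR0.
have bK : b \in K by apply: vK; rewrite mem_head.
have vK' c : c \in v -> c \in K by move=> cv; apply: vK; rewrite inE cv orbT.
rewrite big_cons.
apply: (@le_trans _ _ (len b / D * (D * len (flatten v)))).
  by rewrite ler_wpM2l ?IH// divr_ge0 ?len_ge0// (ltW geo_D0).
rewrite mulrA divfK ?gt_eqF ?geo_D0//.
by apply: len_cat_ge; [exact: KI|apply: word_flatten; exact: KE].
Qed.

Lemma mass_small v : (forall b, b \in v -> b \in K) ->
  mass v <= (2^-1 `^ s) ^+ size v.
Proof.
elim: v => [_|b v IH vK]; first by rewrite /mass big_nil expr0.
have bK : b \in K by apply: vK; rewrite mem_head.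
rewrite /mass big_cons exprS; apply: ler_pM.
- exact: powR_ge0.
- exact: mass_ge0.
- apply: ge0_ler_powR; rewrite ?(ltW s0)// ?nnegrE ?divr_ge0 ?len_ge0 ?(ltW geo_D0)//.
  rewrite ler_pdivrMr ?geo_D0// (le_trans (len_le1 (KI bK)))//.
  by have := geo_D HG; lra.
- by apply: IH => c cv; apply: vK; rewrite inE cv orbT.
Qed.

Let Iprefixes b k : (forall k, b k \in K) -> word I (flatten (prefixes b k)).
Proof. by move=> bK; apply: word_prefixes => i; exact: KI. Qed.

Let prefixesK b k : (forall k, b k \in K) -> forall c, c \in prefixes b k -> c \in K.
Proof. by move=> bK c /mapP[i _ ->]. Qed.

(** [v] is the longest common part, up to depth [N], of the codes of points of [U]. Two points of
    [U] with different next blocks are at distance at least [eta] after the branch of [v], so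
    [len (flatten v) * eta] is at most [D * dU]. Without such a branching, or without a coded point
    in [U], a code of [N] blocks has mass at most [e]. *)
Lemma cover_block (b0 : nat -> seq nat) (U : set R) (dU e : R) :
  (forall k, b0 k \in K) -> 0 < e ->
  (forall x y, U x -> U y -> `|x - y| <= dU) ->
  exists v, [/\ forall c, c \in v -> c \in K,
    forall x, U x -> coded x -> cyl (flatten v) x &
    mass v <= (D ^+ 2 / eta * dU) `^ s + e].
Proof.
move=> b0K e0 UdU.
have [N HN] : exists N, (2^-1 `^ s) ^+ N <= e.
  have /cvgrPdist_le/(_ e e0)[N _ HN] : (fun n => (2^-1 `^ s) ^+ n : R) @ \oo --> (0 : R).
    apply: cvg_expr; rewrite ger0_norm ?powR_ge0//.
    apply: (@lt_le_trans _ _ (1 `^ s)); last by rewrite powR1.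
  by apply: gt0_ltr_powR => //; rewrite ?nnegrE ?invr_ge0//; lra.
  by exists N; have := HN N (leqnn N); rewrite sub0r normrN ger0_norm.
have small b : (forall k, b k \in K) -> mass (prefixes b N) <= e.
  move=> bK; apply: le_trans HN.
  by rewrite -[N in leRHS](size_iota 0) -(size_map b) mass_small//; exact: prefixesK.
have pos t : t <= e -> t <= (D ^+ 2 / eta * dU) `^ s + e.
  by move=> te; rewrite (le_trans te)// lerDr powR_ge0.
have [[x [Ux [b bK bx]]]|noU] := pselect (exists x, U x /\ coded x); last first.
  exists (prefixes b0 N); split; [exact: prefixesK| |exact/pos/small].
  by move=> x Ux cx; exfalso; apply: noU; exists x.
pose P n := `[< forall y, U y -> coded y -> cyl (flatten (prefixes b n)) y >].
have [PN|nPN] := boolP (P N).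
  by exists (prefixes b N); split; [exact: prefixesK|exact/asboolP|exact/pos/small].
have [n nPn minn] := ex_minnP (ex_intro (fun n => ~~ P n) N nPN).
case: n nPn minn => [|k] nPk mink.
  move: nPk => /asboolPn; case=> y Uy [by' b'K /(_ 0%N)].
  by [].
have Pk : P k by apply/negPn/negP => /mink; rewrite ltnn.
move: nPk => /asboolPn/existsNP[y /not_implyP[Uy /not_implyP[cy ny]]].
exists (prefixes b k); split; [exact: prefixesK|exact/asboolP|].
have yk := (asboolP _ Pk) y Uy cy.
have [b' b'K b'y] := cy.
have same : prefixes b k = prefixes b' k.
  apply: (cyl_prefix_code KI eta0 gap _ _ _ yk (b'y k)).
  - exact: prefixesK.
  - exact: prefixesK.
  - by rewrite !size_map.
have diff : b k != b' k.
  apply/eqP => bb'; apply: ny.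
  by rewrite flatten_prefixesS same bb' -flatten_prefixesS.
have := bx k.+1; rewrite flatten_prefixesS => /(cyl_cat HB _ _ (KI (bK k)))[xk bkx].
have := b'y k.+1; rewrite flatten_prefixesS -same.
move=> /(cyl_cat HB _ _ (KI (b'K k)))[_ b'ky].
have far := gap (bK k) (b'K k) diff bkx b'ky.
have lk := geo_lower HG (Iprefixes bK) xk yk.
have pfK : forall c, c \in prefixes b k -> c \in K by exact: prefixesK.
rewrite (le_trans (mass_le_len pfK))// ler_wpDr ?(ltW e0)//.
apply: ge0_ler_powR; rewrite ?(ltW s0)// ?nnegrE.
- by rewrite mulr_ge0 ?len_ge0// (ltW geo_D0).
- rewrite mulr_ge0 ?divr_ge0 ?sqr_ge0 ?(ltW eta0)//.
  by apply: le_trans (UdU x x Ux Ux); exact: normr_ge0.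
have h : len (flatten (prefixes b k)) * eta <= D * dU.
  have : len (flatten (prefixes b k)) * eta <= len (flatten (prefixes b k)) *
      `|br (flatten (prefixes b k)) x - br (flatten (prefixes b k)) y|.
    by rewrite ler_wpM2l ?len_ge0.
  move=> /le_trans; apply; apply: (le_trans lk).
  by rewrite ler_wpM2l ?(ltW geo_D0)// UdU.
have -> : D ^+ 2 / eta * dU = D * (D * dU / eta) by field; rewrite gt_eqF.
by rewrite ler_pM2l ?geo_D0// ler_pdivlMr.
Qed.

Lemma hausdorff_measure_neq0 : hausdorff_measure s A <> 0%E.
Proof.
move=> /hausdorff_nullP H.
have [c0 c0K] : exists c0, c0 \in K.
  case: (K) Kbig => [|c0 K' _]; first by rewrite big_nil ler10.
  by exists c0; rewrite mem_head.
pose C := (D ^+ 2 / eta) `^ s.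
have Deta : 0 < D ^+ 2 / eta by rewrite divr_gt0// exprn_gt0// geo_D0.
have C0 : 0 < C by rewrite powR_gt0.
have k0 : 0 < (4 * C)^-1 by rewrite invr_gt0 mulr_gt0.
have [U [AU Ud We]] := H 1 _ ltr01 k0.
have q0 : (0 : R) < 4^-1 by rewrite invr_gt0.
have /choice[v Hv] : forall n, exists v, [/\ forall c, c \in v -> c \in K,
    forall x, U n x -> coded x -> cyl (flatten v) x &
    ((mass v)%:E <= C%:E * hausdorff_weight s (U n) + (4^-1 / (2 ^ n.+1)%:R)%:E)%E].
  move=> n.
  pose dU := if U n == set0 then 0 else fine (diam (U n)).
  have wE : hausdorff_weight s (U n) = (dU `^ s)%:E.
    rewrite /hausdorff_weight /dU; case: (eqVneq (U n) set0) => [_|/set0P Un].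
      by rewrite powR0// gt_eqF.
    by rewrite -poweR_EFin fineK// ge0_fin_numE ?diam_ge0// (le_lt_trans (Ud n))// ltry.
  have dUP x y : U n x -> U n y -> `|x - y| <= dU.
    move=> Ux Uy; rewrite /dU ifF; last by apply/negbTE/set0P; exists x.
    rewrite -lee_fin fineK; last first.
      by rewrite ge0_fin_numE ?(le_lt_trans (Ud n)) ?ltry// diam_ge0//; exists x.
    by apply: ereal_sup_ubound; exists (x, y).
  have dU0 : 0 <= dU.
    rewrite /dU; case: (eqVneq (U n) set0) => [//|/set0P Un].
    by rewrite fine_ge0// diam_ge0.
  have e0 : (0 : R) < 4^-1 / (2 ^ n.+1)%:R by rewrite divr_gt0// ltr0n expn_gt0.
  have [v [vK vU vm]] := cover_block (fun=> c0K) e0 dUP.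
  exists v; split => //; rewrite wE -EFinM -EFinD lee_fin.
  by apply: (le_trans vm); rewrite lerD2r powRM// ltW.
have vsum : (\esum_(n in [set: nat]) (mass (v n))%:E < 1)%E.
  rewrite -nneseries_esumT; last by move=> n; rewrite lee_fin mass_ge0.
  have w0 n : (0 <= C%:E * hausdorff_weight s (U n))%E.
    by rewrite mule_ge0 ?lee_fin ?(ltW C0)// hausdorff_weight_ge0.
  apply: (@le_lt_trans _ _ (\sum_(0 <= n <oo)
     (C%:E * hausdorff_weight s (U n) + (4^-1 / (2 ^ n.+1)%:R)%:E))%E).
    apply: lee_nneseries => n; first by move=> _ _; rewrite lee_fin mass_ge0.
    by move=> _; have [] := Hv n.
  apply: le_lt_trans (epsilon_trick _ w0 (ltW q0)) _.
  rewrite nneseriesZl; last by move=> n _; exact: hausdorff_weight_ge0.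
  apply: (@le_lt_trans _ _ (C%:E * ((4 * C)^-1)%:E + (4^-1)%:E)%E).
    by rewrite leeD2r// lee_wpmul2l// lee_fin ltW.
  rewrite -EFinM -EFinD lte_fin invfM mulrCA divff ?gt_eqF//; lra.
pose T u := (\esum_(n in [set n | prefix u (v n)]) (mass (v n))%:E)%E.
have m0 n : (0 <= (mass (v n))%:E)%E by rewrite lee_fin mass_ge0.
have T0 : (T [::] < (mass [::])%:E)%E.
  rewrite /mass big_nil; apply: le_lt_trans vsum.
  by apply: esum_sub => // n _.
(* The masses of the children of [u] add up to at least [mass u] by [Kbig], while each [v n] extends
   at most one child, and then also [u]. So some child inherits the strict inequality. *)
have step u : exists b, (T u < (mass u)%:E)%E ->
    b \in K /\ (T (rcons u b) < (mass (rcons u b))%:E)%E.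
  have [Tu|Tu] := pselect (T u < (mass u)%:E)%E; last by exists [::].
  apply: contrapT => /forallNP nob.
  have {}nob b : b \in K -> ((mass (rcons u b))%:E <= T (rcons u b))%E.
    by move=> bK; rewrite leNgt; apply/negP => Tb; apply: (nob b).
  move: Tu; apply/negP; rewrite -leNgt.
  apply: (@le_trans _ _ (\sum_(b <- K) (mass (rcons u b))%:E)%E).
    rewrite sumEFin lee_fin.
    under eq_bigr do rewrite mass_rcons.
    by rewrite -mulr_sumr ler_peMr// mass_ge0.
  apply: (@le_trans _ _ (\sum_(b <- K) T (rcons u b))%E).
    by rewrite big_seq [leRHS]big_seq; apply: lee_sum => b bK; exact: nob.
  rewrite /T; under eq_bigr do rewrite esum_mkcond.
  rewrite -esum_sum; last by move=> n b _ _; case: ifP.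
  rewrite [leRHS]esum_mkcond; apply: le_esum => n _.
  have [[b bK pb]|nob'] := pselect (exists2 b, b \in K & prefix (rcons u b) (v n)).
    rewrite (bigD1_seq b)//= ifT ?inE// big1_seq ?adde0.
      rewrite ifT// inE/=; apply: prefix_trans pb.
      exact: prefix_rcons.
    move=> b' /andP[b'b _]; rewrite ifF//; apply/negbTE; rewrite notin_setE/= => pb'.
    move/prefixP: pb => [w wE]; move/prefixP: pb' => [w' w'E].
    move: w'E; rewrite wE -!cats1 -!catA => /eqP.
    by rewrite eqseq_cat// eqxx/= => /eqP[bb' _]; rewrite bb' eqxx in b'b.
  rewrite big1_seq; first by case: ifP.
  move=> b /andP[_ bK]; rewrite ifF//; apply/negbTE; rewrite notin_setE/= => pb.
  by apply: nob'; exists b.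
have [g Hg] := choice step.
pose u k := iter k (fun u => rcons u (g u)) [::].
have Tu k : (T (u k) < (mass (u k))%:E)%E.
  by elim: k => [//|k IH]; have [] := Hg _ IH.
pose be k := g (u k).
have beK k : be k \in K by have [] := Hg _ (Tu k).
have pre k : prefixes be k = u k.
  by elim: k => [//|k IH]; rewrite prefixesS IH.
(* The point coded by this branch lies in some [U n], hence [v n] is a prefix of the branch. But
   [T (v n)] contains the term [mass (v n)], against the strict inequality kept along the branch. *)
have [x bx] := limit_point (fun k => KI (beK k)) (fun k => Kin (beK k)).
have cx : coded x by exists be.
have [n _ Unx] := AU x (KA cx).
have [vK vU _] := Hv n.
have vn : v n = u (size (v n)).
  rewrite -pre; apply: (cyl_prefix_code KI eta0 gap vK _ _ (vU _ Unx cx) (bx _)).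
    exact: prefixesK.
  by rewrite size_map size_iota.
have := Tu (size (v n)); rewrite -vn; apply/negP; rewrite -leNgt.
rewrite /T; apply: (@esum_term _ _ [set m | prefix (v n) (v m)] _ n) => //=.
exact: prefix_refl.
Qed.

End LowerBound.

(** The cylinder of [b ++ e] lies between two points of the open interval [cyl b], and a ball around
    each of them is still inside [cyl b]. *)
Lemma cyl_gap b e : word I b -> word I e -> inner e -> exists2 eta, 0 < eta &
  forall x y, cyl (b ++ e) x -> ~ cyl b y -> eta <= `|x - y|.
Proof.
move=> Ib Ie ine; have [al [be [ba bb H]]] := inner_core Ib Ie ine.
have nb t : cyl b t -> exists2 r, 0 < r & forall z, `|t - z| < r -> cyl b z.
  move=> bt; have := open_nbhs_nbhs (conj (cyl_open HB Ib) bt).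
  by move=> /nbhs_ballP[r r0 br]; exists r.
have [r1 r10 H1] := nb _ ba; have [r2 r20 H2] := nb _ bb.
exists (Num.min r1 r2); first by rewrite lt_min r10.
move=> x y /H/andP[ax xb] nby; rewrite leNgt; apply/negP.
rewrite lt_min => /andP[x1 x2]; apply: nby.
have [ya|ay] := ltP y al.
  apply: H1; apply: le_lt_trans x1; rewrite !ger0_norm; lra.
have [yb|yb] := leP y be.
  by apply: (cyl_itv HB Ib ba bb); rewrite ay.
by apply: H2; apply: le_lt_trans x2; rewrite !ler0_norm; lra.
Qed.

Lemma cyl_gap_seq (K : seq (seq nat)) e : (forall b, b \in K -> word I b) ->
  word I e -> inner e -> exists2 eta, 0 < eta &
  forall b x y, b \in K -> cyl (b ++ e) x -> ~ cyl b y -> eta <= `|x - y|.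
Proof.
move=> + Ie ine; elim: K => [_|b K IH KI]; first by exists 1.
have [|eta eta0 H] := IH; first by move=> c cK; apply: KI; rewrite inE cK orbT.
have [|eta' eta'0 H'] := cyl_gap _ Ie ine (b := b); first by apply: KI; rewrite mem_head.
exists (Num.min eta eta'); first by rewrite lt_min eta0.
move=> c x y; rewrite inE ge_min => /orP[/eqP ->|cK] cx cy.
  by rewrite (H' x y)// orbT.
by rewrite (H c x y).
Qed.

(** The cylinders of [K0] are merely disjoint; appending [e] separates them and makes the blocks
    inner. By [len_cat_ge], the ratio [len (b ++ e) / D] is at least [len b] times [len e / D ^+ 2],
    whence the threshold. *)
Lemma hausdorff_dim_ge s e (A : set R) (K0 : seq (seq nat)) :
  0 < s -> word I e -> inner e -> uniq K0 ->
  (forall b, b \in K0 -> word I b) ->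
  (forall b b' x, b \in K0 -> b' \in K0 -> b != b' -> cyl b x -> ~ cyl b' x) ->
  (D ^+ 2 / len e) `^ s <= \sum_(b <- K0) len b `^ s ->
  (forall c : nat -> seq nat, (forall k, c k \in K0) ->
      forall x, (forall k, cyl (flatten (prefixes (fun i => c i ++ e) k)) x) ->
      A x) ->
  (s%:E <= hausdorff_dim A)%E.
Proof.
move=> s0 Ie ine uK KI Kdisj Kbig KA.
rewrite leNgt; apply/negP => /hausdorff_dim_ltP.
have [eta eta0 gap] := cyl_gap_seq KI Ie ine.
pose K := [seq b ++ e | b <- K0].
have inj_e : injective (fun b => b ++ e).
  move=> b b' bb'; have sb : size b = size b'.
    by have := congr1 size bb'; rewrite !size_cat => /addIn.
  by move/eqP: bb'; rewrite eqseq_cat// => /andP[/eqP].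
apply: (@hausdorff_measure_neq0 s K eta).
- exact: s0.
- by rewrite map_inj_uniq.
- by move=> _ /mapP[b bK ->]; apply/word_cat; split => //; exact: KI.
- by move=> _ /mapP[b bK ->]; apply: inner_cat => //; exact: KI.
- exact: eta0.
- move=> _ _ x y /mapP[b bK ->] /mapP[b' b'K ->] bb' bx b'y.
  have nbb' : b' != b by apply: contraNneq bb' => ->.
  apply: (gap b) => //; apply: (Kdisj b' b) => //.
  by move/(cyl_cat HB _ _ Ie): b'y => [].
- rewrite big_map.
  have De : 0 < len e / D ^+ 2 by rewrite divr_gt0 ?len_gt0// exprn_gt0// geo_D0.
  apply: (@le_trans _ _ (\sum_(b <- K0) (len e / D ^+ 2) `^ s * len b `^ s)).
    rewrite -mulr_sumr -[leLHS](_ : (len e / D ^+ 2) `^ s * (D ^+ 2 / len e) `^ s = 1).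
      by rewrite ler_wpM2l ?powR_ge0.
    rewrite -powRM ?(ltW De)//; last first.
      by rewrite divr_ge0 ?len_ge0// exprn_ge0// ltW// geo_D0.
    rewrite (_ : len e / D ^+ 2 * (D ^+ 2 / len e) = 1) ?powR1//.
    by field; rewrite !gt_eqF ?geo_D0 ?len_gt0.
  rewrite big_seq [leRHS]big_seq; apply: ler_sum => b bK.
  have lb := len_ge0 b; have lb0 := len_gt0 (KI b bK).
  rewrite -powRM ?(ltW De)//; apply: ge0_ler_powR; rewrite ?(ltW s0)// ?nnegrE.
  + by rewrite mulr_ge0// ltW.
  + by rewrite divr_ge0 ?len_ge0// (ltW geo_D0).
  rewrite ler_pdivlMr ?geo_D0//.
  have := len_cat_ge (KI b bK) Ie; rewrite -ler_pdivrMl ?geo_D0//.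
  apply: le_trans; rewrite le_eqVlt; apply/orP; left; apply/eqP.
  by field; rewrite gt_eqF ?geo_D0.
- move=> x [c cK cx].
  pose c' k := take (size (c k) - size e) (c k).
  have cE k : c k = c' k ++ e /\ c' k \in K0.
    have /mapP[b bK E] := cK k.
    by rewrite /c' E size_cat addnK take_size_cat.
  apply: (KA c'); first by move=> k; have [] := cE k.
  move=> k; rewrite (_ : (fun i => c' i ++ e) = c)//.
  by apply/funext => i; have [-> _] := cE i.
Qed.

End Dimension.

(** * Inner words, periodic points and the coding of the repeller *)

Section Repeller.
Context {R : realType} (J : nat -> set R) (F : R -> R) (I : set nat).
Variables D lam : R.
Hypothesis HB : base_map I J F.
Hypothesis HG : cyl_geometry J F I D lam.

Local Notation br w := (iter (size w) F).
Local Notation cyl := (cyl J F).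
Local Notation len := (len J F).
Local Notation R0 := (repeller (Delta0 I J) F).
Local Notation inner := (inner J F).

Lemma J_between i j x y z : I i -> I j -> i != j -> J i x -> J j y -> x < y ->
  J i z -> z < y.
Proof.
move=> Ii Ij ij Jx Jy xy Jz; rewrite ltNge; apply/negP => yz.
move/eqP: ij; apply; apply: (base_disjoint HB Ii Ij); exists y; split => //.
have [_ itvJ _ _] := base_interval HB Ii.
by apply: (itvJ x z) => //; rewrite (ltW xy).
Qed.

Lemma J_between' i j x y z : I i -> I j -> i != j -> J i x -> J j y -> x < y ->
  J j z -> x < z.
Proof.
move=> Ii Ij ij Jx Jy xy Jz; rewrite ltNge; apply/negP => zx.
move/eqP: ij; apply; apply: (base_disjoint HB Ii Ij); exists x; split => //.
have [_ itvJ _ _] := base_interval HB Ij.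
by apply: (itvJ z y) => //; rewrite zx (ltW xy).
Qed.

Lemma exists_two_letters : exists i j x y,
  [/\ I i, I j, i != j & J i x /\ J j y /\ x < y].
Proof.
have [f] := @pcard_leP _ _ `I_2 I (base_card HB).
have [i [j [Ii Ij ij]]] : exists i j, [/\ I i, I j & i != j].
  exists (f 0%N), (f 1%N); split; [exact: funS|exact: funS|].
  by apply/eqP => /(@inj _ _ _ f); rewrite !inE => /(_ isT isT).
have [x Jx] : J i !=set0 by have [] := base_interval HB Ii.
have [y Jy] : J j !=set0 by have [] := base_interval HB Ij.
have [xy|yx|xy] := ltgtP x y; first by exists i, j, x, y.
- by exists j, i, y, x; split; rewrite // eq_sym.
- exfalso; move/eqP: ij; apply; apply: (base_disjoint HB Ii Ij).
  by exists x; split => //; rewrite xy.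
Qed.

(** With [J i] to the left of [J j], a cylinder beginning with [i] stays to the left of [y]. A
    second letter keeps it away from the left end of [J i]: [j] if the branch of [i] increases, [i]
    if it decreases. Putting [i0] in front preserves the property. *)
Lemma exists_inner i0 : I i0 ->
  exists u, word I (i0 :: u) /\ inner (i0 :: u).
Proof.
move=> Ii0; have [i [j [x [y [Ii Ij ij [Jx [Jy xy]]]]]]] := exists_two_letters.
suff [u Iu inu] : exists2 u, word I u & inner u.
  exists u; split; first by apply/word_cons.
  by apply: (inner_cat HB (u := [:: i0])) => //; apply/word_cons.
have I1 : word I [:: i] by apply/word_cons.
have IiP : word I [:: i; j] by do 2!(apply/word_cons; split => //).
have IiiP : word I [:: i; i] by do 2!(apply/word_cons; split => //).
have /andP[x0 x1] := base_sub01 HB Ii Jx.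
have /andP[y0 y1] := base_sub01 HB Ij Jy.
have up z : J i z -> z <= y by move=> Jz; rewrite ltW// (J_between Ii Ij ij Jx Jy xy).
have mk t w : J i t -> word I w -> (forall z, cyl w z -> J i z /\ t < z) -> inner w.
  move=> Jt Iw H; have /andP[t0 _] := base_sub01 HB Ii Jt.
  by exists t, y; split => // z /H[Jz tz]; rewrite (ltW tz) up.
have [mono|mono] := cyl_mono HB I1.
- have [|t [Jt _] /= tE] := cyl_surj HB (y := x) I1; first by rewrite x0.
  exists [:: i; j] => //; apply: (mk t) => // z [Jz [JFz FFz]]; split => //.
  rewrite ltNge; apply/negP; rewrite le_eqVlt => /orP[/eqP zt|zt].
    by have := J_between' Ii Ij ij Jx Jy xy JFz; rewrite zt tE ltxx.
  have := mono z t; rewrite /= tE !in_itv/= x0 x1 (base_img01 HB Ii Jz).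
  move=> /(_ (conj Jz isT) (conj Jt isT) zt); apply/negP; rewrite -leNgt ltW//.
  exact: (J_between' Ii Ij ij Jx Jy xy).
- have [|t [Jt _] /= tE] := cyl_surj HB (y := y) I1; first by rewrite y0.
  exists [:: i; i] => //; apply: (mk t) => // z [Jz [JFz FFz]]; split => //.
  rewrite ltNge; apply/negP; rewrite le_eqVlt => /orP[/eqP zt|zt].
    by have := J_between Ii Ij ij Jx Jy xy JFz; rewrite zt tE ltxx.
  have := mono z t; rewrite /= tE !in_itv/= y0 y1 (base_img01 HB Ii Jz).
  move=> /(_ (conj Jz isT) (conj Jt isT) zt); apply/negP; rewrite -leNgt ltW//.
  exact: (J_between Ii Ij ij Jx Jy xy).
Qed.

Lemma repeller_F x : R0 x -> R0 (F x).
Proof. by move=> Rx n; rewrite -iterSr; exact: Rx. Qed.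

Lemma repeller_cyl x n : R0 x -> exists2 w, words I n w & cyl w x.
Proof.
elim: n x => [|n IH] x Rx; have [i Ii Jx] := Rx 0%N.
  exists [::]; first by rewrite words0.
  by rewrite /= in_itv /= (base_sub01 HB Ii Jx).
have [w [sw Iw] wx] := IH _ (repeller_F Rx).
exists (i :: w) => //; split; first by rewrite /= sw.
exact/word_cons.
Qed.

Lemma cyl_nth w x k : word I w -> cyl w x -> (k < size w)%N ->
  J (nth 0%N w k) (iter k F x).
Proof.
elim: w x k => [//|i w IH] x [|k] /word_cons[Ii Iw] [Jx wx] //= kw.
by rewrite -iterS iterSr; exact: IH.
Qed.

Lemma cyl_repeller x : (forall n, exists w, [/\ word I w, (n < size w)%N & cyl w x]) ->
  R0 x.
Proof.
move=> H n; have [w [Iw nw wx]] := H n.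
exists (nth 0%N w n); first by apply: Iw; rewrite mem_nth.
exact: cyl_nth.
Qed.

Lemma coded_repeller (b : nat -> seq nat) x : (forall k, word I (b k)) ->
  (forall k, (0 < size (b k))%N) ->
  (forall k, cyl (flatten (prefixes b k)) x) -> R0 x.
Proof.
move=> Ib b0 bx; apply: cyl_repeller => n.
exists (flatten (prefixes b n.+1)); split => //; first exact: word_prefixes.
elim: n => [|n IH]; first by rewrite /= cats0.
rewrite [in X in (_ < X)%N]flatten_prefixesS size_cat.
by have := b0 n.+1; lia.
Qed.

Lemma exists_inner_word : exists e, [/\ word I e, (0 < size e)%N & inner e].
Proof.
have [i [_ [_ [_ [Ii _ _ _]]]]] := exists_two_letters.
by have [u [Iu inu]] := exists_inner Ii; exists (i :: u).
Qed.

Lemma cyl_R0 w : word I w -> exists2 x, cyl w x & R0 x.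
Proof.
move=> Iw; have [e [Ie e0 ine]] := exists_inner_word.
pose b k := if k is 0%N then w ++ e else e.
have Ib k : word I (b k) by case: k => [|k] //=; apply/word_cat.
have inb k : inner (b k) by case: k => [|k] //=; exact: inner_cat HB _ _ Iw Ie ine.
have [x bx] := limit_point HB Ib inb.
exists x.
  have := bx 1%N; rewrite /= cats0 => /(cyl_cat HB _ _ Ie)[].
  by [].
apply: coded_repeller bx => // -[|k] //=; by rewrite size_cat ltn_addl.
Qed.

(** The point coded by the endless repetition of [w] and its image under the branch of [w] lie in
    the same cylinders, whose lengths tend to 0. *)
Lemma inner_periodic w : word I w -> (0 < size w)%N -> inner w ->
  exists2 x, cyl w x & Per (Delta0 I J) F (size w) x.
Proof.
move=> Iw w0 inw; pose b (k : nat) := w.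
have Ib k : word I (b k) by [].
have [x bx] := limit_point HB Ib (fun=> inw).
have flatS k : flatten (prefixes b k.+1) = w ++ flatten (prefixes b k).
  by elim: k => [//|k IH]; rewrite flatten_prefixesS [in LHS]IH -catA;
    congr (_ ++ _); rewrite flatten_prefixesS.
have Ip k : word I (flatten (prefixes b k)) by exact: word_prefixes.
have sz k : size (flatten (prefixes b k)) = (k * size w)%N.
  by elim: k => [//|k IH]; rewrite flatS size_cat IH mulSn.
have wx : cyl w x by have := bx 1%N; rewrite /= cats0.
exists x => //; split; first by apply: coded_repeller bx.
have Fbx k : cyl (flatten (prefixes b k)) (br w x).
  by have := bx k.+1; rewrite flatS => /(cyl_cat HB _ _ (Ip k))[].
apply/eqP; rewrite -subr_eq0 -normr_le0; apply/ler_addgt0Pr => e e0; rewrite add0r.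
have lam0 := geo_lam0 HG.
have [N HN] : exists N, lam^-1 ^+ N <= e.
  have /cvgrPdist_le/(_ e e0)[N _ HN] : (fun n => lam^-1 ^+ n : R) @ \oo --> (0 : R).
    apply: cvg_expr; rewrite ger0_norm ?invr_ge0 ?(ltW lam0)//.
    by rewrite invf_lt1// (geo_lam HG).
  exists N; have := HN N (leqnn N); rewrite sub0r normrN ger0_norm//.
  by rewrite exprn_ge0// invr_ge0 ltW.
apply: le_trans HN; apply: (le_trans (len_ub HB (Ip N) (Fbx N) (bx N))).
apply: (le_trans (len_lam HB HG (Ip N))); rewrite sz -exprVn.
apply: ler_wiXn2l; rewrite ?invr_ge0 ?(ltW lam0)//.
- by rewrite invf_le1// ltW// (geo_lam HG).
- by rewrite leq_pmulr.
Qed.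

(** Of three disjoint intervals the middle one is inner, so at most two letters fail. Such a letter
    may have no fixed point in its open interval, which matters when sums over fixed points are
    compared with sums over letters. *)
Lemma noninner_finite : exists L : seq nat, forall i, I i -> ~ inner [:: i] -> i \in L.
Proof.
pose N i := I i /\ ~ inner [:: i].
have three i j k x y z : N i -> N j -> N k -> i != j -> j != k ->
    J i x -> J j y -> J k z -> x < y -> y < z -> False.
  move=> [Ii _] [Ij nj] [Ik _] ij jk Jx Jy Jz xy yz; apply: nj.
  exists x, z; have /andP[x0 _] := base_sub01 HB Ii Jx.
  have /andP[_ z1] := base_sub01 HB Ik Jz; split => // t [Jt _].
  rewrite ltW/= ?ltW//; first exact: (J_between Ij Ik jk Jy Jz yz).
  exact: (J_between' Ii Ij ij Jx Jy xy).
have pt i : N i -> exists x, J i x.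
  by move=> [Ii _]; have [_ _ [x Jx] _] := base_interval HB Ii; exists x.
have neq i j x y : N i -> N j -> i != j -> J i x -> J j y -> x != y.
  move=> [Ii _] [Ij _] ij Jx Jy; apply: contraNneq ij => xy.
  by apply/eqP; apply: (base_disjoint HB Ii Ij); exists x; split; rewrite // xy.
have three' i j k : N i -> N j -> N k -> i != j -> j != k -> i != k -> False.
  move=> Ni Nj Nk ij jk ik; have [x Jx] := pt i Ni; have [y Jy] := pt j Nj.
  have [z Jz] := pt k Nk.
  have ji : j != i by rewrite eq_sym.
  have kj : k != j by rewrite eq_sym.
  have ki : k != i by rewrite eq_sym.
  have := neq _ _ _ _ Ni Nj ij Jx Jy; have := neq _ _ _ _ Nj Nk jk Jy Jz.
  have := neq _ _ _ _ Ni Nk ik Jx Jz.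
  rewrite !neq_lt => /orP[xz|zx] /orP[yz|zy] /orP[xy|yx].
  - exact: (three i j k x y z).
  - exact: (three j i k y x z).
  - exact: (three i k j x z y).
  - by have := lt_trans (lt_trans xz zy) yx; rewrite ltxx.
  - by have := lt_trans (lt_trans xy yz) zx; rewrite ltxx.
  - exact: (three j k i y z x).
  - exact: (three k i j z x y).
  - exact: (three k j i z y x).
have [[a Na]|noN] := pselect (exists a, N a); last first.
  by exists [::] => i Ii ni; exfalso; apply: noN; exists i.
have [[b [Nb ab]]|noN] := pselect (exists b, N b /\ a != b); last first.
  exists [:: a] => i Ii ni; rewrite inE; apply/negPn/negP => ia.
  by apply: noN; exists i; rewrite eq_sym.
exists [:: a; b] => i Ii ni; rewrite !inE; apply/negPn/negP.
rewrite negb_or => /andP[ia ib].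
by apply: (three' a b i) => //; rewrite eq_sym.
Qed.

Lemma cylinder_cyl w : word I w -> (0 < size w)%N -> cylinder J F w = cyl w.
Proof.
move=> Iw w0; apply/seteqP; split => x; last first.
  by move=> wx k kw; exact: cyl_nth.
elim: w x w0 Iw => [//|i w IH] x _ /word_cons[Ii Iw] wx.
have Jx : J i x by exact: (wx 0%N).
split => //=; case: w IH Iw wx => [|j w] IH Iw wx.
  by rewrite /= in_itv/= (base_img01 HB Ii Jx).
by apply: IH => // k kw; have := wx k.+1 kw; rewrite iterSr.
Qed.

End Repeller.

(** * Partition sums and pressure *)

Section LimSup.
Context {R : realType}.
Implicit Types (u : nat -> \bar R).
Local Open Scope ereal_scope.

Lemma limn_esup_le_esups u N : limn_esup u <= esups u N.
Proof.
rewrite limn_esup_lim; apply: lime_le; first exact: is_cvg_esups.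
by exists N => // n /= Nn; exact: nonincreasing_esups.
Qed.

Lemma limn_esup_gt u (x : \bar R) N : x < limn_esup u ->
  exists2 n, (N <= n)%N & x < u n.
Proof.
move=> xu; have := lt_le_trans xu (limn_esup_le_esups u N).
by move=> /ereal_sup_gt[_ [n /= Nn <-]]; exists n.
Qed.

Lemma limn_esup_ltoo u : limn_esup u < +oo ->
  exists N, forall n, (N <= n)%N -> u n < +oo.
Proof.
move=> H; apply: contrapT => /forallNP noN; move: H; apply/negP; rewrite -leNgt.
rewrite limn_esup_lim (_ : esups u = cst +oo) ?lim_cst//.
apply/funext => N /=; apply/eqP; rewrite -leye_eq.
have /existsNP[n /not_implyP[Nn /negP]] := noN N; rewrite -leNgt => un.
by apply: le_trans un _; apply: ereal_sup_ubound; exists n.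
Qed.

Lemma limn_einf_ltoo (v : nat -> R) (x : R) : limn_einf (fun n => (v n)%:E) < x%:E ->
  forall N, exists2 n, (N <= n)%N & (v n < x)%R.
Proof.
move=> H N.
have := @limn_esup_gt (-%E \o (fun n => (v n)%:E)) (- x%:E) N.
rewrite limn_esupN lteN2 => /(_ H)[n Nn h]; exists n => //.
by move: h; rewrite /= ?lteN2 ?lte_fin ?ltrN2.
Qed.

Lemma limn_einf_le (u : nat -> \bar R) (x : \bar R) :
  (forall N, exists2 n, (N <= n)%N & (u n <= x)%E) -> (limn_einf u <= x)%E.
Proof.
move=> H; rewrite limn_einf_lim; apply: lime_le; first exact: is_cvg_einfs.
apply: nearW => N; have [n Nn un] := H N.
by apply: le_trans un; apply: ereal_inf_lbound; exists n.
Qed.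

End LimSup.

Section PartitionSums.
Context {R : realType} (J : nat -> set R) (F : R -> R) (I : set nat).
Variables D lam : R.
Hypothesis HB : base_map I J F.
Hypothesis HG : cyl_geometry J F I D lam.
Variable f : nat -> R.

Local Notation br w := (iter (size w) F).
Local Notation cyl := (cyl J F).
Local Notation len := (len J F).
Local Notation R0 := (repeller (Delta0 I J) F).
Local Notation inner := (inner J F).

Definition zterm (s q : R) (w : seq nat) : R := len w `^ s * expR (q * wsum f w).

Definition zsum (n : nat) (s q : R) : \bar R :=
  \esum_(w in words I n) (zterm s q w)%:E.

Let D0 : 0 < D. Proof. exact: geo_D0 HG. Qed.

Lemma zterm_ge0 s q w : 0 <= zterm s q w.
Proof. by rewrite mulr_ge0 ?powR_ge0 ?expR_ge0. Qed.

Lemma zterm_gt0 s q w : word I w -> 0 < zterm s q w.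
Proof. by move=> Iw; rewrite mulr_gt0 ?powR_gt0 ?expR_gt0// (len_gt0 HB HG). Qed.

Lemma zsum_ge0 n s q : (0 <= zsum n s q)%E.
Proof. by apply: esum_ge0 => w _; rewrite lee_fin zterm_ge0. Qed.

Lemma zterm_cat_le s q u v : 0 <= s -> word I u -> word I v ->
  zterm s q (u ++ v) <= D `^ s * (zterm s q u * zterm s q v).
Proof.
move=> s0 Iu Iv; rewrite /zterm wsum_cat mulrDr expRD.
have -> (a b c d e : R) : a * (b * c * (d * e)) = a * (b * d) * (c * e) by ring.
rewrite ler_wpM2r ?mulr_ge0 ?expR_ge0// -!powRM ?mulr_ge0 ?len_ge0 ?(ltW D0)//.
apply: ge0_ler_powR; rewrite ?nnegrE ?mulr_ge0 ?len_ge0 ?(ltW D0)//.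
exact: len_cat_le HB HG _ _ Iu Iv.
Qed.

Lemma zterm_cat_ge s q u v : 0 <= s -> word I u -> word I v ->
  zterm s q u * zterm s q v <= D `^ s * zterm s q (u ++ v).
Proof.
move=> s0 Iu Iv; rewrite /zterm wsum_cat mulrDr expRD.
rewrite [leLHS]mulrACA [leRHS]mulrA ler_wpM2r ?mulr_ge0 ?expR_ge0//.
rewrite -!powRM ?mulr_ge0 ?len_ge0 ?(ltW D0)//.
apply: ge0_ler_powR; rewrite ?nnegrE ?mulr_ge0 ?len_ge0 ?(ltW D0)//.
exact: len_cat_ge HB HG _ _ Iu Iv.
Qed.

Lemma zsum_cat_le n m s q : 0 <= s -> (zsum m s q < +oo)%E ->
  (zsum (n + m) s q <= (D `^ s)%:E * (zsum n s q * zsum m s q))%E.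
Proof.
move=> s0 fin; have Ds : 0 <= D `^ s by exact: powR_ge0.
rewrite /zsum esum_words_cat; last by move=> w; rewrite lee_fin zterm_ge0.
rewrite -esum_mul//; [|by move=> w; exact: zterm_ge0..].
rewrite -esumZl//; last first.
  by move=> u; apply: esum_ge0 => v _; rewrite lee_fin mulr_ge0 ?zterm_ge0.
apply: le_esum => u [_ Iu]; rewrite -esumZl//; last first.
  by move=> v; rewrite lee_fin mulr_ge0 ?zterm_ge0.
by apply: le_esum => v [_ Iv]; rewrite -EFinM lee_fin zterm_cat_le.
Qed.

Lemma zsum_le n s t q : s <= t -> (zsum n t q <= zsum n s q)%E.
Proof.
move=> st; apply: le_esum => w [_ Iw]; rewrite lee_fin ler_wpM2r ?expR_ge0//.
by apply: ger_powR => //; rewrite (len_gt0 HB HG)// (len_le1 HB).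
Qed.

(** The words of length [n.+1] with a fixed ending [v] already carry the whole sum over single
    letters, up to a constant. *)
Lemma zsum1_fin n s q : 0 <= s -> (zsum n.+1 s q < +oo)%E -> (zsum 1 s q < +oo)%E.
Proof.
move=> s0 fin.
have [i [_ [_ [_ [Ii _ _ _]]]]] := exists_two_letters HB.
pose v := nseq n i; have [sv Iv] := words_nseq n Ii.
have v0 : 0 < zterm s q v by exact: zterm_gt0.
have Ds : 0 < D `^ s by rewrite powR_gt0.
have c0 : 0 < D `^ s / zterm s q v by rewrite divr_gt0.
apply: (@le_lt_trans _ _ ((D `^ s / zterm s q v)%:E * zsum n.+1 s q)%E); last first.
  by rewrite lte_mul_pinfty// ?lee_fin ?(ltW c0).
rewrite -[n.+1]add1n /zsum esum_words_cat; last by move=> w; rewrite lee_fin zterm_ge0.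
rewrite -esumZl ?(ltW c0)//; last first.
  by move=> u; apply: esum_ge0 => w _; rewrite lee_fin zterm_ge0.
apply: le_esum => u [_ Iu].
apply: (@le_trans _ _ ((D `^ s / zterm s q v)%:E * (zterm s q (u ++ v))%:E)%E).
  rewrite -EFinM lee_fin mulrAC ler_pdivlMr//.
  exact: zterm_cat_ge.
rewrite lee_wpmul2l ?lee_fin ?(ltW c0)//.
by apply: (@esum_term _ _ _ (fun v => (zterm s q (u ++ v))%:E)); rewrite ?lee_fin ?zterm_ge0.
Qed.

Lemma zsum_fin n s q : 0 <= s -> (zsum 1 s q < +oo)%E -> (zsum n s q < +oo)%E.
Proof.
move=> s0 fin; elim: n => [|n IH].
  by rewrite /zsum words0 esum_set1 ?ltry// lee_fin zterm_ge0.
rewrite -addn1 (le_lt_trans (zsum_cat_le n s0 fin))//.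
by rewrite lte_mul_pinfty ?lee_fin ?powR_ge0// lte_mul_pinfty ?zsum_ge0// ge0_fin_numE// zsum_ge0.
Qed.

(** Convexity of the exponential, term by term, from its tangent at [m]. *)
Lemma zsum_interpolation n s t q a : 0 <= a <= 1 ->
  (zsum n (a * s + (1 - a) * t) (a * q) <=
   a%:E * zsum n s q + (1 - a)%:E * zsum n t 0)%E.
Proof.
move=> /andP[a0 a1]; have a1' : 0 <= 1 - a by rewrite subr_ge0.
rewrite /zsum -!esumZl//; [|by move=> w; rewrite lee_fin zterm_ge0..].
rewrite -esumD; [|by move=> w _; rewrite -EFinM lee_fin mulr_ge0 ?zterm_ge0..].
apply: le_esum => w [_ Iw]; rewrite -!EFinM -EFinD lee_fin.
have l0 := len_gt0 HB HG Iw.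
have E b c : zterm b c w = expR (b * ln (len w) + c * wsum f w).
  by rewrite /zterm /powR gt_eqF// expRD.
rewrite !E mul0r addr0.
set x := s * ln (len w) + q * wsum f w; set y := t * ln (len w).
have -> : (a * s + (1 - a) * t) * ln (len w) + a * q * wsum f w = a * x + (1 - a) * y.
  by rewrite /x /y; ring.
set m := a * x + (1 - a) * y.
have h z : expR m * (1 + (z - m)) <= expR z.
  have -> : expR z = expR m * expR (z - m) by rewrite -expRD addrC subrK.
  rewrite ler_wpM2l ?expR_ge0//.
  exact: expR_ge1Dx.
have hx : a * (expR m * (1 + (x - m))) <= a * expR x by rewrite ler_wpM2l.
have hy : (1 - a) * (expR m * (1 + (y - m))) <= (1 - a) * expR y by rewrite ler_wpM2l.
have : a * (expR m * (1 + (x - m))) + (1 - a) * (expR m * (1 + (y - m))) = expR m.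
  by rewrite /m; ring.
lra.
Qed.

(** The smallness assumption gives a ratio [th < 1] with [z (n + N) <= th * z N], so the sum over
    all lengths is at most the sum over the first [n] of them divided by [1 - th]. *)
Lemma zsum_geometric n s q : 0 <= s -> (0 < n)%N -> (zsum 1 s q < +oo)%E ->
  ((D `^ s)%:E * zsum n s q < 1)%E ->
  (\esum_(w in word I) (zterm s q w)%:E < +oo)%E.
Proof.
move=> s0 n0 fin1 small.
have fin k : (zsum k s q < +oo)%E by exact: zsum_fin.
have numk k : zsum k s q \is a fin_num by rewrite ge0_fin_numE ?zsum_ge0.
pose z k := fine (zsum k s q).
have zE k : zsum k s q = (z k)%:E by rewrite fineK.
have z0 k : 0 <= z k by rewrite fine_ge0// zsum_ge0.
pose th := D `^ s * z n.
have th0 : 0 <= th by rewrite mulr_ge0 ?powR_ge0.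
have th1 : th < 1 by rewrite -lte_fin EFinM -zE.
have zn N : z (n + N)%N <= th * z N.
  rewrite -lee_fin -zE addnC; apply: le_trans (zsum_cat_le _ s0 (fin n)) _.
  by rewrite !zE -!EFinM lee_fin /th; lra.
pose A := \sum_(0 <= N < n) z N.
have P k : \sum_(0 <= N < k * n) z N <= A / (1 - th).
  have t1 : 0 < 1 - th by rewrite subr_gt0.
  have A0 : 0 <= A by exact: sumr_ge0.
  elim: k => [|k IH]; first by rewrite mul0n big_geq// divr_ge0// ltW.
  rewrite mulSn (big_cat_nat (n := n))//= ?leq_addr//.
  rewrite (_ : \sum_(n <= N < _) _ = \sum_(0 <= N < k * n) z (N + n)%N); last first.
    by rewrite -{1}(add0n n) big_addn addKn.
  apply: (@le_trans _ _ (A + th * (A / (1 - th)))).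
    rewrite lerD2l; apply: (@le_trans _ _ (th * \sum_(0 <= N < k * n) z N)).
      by rewrite mulr_sumr; apply: ler_sum => N _; rewrite addnC.
    by rewrite ler_wpM2l.
  by rewrite le_eqVlt; apply/orP; left; apply/eqP; field; rewrite gt_eqF.
have -> : word I = \bigcup_N words I N.
  by apply/seteqP; split => [w Iw|w [N _ [_ //]]]; exists (size w).
rewrite esum_bigcupT; last 2 first.
- by move=> i j _ _ [w [[<- _] [<- _]]].
- by move=> w; rewrite lee_fin zterm_ge0.
apply: (@le_lt_trans _ _ (A / (1 - th))%:E); last exact: ltry.
rewrite -nneseries_esumT; last by move=> N; exact: zsum_ge0.
apply: lime_le; first by apply: is_cvg_nneseries => N _ _; exact: zsum_ge0.
apply: nearW => M.
apply: (@le_trans _ _ (\sum_(0 <= N < M * n) z N)%:E); last by rewrite lee_fin P.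
rewrite -sumEFin [leRHS](big_cat_nat (n := M))//=; last by rewrite leq_pmulr.
rewrite -[leLHS]adde0 leeD//.
  by apply: lee_sum => N _; rewrite -/(zsum N s q) zE.
by apply: sume_ge0 => N _; rewrite lee_fin.
Qed.

(* Interpolating towards the finite sum at (t, 0) lowers the exponent s while
   keeping the partition sum small. *)
Lemma zsum_shift n s t q : 0 <= t -> t < s -> (0 < n)%N ->
  (zsum 1 t 0 < +oo)%E -> (zsum 1 s q < +oo)%E ->
  (zsum n s q <= ((4 * D `^ s)^-1)%:E)%E ->
  exists s' q', [/\ t <= s', s' < s &
    (\esum_(w in word I) (zterm s' q' w)%:E < +oo)%E].
Proof.
move=> t0 ts n0 fint fins small.
have Ds : 0 < D `^ s by rewrite powR_gt0.
(* Interpolation leaves a partition sum of at most [2 * tau]; with its constant in front this is at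
   most 1/2, below the threshold of [zsum_geometric]. *)
pose tau := (4 * D `^ s)^-1.
have tau0 : 0 < tau by rewrite invr_gt0 mulr_gt0.
have finn : (zsum n t 0 < +oo)%E by exact: zsum_fin.
have : zsum n t 0 \is a fin_num by rewrite ge0_fin_numE ?zsum_ge0.
move=> /fineK; set Y := fine _ => YE.
have Y0 : 0 <= Y by rewrite fine_ge0// zsum_ge0.
have den : 0 < Y + tau + 1 by rewrite ltr_pwDr// addr_ge0// ltW.
(* A weight in the unit interval so light that the sum [Y] at exponent [t] contributes at most
   [tau]. *)
pose b := tau / (Y + tau + 1).
have b0 : 0 < b by rewrite divr_gt0.
have b1 : b <= 1 by rewrite ler_pdivrMr// mul1r; lra.
have bY : b * Y <= tau.
  rewrite /b mulrAC ler_pdivrMr// ler_wpM2l ?(ltW tau0)//; lra.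
pose a := 1 - b.
have a01 : 0 <= a <= 1 by rewrite /a; apply/andP; split; lra.
have aE : 1 - a = b by rewrite /a; lra.
have s'E : a * s + (1 - a) * t = s - b * (s - t) by rewrite /a; ring.
have bst : 0 < b * (s - t) by rewrite mulr_gt0// subr_gt0.
have bst' : b * (s - t) <= s - t by rewrite ler_piMl// subr_ge0 ltW.
have s'0 : t <= a * s + (1 - a) * t by rewrite s'E; lra.
exists (a * s + (1 - a) * t), (a * q); split => //.
  by rewrite s'E; lra.
apply: (@zsum_geometric n); rewrite ?(le_trans t0)//.
  apply: (le_lt_trans (zsum_interpolation _ _ _ _ a01)).
  rewrite aE; apply: lte_add_pinfty; apply: lte_mul_pinfty; rewrite ?lee_fin ?(ltW b0)//.
  by case/andP: a01.
have le2 : (zsum n (a * s + (1 - a) * t) (a * q) <= (2 * tau)%:E)%E.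
  apply: (le_trans (zsum_interpolation _ _ _ _ a01)).
  have -> : (2 * tau)%:E = (tau%:E + tau%:E)%E by rewrite -EFinD; congr (_%:E); ring.
  rewrite aE -YE leeD//.
    apply: (@le_trans _ _ (1 * tau%:E)%E); last by rewrite mul1e.
    rewrite lee_pmul ?lee_fin ?zsum_ge0//; by case/andP: a01.
apply: (@le_lt_trans _ _ ((D `^ s)%:E * (2 * tau)%:E)%E).
  rewrite lee_pmul ?lee_fin ?powR_ge0 ?zsum_ge0//.
  apply: ler_powR; last by rewrite s'E; lra.
  by have := geo_D HG; lra.
rewrite -EFinM lte_fin /tau; have -> : D `^ s * (2 * (4 * D `^ s)^-1) = 2^-1.
  by field; rewrite gt_eqF.
lra.
Qed.

Lemma birkhoff_len_le s w x : 0 <= s -> word I w -> cyl w x ->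
  expR (birkhoff_sum F (fun x => s * geom_potential F x) (size w) x) <= (D * len w) `^ s.
Proof.
move=> s0 Iw wx; have -> : birkhoff_sum F (fun x => s * geom_potential F x) (size w) x =
    s * birkhoff_sum F (geom_potential F) (size w) x by rewrite /birkhoff_sum mulr_sumr.
rewrite mulrC expRM; apply: ge0_ler_powR; rewrite ?nnegrE ?expR_ge0//.
  by rewrite mulr_ge0 ?len_ge0 ?(ltW D0).
exact: geo_pot_le HG _ _ Iw wx.
Qed.

Lemma birkhoff_len_ge s w x : 0 <= s -> word I w -> cyl w x ->
  (len w / D) `^ s <= expR (birkhoff_sum F (fun x => s * geom_potential F x) (size w) x).
Proof.
move=> s0 Iw wx; have -> : birkhoff_sum F (fun x => s * geom_potential F x) (size w) x =
    s * birkhoff_sum F (geom_potential F) (size w) x by rewrite /birkhoff_sum mulr_sumr.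
rewrite (mulrC s) expRM; apply: ge0_ler_powR; rewrite ?nnegrE ?expR_ge0//.
  by rewrite divr_ge0 ?len_ge0 ?(ltW D0).
by rewrite ler_pdivrMr// mulrC; exact: geo_pot_ge HG _ _ Iw wx.
Qed.

(** Two periodic points with the same word coincide, because the branch fixes both and expands their
    distance by at least [lam ^+ n > 1]. *)
Lemma Per_code n : (0 < n)%N -> exists2 code : R -> seq nat,
  (forall x, Per (Delta0 I J) F n x -> words I n (code x) /\ cyl (code x) x) &
  set_inj (Per (Delta0 I J) F n) code.
Proof.
move=> n0; have /choice[code Hc] : forall x, exists w,
    Per (Delta0 I J) F n x -> words I n w /\ cyl w x.
  move=> x; have [[Rx xx]|nP] := pselect (Per (Delta0 I J) F n x); last by exists [::].
  by have [w ww wx] := repeller_cyl HB n Rx; exists w.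
exists code => // x y /set_mem Px /set_mem Py E.
have [[sw Iw] wx] := Hc x Px; have [_] := Hc y Py; rewrite -E => wy.
have := geo_expand HG Iw wx wy; rewrite sw Px.2 Py.2 => h.
apply/eqP; rewrite -subr_eq0 -normr_le0 leNgt; apply/negP => d0.
move: h; apply/negP; rewrite -ltNge ltr_pMl// exprn_egt1// -?lt0n ?(geo_lam HG)//.
Qed.

(** Each periodic point contributes at most [D] to the power [s] times the term of its own word, and
    distinct points have distinct words; exponential growth of the periodic sums along some lengths
    forces growth of [zsum]. *)
Lemma pressure_pos_unbounded i s (B : R) : 0 <= s ->
  (0 < pressure I J F i (fun x => s * geom_potential F x)%R)%E ->
  exists2 n, (0 < n)%N & (B%:E <= zsum n s 0)%E.
Proof.
move=> s0 Ppos.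
have [e e0 Pe] : exists2 e : R, 0 < e &
    (e%:E < pressure I J F i (fun x => s * geom_potential F x)%R)%E.
  case: pressure Ppos => [r||]//; last by exists 1; rewrite ?ltry.
  by rewrite lte_fin => r0; exists (r / 2); rewrite ?lte_fin; lra.
pose C := D `^ s.
have C0 : 0 < C by rewrite powR_gt0.
have [n Nn Hn] := limn_esup_gt (Num.truncn (`|B| * C / e)).+1 Pe.
have n0 : (0 < n)%N by exact: leq_trans Nn.
exists n => //.
have [code Hc inj] := Per_code n0.
pose S := \esum_(x in Per (Delta0 I J) F n `&` J i)
  (expR (birkhoff_sum F (fun x => s * geom_potential F x) n x))%:E.
have Sz : (S <= C%:E * zsum n s 0)%E.
  apply: (@le_trans _ _ (\esum_(x in Per (Delta0 I J) F n `&` J i)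
     (C * zterm s 0 (code x))%:E)).
    apply: le_esum => x [Px _]; have [[sw Iw] wx] := Hc x Px.
    rewrite lee_fin /zterm mul0r expR0 mulr1 -powRM ?len_ge0 ?(ltW D0)//.
    by rewrite -[n in leLHS]sw; exact: birkhoff_len_le.
  have inj' : set_inj (Per (Delta0 I J) F n `&` J i) code.
    by move=> x y /set_mem[Px _] /set_mem[Py _]; apply: inj; exact: mem_set.
  rewrite -(esum_image _ code (fun w => (C * zterm s 0 w)%:E))// /zsum -esumZl ?(ltW C0)//; last first.
    by move=> w; rewrite lee_fin zterm_ge0.
  apply: (@le_trans _ _ (\esum_(w in words I n) (C * zterm s 0 w)%:E)); last first.
    by apply: le_esum => w _; rewrite EFinM.
  apply: esum_sub; first by move=> w; rewrite lee_fin mulr_ge0 ?zterm_ge0// ltW.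
  by move=> _ [x [Px _] <-]; have [] := Hc x Px.
have nR : (0 < n%:R :> R)%R by rewrite ltr0n.
have SB : ((`|B| * C)%:E <= S)%E.
  move: Hn; rewrite -/S => Hn.
  have S0 : (0 <= S)%E by apply: esum_ge0 => x _; rewrite lee_fin expR_ge0.
  move: (S) Hn S0 => [r Hn S0|_ _|_]; [|by rewrite leey|by rewrite leeNy_eq].
  have [r0|r0] := leP r 0.
    by move: Hn; rewrite le0_lneNy ?lee_fin// gt0_muleNy// lte_fin invr_gt0.
  move: Hn.
  rewrite lne_EFin// -EFinM lte_fin mulrC ltr_pdivlMr// => h.
  rewrite lee_fin; apply: (@le_trans _ _ (e * n%:R)).
    have : `|B| * C / e < n%:R by rewrite (lt_le_trans (truncnS_gt _))// ler_nat.
    by rewrite ltr_pdivrMr// => /ltW; rewrite (mulrC e).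
  apply: (@le_trans _ _ (ln r)); first exact: ltW.
  by rewrite ltW// -[ltRHS]lnK ?posrE// (lt_le_trans _ (expR_ge1Dx _))// ltrDr.
have := le_trans SB Sz; rewrite mulrC EFinM lee_pmul2l ?lte_fin//.
by apply: le_trans; rewrite lee_fin ler_norm.
Qed.

(** Here every word [w] must be matched with a periodic point in [J i]. A word may have none, but
    the prefix [e], an inner word starting with [i], makes [e ++ w] inner, hence periodic by
    [inner_periodic], and costs a constant factor. *)
Lemma pressure_fin_zsum1 i s : 0 <= s -> I i ->
  (pressure I J F i (fun x => s * geom_potential F x)%R < +oo)%E ->
  (zsum 1 s 0 < +oo)%E.
Proof.
move=> s0 Ii /limn_esup_ltoo[N HN].
have [u [Ieu ine]] := exists_inner HB Ii.
set e := i :: u in Ieu ine.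
pose n := N.+1.
suff : (zsum n s 0 < +oo)%E by exact: zsum1_fin.
pose k := (size e + n)%N.
have k0 : (0 < k)%N by [].
have := HN k (leq_trans (leqnSn N) (leq_addl _ _)).
set S := \esum_(x in _) _ => HS.
have Sfin : (S < +oo)%E.
  move: HS; case: S => [r||]//=; first by rewrite ltry.
  by rewrite gt0_muley// lte_fin invr_gt0 ltr0n.
have wP w : words I n w -> word I (e ++ w) /\ inner (e ++ w).
  move=> [_ Iw]; have Iew : word I (e ++ w) by apply/word_cat.
  split => //; have [a [b [a0 b1 ab]]] := ine.
  by exists a, b; split => // x /(cyl_cat HB _ _ Iw)[/ab].
have /choice[pt Hpt] : forall w, exists x, words I n w ->
    cyl (e ++ w) x /\ Per (Delta0 I J) F k x.
  move=> w; have [ww|nw] := pselect (words I n w); last by exists 0.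
  have [Iew inw] := wP w ww.
  have [|x ex Px] := inner_periodic HB HG Iew _ inw; first by rewrite size_cat.
  by exists x => _; split => //; move: Px; rewrite size_cat (proj1 ww).
have injpt : set_inj (words I n) pt.
  move=> v w /set_mem vw /set_mem ww E.
  have [vx _] := Hpt v vw; have [wx _] := Hpt w ww.
  have sz : size (e ++ v) = size (e ++ w) by rewrite !size_cat (proj1 vw) (proj1 ww).
  have := cyl_inj HB (wP v vw).1 (wP w ww).1 sz vx.
  by rewrite E => /(_ wx)/eqP; rewrite eqseq_cat// => /andP[_ /eqP].
pose c := (len e / D ^+ 2) `^ s.
have le0 : 0 < len e by exact: len_gt0 HB HG _ Ieu.
have c0 : 0 < c by rewrite powR_gt0// divr_gt0// exprn_gt0.
suff : (c%:E * zsum n s 0 <= S)%E.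
  move=> h; have := le_lt_trans h Sfin.
  have := zsum_ge0 n s 0; case: (zsum n s 0) => [r||]//; rewrite ?ltry//.
  by rewrite gt0_muley// lte_fin.
rewrite /zsum -esumZl ?(ltW c0)//; last by move=> w; rewrite lee_fin zterm_ge0.
apply: (@le_trans _ _ (\esum_(w in words I n)
  (expR (birkhoff_sum F (fun x => s * geom_potential F x) k (pt w)))%:E)).
  apply: le_esum => w ww; have [ex _] := Hpt w ww; have [Iew _] := wP w ww.
  have ke : k = size (e ++ w) by rewrite size_cat (proj1 ww).
  rewrite -EFinM lee_fin ke; apply: le_trans (birkhoff_len_ge s0 Iew ex).
  rewrite /zterm mul0r expR0 mulr1 /c -powRM ?len_ge0//; last first.
    by rewrite divr_ge0// ?exprn_ge0// ltW.
  apply: ge0_ler_powR; rewrite ?nnegrE//.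
  - by rewrite mulr_ge0 ?len_ge0// divr_ge0// ?exprn_ge0// ltW.
  - by rewrite divr_ge0 ?len_ge0// ltW.
  have := len_cat_ge HB HG Ieu ww.2; rewrite -ler_pdivrMl// => h.
  rewrite ler_pdivlMr//; apply: le_trans h; rewrite le_eqVlt; apply/orP; left.
  by apply/eqP; field; rewrite gt_eqF.
rewrite -(esum_image _ pt (fun x => (expR (birkhoff_sum F
  (fun x => s * geom_potential F x) k x))%:E))//.
apply: esum_sub; first by move=> x; rewrite lee_fin expR_ge0.
move=> _ [w ww <-]; have [ex Px] := Hpt w ww; split => //.
by case: ex.
Qed.

End PartitionSums.

(** * Gibbs weights of cylinders *)

Section GibbsWeights.
Context {R : realType} (J : nat -> set R) (F : R -> R) (I : set nat).
Variables D lam : R.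
Hypothesis HB : base_map I J F.
Hypothesis HG : cyl_geometry J F I D lam.
Variable mu : probability (measurableTypeR R) R.

Local Notation br w := (iter (size w) F).
Local Notation cyl := (cyl J F).
Local Notation len := (len J F).
Local Notation R0 := (repeller (Delta0 I J) F).

Hypothesis muR0 : mu R0 = 1%E.
Hypothesis mu_inv : forall A : set (measurableTypeR R), measurable A ->
  mu (R0 `&` F @^-1` A) = mu (R0 `&` A).

Definition weight (w : seq nat) : R := fine (mu (cyl w)).

Lemma weight_ge0 w : 0 <= weight w.
Proof. exact: fine_ge0. Qed.

Lemma cyl_measurable w : word I w -> measurable (cyl w : set (measurableTypeR R)).
Proof. by move=> Iw; apply: measurable_realfun.open_measurable; exact: cyl_open HB _ Iw. Qed.

Lemma repellerE : R0 = \bigcap_n \bigcup_(w in words I n) cyl w.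
Proof.
apply/seteqP; split => x.
  by move=> Rx n _; have [w ww wx] := repeller_cyl HB n Rx; exists w.
move=> H; apply: cyl_repeller => n; have [w [sw Iw] wx] := H n.+1 Logic.I.
by exists w; rewrite sw.
Qed.

Lemma repeller_measurable : measurable (R0 : set (measurableTypeR R)).
Proof.
rewrite repellerE; apply: bigcap_measurable; first by exists 0%N.
move=> n _; apply: measurable_realfun.open_measurable.
by apply: bigcup_open => w [_ Iw]; exact: cyl_open HB _ Iw.
Qed.

Lemma mu_repellerI (A : set (measurableTypeR R)) : measurable A ->
  mu (R0 `&` A) = mu A.
Proof.
move=> mA; have mR := repeller_measurable.
have h : mu A = (mu (A `\` R0) + mu (A `&` R0))%E by exact: measureDI.
rewrite h setIC [X in (X + _)%E](_ : _ = 0%E) ?add0e//.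
apply/eqP; rewrite eq_le measure_ge0 andbT.
apply: (@le_trans _ _ (mu (~` R0))).
  by apply: le_measure; rewrite ?inE; [exact: measurableD|exact: measurableC|move=> x []].
by rewrite probability_setC// muR0 subee.
Qed.

Lemma weightE w : word I w -> mu (cyl w) = (weight w)%:E.
Proof. by move=> Iw; rewrite /weight fineK// fin_num_measure//; exact: cyl_measurable. Qed.

Lemma weight_nil : weight [::] = 1.
Proof.
apply/eqP; rewrite -eqe -weightE// eq_le probability_le1/= -?muR0.
  apply: le_measure; rewrite ?inE; [exact: repeller_measurable|exact: (cyl_measurable (word_nil I))|].
  move=> x Rx; have [w] := repeller_cyl HB 0 Rx.
  by rewrite words0 => ->.
exact: (cyl_measurable (word_nil I)).
Qed.

Lemma weight_split (A : set (measurableTypeR R)) (v : nat -> seq nat) :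
  (forall i, I i -> word I (v i)) -> (forall i, I i -> size (v i) = size (v 0%N)) ->
  injective v ->
  R0 `&` A = R0 `&` \bigcup_(i in I) cyl (v i) ->
  mu (R0 `&` A) = \esum_(i in I) (weight (v i))%:E.
Proof.
move=> Iv sv injv ->; rewrite setI_bigcupr measure_bigcup.
- rewrite nneseries_esum; last by [].
  rewrite set_mem_set; apply: eq_esum => i Ii.
  rewrite -weightE; last exact: Iv.
  by apply: mu_repellerI; apply: cyl_measurable; exact: Iv.
- move=> i Ii; apply: measurableI; first exact: repeller_measurable.
  by apply: cyl_measurable; exact: Iv.
- move=> i j Ii Ij [x [[_ xi] [_ xj]]]; apply: injv.
  by apply: (cyl_inj HB (Iv i Ii) (Iv j Ij) _ xi xj); rewrite !sv.
Qed.

Lemma weight_rcons n w : words I n w ->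
  \esum_(i in I) (weight (rcons w i))%:E = (weight w)%:E.
Proof.
move=> [sw Iw]; rewrite -weightE// -(mu_repellerI (cyl_measurable Iw)).
have Iwi i : I i -> word I (rcons w i).
  by move=> Ii; rewrite -cats1; apply/word_cat; split => //; apply/word_cons.
rewrite (@weight_split (cyl w) (rcons w))//.
- by move=> i _; rewrite !size_rcons.
- exact: rcons_injr.
- apply/seteqP; split => x [Rx].
    move=> wx; split => //.
    have [u [su Iu]] := repeller_cyl HB n.+1 Rx.
    case/lastP: u su Iu => [//|u i]; rewrite size_rcons => -[su] Iui.
    have /word_cat[Iu /word_cons[Ii _]] : word I (u ++ [:: i]) by rewrite cats1.
    move=> uix; exists i => //.
    suff <- : u = w by [].
    have ux : cyl u x.
      have I1 : word I [:: i] by apply/word_cons.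
      by move: uix; rewrite -cats1 => /(cyl_cat HB _ _ I1)[].
    by apply: (cyl_inj HB Iu Iw _ ux wx); rewrite su sw.
  move=> [i Ii]; have I1 : word I [:: i] by apply/word_cons.
  by rewrite -cats1 => /(cyl_cat HB _ _ I1)[].
Qed.

(** Invariance of [mu]: on the repeller, the cylinders of the words [i :: w] partition the preimage
    of [cyl w]. *)
Lemma weight_cons n w : words I n w ->
  \esum_(i in I) (weight (i :: w))%:E = (weight w)%:E.
Proof.
move=> [sw Iw]; rewrite -weightE// -(mu_repellerI (cyl_measurable Iw)).
rewrite -(mu_inv (cyl_measurable Iw)).
have Iwi i : I i -> word I (i :: w) by move=> Ii; apply/word_cons.
rewrite (@weight_split (F @^-1` cyl w) (fun i => i :: w))//.
- by move=> i j [].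
- apply/seteqP; split => x [Rx].
    by move=> wx; split => //; have [i Ii Jx] := Rx 0%N; exists i.
  by move=> [i Ii [_ wx]].
Qed.

Variables (delta : R) (i0 : nat).
Hypothesis delta0 : 0 <= delta.
Hypothesis Ii0 : I i0.

Let D0 : 0 < D. Proof. exact: geo_D0 HG. Qed.

(** [P] in the conclusion is minus the pressure, which [bowen] shows to be 0. That the pressure is
    finite has to be extracted from the two-sided Gibbs bound. *)
Lemma gibbs_weight :
  gibbs_measure I J F i0 (fun x => delta * geom_potential F x) mu ->
  exists P C : R, 0 < C /\ forall w, word I w -> (0 < size w)%N ->
    weight w <= C * (len w `^ delta * expR ((size w)%:R * P)) /\
    len w `^ delta * expR ((size w)%:R * P) <= C * weight w.
Proof.
case=> _ _ [C0 [C01 HC]].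
have C00 : 0 < C0 by rewrite (lt_le_trans _ C01).
pose g x := delta * geom_potential F x.
have Sw w : word I w -> (0 < size w)%N -> exists r : R,
    [/\ ereal_sup [set (birkhoff_sum F g (size w) x)%:E | x in cylinder J F w `&` R0] = r%:E,
        (len w / D) `^ delta <= expR r & expR r <= (D * len w) `^ delta].
  move=> Iw w0; rewrite (cylinder_cyl HB)//.
  set S := [set _ | _ in _].
  have [x wx Rx] := cyl_R0 HB Iw.
  have Sx : S (birkhoff_sum F g (size w) x)%:E by exists x.
  have Dl : 0 < (D * len w) `^ delta by rewrite powR_gt0// mulr_gt0// (len_gt0 HB HG).
  have ub : (ereal_sup S <= (ln ((D * len w) `^ delta))%:E)%E.
    apply: ge_ereal_sup => _ [y [wy _] <-]; rewrite lee_fin.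
    rewrite -[leLHS]expRK ler_ln ?posrE ?expR_gt0//.
    exact: (birkhoff_len_le HG).
  have lb := ereal_sup_ubound Sx.
  case: (ereal_sup S) ub lb => [r||]//; rewrite !lee_fin => ub lb.
  exists r; split => //.
    by apply: le_trans (_ : expR (birkhoff_sum F g (size w) x) <= _);
      [exact: (birkhoff_len_ge HG)|rewrite ler_expR].
  by rewrite -[leRHS]lnK ?posrE// ler_expR.
(* For an infinite pressure the Gibbs ratio of the word [[:: i0]] would be 0 or [+oo], against one
   of its two bounds. *)
have [P PE] : exists P : R, pressure I J F i0 g = P%:E.
  have I1 : word I [:: i0] by apply/word_cons.
  have /= := HC [:: i0] isT (fun k => I1 k).
  have [r [-> _ _]] := Sw _ I1 isT.
  rewrite -/g.
  case: (pressure I J F i0 g) => [P||]; first by exists P.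
  - rewrite mul1e/= (cylinder_cyl HB)// weightE// inve0 => -[].
    have := weight_ge0 [:: i0]; rewrite le_eqVlt => /orP[/eqP <-|w0].
      by rewrite mul0e lee_fin leNgt invr_gt0 C00.
    by rewrite gt0_muley ?lte_fin// => _; rewrite leye_eq.
  - rewrite mul1e/= invey mule0 => -[].
    by rewrite lee_fin leNgt invr_gt0 C00.
have Dd : 0 < D `^ delta by rewrite powR_gt0.
exists (- P), (C0 * D `^ delta); split; first by rewrite mulr_gt0.
move=> w Iw w0; have /= := HC w w0 (fun k => Iw k).
have [r [-> rlo rhi]] := Sw w Iw w0.
rewrite -/g PE -EFinM -EFinB/= (cylinder_cyl HB)// weightE//.
rewrite inver gt_eqF ?expR_gt0// -EFinM !lee_fin ler_pdivlMr ?expR_gt0//.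
rewrite ler_pdivrMr ?expR_gt0// => -[lo hi].
have E0 : 0 <= expR ((size w)%:R * - P) by exact: expR_ge0.
have l0 := len_ge0 J F w.
have expE : expR (r - (size w)%:R * P) = expR r * expR ((size w)%:R * - P).
  by rewrite mulrN expRD.
split.
  apply: (le_trans hi); rewrite expE -mulrA ler_pM2l// [leRHS]mulrA ler_wpM2r//.
  by rewrite -powRM// ltW.
have {}lo : expR (r - (size w)%:R * P) <= C0 * weight w by rewrite -ler_pdivrMl.
rewrite expE in lo.
have h : len w `^ delta <= D `^ delta * expR r.
  apply: le_trans (_ : D `^ delta * (len w / D) `^ delta <= _).
    by rewrite -powRM ?divr_ge0 ?(ltW D0)// mulrC divfK ?gt_eqF.
  by rewrite ler_wpM2l ?(ltW Dd).
apply: (@le_trans _ _ (D `^ delta * expR r * expR ((size w)%:R * - P))).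
  by rewrite ler_wpM2r.
by rewrite -mulrA (mulrC C0) -mulrA ler_pM2l.
Qed.

Lemma weight_sum n : \esum_(w in words I n) (weight w)%:E = 1%E.
Proof.
have := @esum_p_catr R I weight weight_ge0 weight_rcons 0 n [::].
by rewrite weight_nil => ->//; rewrite words0.
Qed.

Hypothesis Hgibbs : gibbs_measure I J F i0 (fun x => delta * geom_potential F x) mu.
Hypothesis Hreg : strongly_regular I J F i0.
Hypothesis Hdim : hausdorff_dim R0 = delta%:E.

Lemma exists_summable_exponent (g : nat -> R) : exists s, [/\ 0 < s,
  (zsum J F I g 1 s 0 < +oo)%E &
  forall B : R, exists2 n, (0 < n)%N & (B%:E <= zsum J F I g n s 0)%E].
Proof.
have [s [s0 Ppos Pfin]] := Hreg; exists s; split => //.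
  exact: (pressure_fin_zsum1 HB HG g (ltW s0) Ii0 Pfin).
by move=> B; exact: (pressure_pos_unbounded HB HG g B (ltW s0) Ppos).
Qed.

Lemma hausdorff_null_repeller (g : nat -> R) s : 0 < s ->
  (\esum_(w in word I) (zterm J F g s 0 w)%:E < +oo)%E ->
  hausdorff_measure s R0 = 0%E.
Proof.
move=> s0 fin; apply: (hausdorff_null_limsup HB (G := word I)) => //.
  apply: le_lt_trans fin; apply: le_esum => w _.
  by rewrite /zterm mul0r expR0 mulr1.
move=> x Rx N; have [w [sw Iw] wx] := repeller_cyl HB N Rx.
by exists w; split => //; rewrite sw.
Qed.

Lemma zsum_mul n C a : 0 <= C ->
  (forall w, words I n w -> len w `^ delta <= C * a * weight w) -> 0 <= a ->
  (zsum J F I (fun=> 0%R) n delta 0 <= (C * a)%:E)%E.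
Proof.
move=> C0 H a0.
have -> : (C * a)%:E = ((C * a)%:E * \esum_(w in words I n) (weight w)%:E)%E.
  by rewrite weight_sum mule1.
rewrite -esumZl ?mulr_ge0//; last by move=> w; rewrite lee_fin weight_ge0.
apply: le_esum => w ww; rewrite -EFinM lee_fin /zterm mul0r expR0 mulr1.
exact: H.
Qed.

(* Here - P is the pressure of delta times the geometric potential: if P > 0 the
   partition sums at delta are small and dim R0 < delta, if P < 0 they are large
   and finite subsystems have dimension above delta. *)
Lemma bowen : exists C s1 : R, [/\ 0 < C, 0 < s1, s1 < delta,
  (forall g, zsum J F I g 1 s1 0 < +oo)%E &
  forall w, word I w -> weight w <= C * len w `^ delta /\
                        len w `^ delta <= C * weight w].
Proof.
have [P [C [C0 HC]]] := gibbs_weight Hgibbs.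
have [s1 [s10 fin1 unb]] := exists_summable_exponent (fun=> 0%R).
have zup n : (0 < n)%N ->
    (zsum J F I (fun=> 0%R) n delta 0 <= (C * expR (- (n%:R * P)))%:E)%E.
  move=> n0; apply: zsum_mul; rewrite ?expR_ge0 ?(ltW C0)// => w [sw Iw].
  have w0 : (0 < size w)%N by rewrite sw.
  have [_] := HC w Iw w0; rewrite sw.
  by rewrite expRN mulrAC ler_pdivlMr ?expR_gt0.
have Dd : 0 < D `^ delta by rewrite powR_gt0.
have zsumg (g : nat -> R) n s : zsum J F I g n s 0 = zsum J F I (fun=> 0%R) n s 0.
  by apply: eq_esum => w _; rewrite /zterm !mul0r.
(* Partition sums decrease in the exponent: if [delta <= s1], those at [s1] would be bounded by
   those at [delta], hence by [C], although they are unbounded. *)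
have s1d : 0 <= P -> s1 < delta.
  move=> P0; rewrite ltNge; apply/negP => ds.
  have [n n0 Hn] := unb (C + 1).
  have := le_trans Hn (le_trans (zsum_le HB HG _ n 0 ds) (zup n n0)).
  rewrite lee_fin; apply/negP; rewrite -ltNge.
  apply: (@le_lt_trans _ _ C); last by rewrite ltrDl.
  by rewrite ler_piMr ?(ltW C0)// -expR0 ler_expR oppr_le0 mulr_ge0.
have nPpos : ~ 0 < P.
  move=> P0; have sd := s1d (ltW P0).
  pose n := (Num.truncn (4 * D `^ delta * C / P)).+1.
  have [||||s [q [s1s sd' fin]]] := @zsum_shift _ J F I D lam HB HG (fun=> 0%R) n delta s1 0 (ltW s10) sd.
  - by [].
  - exact: fin1.
  - exact: le_lt_trans (zsum_le HB HG _ 1 0 (ltW sd)) fin1.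
  - apply: (le_trans (zup n isT)); rewrite lee_fin.
    apply: (@le_trans _ _ (C * (n%:R * P)^-1)).
      by rewrite ler_pM2l// expRN_le// mulr_gt0.
    have nP : 4 * D `^ delta * C < n%:R * P.
      by rewrite -ltr_pdivrMr// truncnS_gt.
    rewrite ler_pdivrMr ?mulr_gt0// ler_pdivlMl ?mulr_gt0//.
    by rewrite ltW.
  have q0 : (\esum_(w in word I) (zterm J F (fun=> 0%R) s 0 w)%:E < +oo)%E.
    apply: le_lt_trans fin; apply: le_esum => w _.
    by rewrite /zterm /wsum big1// !mulr0.
  have := hausdorff_dim_le (ltW (lt_le_trans s10 s1s))
     (hausdorff_null_repeller (lt_le_trans s10 s1s) q0).
  by rewrite Hdim lee_fin leNgt sd'.
have nPneg : ~ P < 0.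
  move=> P0.
  have [e [Ie e0 ine]] := exists_inner_word HB.
  have le0 := len_gt0 HB HG Ie.
  (* The threshold of [hausdorff_dim_ge] at exponent [delta + 1]; it dominates the one at
     [delta + h] for every [h <= 1]. *)
  pose B := (D ^+ 2 / len e) `^ (delta + 1).
  have De : 1 <= D ^+ 2 / len e.
    rewrite ler_pdivlMr// mul1r (le_trans (len_le1 HB Ie))//.
    by rewrite exprn_ege1//; have := geo_D HG; lra.
  have B0 : 0 < B by rewrite powR_gt0// (lt_le_trans _ De).
  pose n := (Num.truncn (2 * B * C / - P)).+1.
  have Bz : ((2 * B)%:E < zsum J F I (fun=> 0%R) n delta 0)%E.
    apply: (@lt_le_trans _ _ (C^-1 * expR (- (n%:R * P)))%:E).
      rewrite lte_fin ltr_pdivlMl//.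
      have : 2 * B * C < n%:R * - P by rewrite -ltr_pdivrMr ?oppr_gt0// truncnS_gt.
      have := expR_ge1Dx (- (n%:R * P)); rewrite mulrN; lra.
    have -> : (C^-1 * expR (- (n%:R * P)))%:E =
        ((C^-1 * expR (- (n%:R * P)))%:E * \esum_(w in words I n) (weight w)%:E)%E.
      by rewrite weight_sum mule1.
    rewrite -esumZl ?mulr_ge0 ?invr_ge0 ?expR_ge0 ?(ltW C0)//; last first.
      by move=> w; rewrite lee_fin weight_ge0.
    apply: le_esum => w [sw Iw]; rewrite -EFinM lee_fin /zterm mul0r expR0 mulr1.
    have w0 : (0 < size w)%N by rewrite sw.
    have [+ _] := HC w Iw w0; rewrite sw => h.
    rewrite -mulrA ler_pdivrMl// expRN ler_pdivrMl ?expR_gt0//.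
    by rewrite [leRHS]mulrC -mulrA.
  have [K [uK KW HK]] := esum_gt_seq Bz.
  have [l l0 Hl] : exists2 l, 0 < l & forall w, w \in K -> l <= len w.
    elim: (K) KW => [|w K' IH] KW; first by exists 1.
    have [|l l0 Hl] := IH; first by move=> v vK; apply: KW; rewrite inE vK orbT.
    exists (Num.min l (len w)).
      by rewrite lt_min l0 (len_gt0 HB HG)//; have [] := KW w (mem_head _ _).
    by move=> v; rewrite inE ge_min => /orP[/eqP ->|/Hl ->//]; rewrite lexx orbT.
  (* So small that raising the lengths of the finite family [K] to the power [h] gives at least 1/2;
     the factor 2 in [2 * B] pays for it. *)
  pose h := (2 * (`|ln l| + 1))^-1.
  have ln0 : 0 < `|ln l| + 1 by rewrite ltr_pwDr.
  have h0 : 0 < h by rewrite invr_gt0 mulr_gt0.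
  have h1 : h <= 1.
    rewrite invf_le1 ?mulr_gt0//.
    by have := normr_ge0 (ln l); lra.
  have lh w : w \in K -> 2^-1 <= len w `^ h.
    move=> wK; apply: (@le_trans _ _ (l `^ h)).
      rewrite /powR gt_eqF//; apply: le_trans (expR_ge1Dx _).
      have : h * `|ln l| <= 2^-1.
        by rewrite /h invfM -mulrA ler_piMr// ler_pdivrMl// mulr1 lerDl.
      have := ler_norm (- ln l); rewrite normrN => /(ler_wpM2l (ltW h0)); lra.
    have [_ Iw] := KW w wK.
    apply: ge0_ler_powR; rewrite ?nnegrE ?(ltW h0) ?(ltW l0) ?len_ge0//.
    exact: Hl.
  have : ((delta + h)%:E <= hausdorff_dim R0)%E.
    apply: (hausdorff_dim_ge HB HG (e := e) (K0 := K)) => //.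
    - by rewrite ltr_wpDl.
    - by move=> b /KW[].
    - move=> b b' x /KW[sb Ib] /KW[sb' Ib'] bb' bx b'x; move/eqP: bb'; apply.
      by apply: (cyl_inj HB Ib Ib' _ bx b'x); rewrite sb sb'.
    - apply: (@le_trans _ _ B).
        by apply: ler_powR => //; rewrite lerD2l.
      apply: (@le_trans _ _ (2^-1 * \sum_(b <- K) len b `^ delta)).
        rewrite ler_pdivlMl//; move: HK; rewrite sumEFin lte_fin => /ltW.
        move=> /le_trans; apply; rewrite le_eqVlt; apply/orP; left; apply/eqP.
        by apply: eq_bigr => b _; rewrite /zterm mul0r expR0 mulr1.
      rewrite mulr_sumr big_seq [leRHS]big_seq; apply: ler_sum => b bK.
      have [_ Ib] := KW b bK.
      rewrite powRD; last by rewrite (gt_eqF (len_gt0 HB HG Ib)) implybT.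
      by rewrite mulrC ler_wpM2l ?powR_ge0// lh.
    - move=> c cK x cx.
      apply: (coded_repeller _ _ cx) => k.
        by apply/word_cat; split => //; have [] := KW _ (cK k).
      by rewrite size_cat addn_gt0 e0 orbT.
  by rewrite Hdim lee_fin leNgt ltrDl h0.
have P0 : P = 0.
  by apply/eqP; rewrite eq_le !leNgt; apply/andP; split; apply/negP.
have l00 : 0 < len [::] `^ delta by rewrite powR_gt0// (len_gt0 HB HG).
(* The two added terms take care of the empty word, about which the Gibbs bound says nothing. *)
exists (C + len [::] `^ delta + (len [::] `^ delta)^-1), s1; split => //.
- by rewrite !addr_gt0// invr_gt0.
- by apply: s1d; rewrite P0.
- by move=> g; rewrite zsumg.
move=> w Iw; have [->|w0] := eqVneq w [::].
  rewrite weight_nil; split.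
    rewrite mulrDl mulVf ?gt_eqF// lerDr mulr_ge0 ?powR_ge0// addr_ge0 ?powR_ge0//.
    exact: ltW.
  by rewrite mulr1 -addrA addrCA lerDl addr_ge0 ?invr_ge0 ?powR_ge0// ltW.
have w0' : (0 < size w)%N by rewrite lt0n size_eq0.
have [] := HC w Iw w0'; rewrite P0 mulr0 expR0 !mulr1 => h1 h2; split.
  apply: (le_trans h1); rewrite ler_wpM2r ?powR_ge0// -addrA lerDl addr_ge0 ?powR_ge0//.
  by rewrite invr_ge0 powR_ge0.
apply: (le_trans h2); rewrite ler_wpM2r ?weight_ge0// -addrA lerDl addr_ge0 ?powR_ge0//.
by rewrite invr_ge0 powR_ge0.
Qed.

End GibbsWeights.

(** * Balanced words *)

Section BalancedWords.
Context {R : realType} (I : set nat) (p : seq nat -> R).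
Hypothesis p0 : forall w, 0 <= p w.
Hypothesis p_nil : p [::] = 1.
Hypothesis p_rcons : forall n w, words I n w ->
  \esum_(i in I) (p (rcons w i))%:E = (p w)%:E.
Hypothesis p_cons : forall n w, words I n w ->
  \esum_(i in I) (p (i :: w))%:E = (p w)%:E.
Variable c : R.
Hypothesis c0 : 0 < c.
Hypothesis p_cat : forall n m u v, words I n u -> words I m v ->
  c * (p u * p v) <= p (u ++ v).
Variable f : nat -> R.
Hypothesis f0 : forall i, 0 <= f i.

Definition near b e n : set (seq nat) :=
  words I n `&` [set w | `|wsum f w - n%:R * b| <= e * n%:R].

(** Markov's inequality for the weak law at [e / 2]: the words outside [near] weigh at most 1/2. *)
Lemma esum_near b e : mean I p 1 (wsum f) = b%:E -> 0 < e ->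
  exists N, forall n, (N <= n)%N ->
    ((2^-1)%:E <= \esum_(w in near b e n) (p w)%:E)%E.
Proof.
move=> fb e0; have e20 : 0 < e / 2 by rewrite divr_gt0.
have [N HN] := weak_law p0 p_nil p_rcons p_cons c0 p_cat f0 fb e20.
exists (maxn N 1) => n; rewrite geq_max => /andP[/HN dev n0].
have n0' : 0 < n%:R :> R by rewrite ltr0n.
have en0 : 0 < e * n%:R by rewrite mulr_gt0.
have tot : \esum_(w in words I n) (p w)%:E = 1%E.
  rewrite -(mean_cst p0 p_nil p_rcons n (ler01 : 0 <= 1 :> R)).
  by apply: eq_esum => w _; rewrite mulr1.
pose B := [set w | `|wsum f w - n%:R * b| <= e * n%:R].
have /esym := esumID B (words I n) (fun w => (p w)%:E) (fun w _ => p0 w : (0 <= (p w)%:E)%E).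
rewrite tot.
have far : (\esum_(w in words I n `&` ~` B) (p w)%:E <= (2^-1)%:E)%E.
  apply: (@le_trans _ _ (((e * n%:R)^-1)%:E * deviation I p f b n)%E).
    rewrite /deviation /mean -esumZl ?invr_ge0 ?(ltW en0)//; last first.
      by move=> w; rewrite lee_fin mulr_ge0.
    apply: le_trans (esum_sub _ (@subIsetl _ _ (~` B))).
      apply: le_esum => w [_ /negP]; rewrite -ltNge => h.
      rewrite -EFinM lee_fin mulrCA ler_peMr//.
      by rewrite ler_pdivlMl// mulr1 ltW.
    by move=> w; rewrite -EFinM lee_fin !mulr_ge0// invr_ge0 ltW.
  apply: (@le_trans _ _ (((e * n%:R)^-1)%:E * (e / 2 * n%:R)%:E)%E).
    by rewrite lee_wpmul2l// lee_fin invr_ge0 ltW.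
  rewrite -EFinM lee_fin le_eqVlt; apply/orP; left; apply/eqP.
  by field; rewrite !gt_eqF.
move=> E; rewrite leNgt; apply/negP => h.
have : (\esum_(w in words I n `&` B) (p w)%:E +
   \esum_(w in words I n `&` ~` B) (p w)%:E < (2^-1)%:E + (2^-1)%:E)%E.
  apply: lte_leD => //; rewrite ge0_fin_numE; first by rewrite (le_lt_trans far)// ltry.
  by apply: esum_ge0 => w _; rewrite lee_fin.
by rewrite E -EFinD lte_fin; lra.
Qed.

Lemma sum_geometric_le (r : R) N : 0 <= r < 1 ->
  \sum_(0 <= m < N) r ^+ m <= (1 - r)^-1.
Proof.
move=> /andP[r0 r1]; have r1' : 0 < 1 - r by rewrite subr_gt0.
rewrite -[leRHS]mulr1 ler_pdivlMl//.
suff -> : (1 - r) * \sum_(0 <= m < N) r ^+ m = 1 - r ^+ N.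
  by rewrite gerBl exprn_ge0.
elim: N => [|N IH]; first by rewrite big_geq// mulr0 expr0 subrr.
by rewrite big_nat_recr//= mulrDr IH exprS; ring.
Qed.

(** By contradiction: if the level sets of [k] had weight below [expR (- (e * m))] for all [m >= M],
    the exponential moment at [q = e / 2] would be bounded by a convergent geometric series. *)
Lemma exists_heavy_value (a : nat -> R) (k : nat -> nat) :
  (forall i, 0 <= a i) -> (\esum_(i in I) (a i)%:E < +oo)%E ->
  (forall q, 0 < q -> \esum_(i in I) (a i * expR (q * (k i)%:R))%:E = +oo%E) ->
  forall e M, 0 < e -> exists2 m, (M <= m)%N &
    ((expR (- (e * m%:R)))%:E <=
       \esum_(i in I `&` [set i | k i = m]) (a i)%:E)%E.
Proof.
move=> a0 fin div e M e0; apply: contrapT => no.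
pose A m := \esum_(i in I `&` [set i | k i = m]) (a i)%:E.
have Am m : (M <= m)%N -> (A m <= (expR (- (e * m%:R)))%:E)%E.
  by move=> Mm; rewrite leNgt; apply/negP => /ltW h; apply: no; exists m.
have A0 m : (0 <= A m)%E by apply: esum_ge0 => i _; rewrite lee_fin.
pose S := fine (\esum_(i in I) (a i)%:E).
have SE : \esum_(i in I) (a i)%:E = S%:E.
  by rewrite fineK// ge0_fin_numE// esum_ge0// => i _; rewrite lee_fin.
have S0 : 0 <= S by rewrite fine_ge0// esum_ge0// => i _; rewrite lee_fin.
have AS m : (A m <= S%:E)%E.
  by rewrite -SE; apply: esum_sub => [i|i []//]; rewrite lee_fin.
pose q := e / 2; have q0 : 0 < q by rewrite divr_gt0.
pose r := expR (- q); have r0 : 0 <= r by exact: expR_ge0.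
have r1 : r < 1 by rewrite -expR0 ltr_expR oppr_lt0.
pose K := S * expR (2 * q * M%:R) + 1.
have K0 : 0 <= K by rewrite addr_ge0// mulr_ge0// expR_ge0.
have term m : ((expR (q * m%:R))%:E * A m <= (K * r ^+ m)%:E)%E.
  have rm : r ^+ m = expR (- (q * m%:R)) by rewrite -expRM_natr mulNr.
  have [Mm|mM] := leqP M m.
    apply: (@le_trans _ _ ((expR (q * m%:R))%:E * (expR (- (e * m%:R)))%:E)%E).
      by rewrite lee_wpmul2l ?lee_fin ?expR_ge0// Am.
    rewrite -EFinM lee_fin -expRD rm.
    have -> : q * m%:R + - (e * m%:R) = - (q * m%:R) by rewrite /q; field.
    by rewrite ler_peMl ?expR_ge0// lerDr mulr_ge0// expR_ge0.
  apply: (@le_trans _ _ ((expR (q * m%:R))%:E * S%:E)%E).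
    by rewrite lee_wpmul2l ?lee_fin ?expR_ge0.
  rewrite -EFinM lee_fin rm.
  apply: (@le_trans _ _ (S * expR (2 * q * M%:R) * expR (- (q * m%:R)))).
    rewrite mulrC -mulrA -expRD ler_wpM2l// ler_expR.
    have : q * m%:R <= q * M%:R by rewrite ler_pM2l// ler_nat ltnW.
    lra.
  by rewrite ler_wpM2r ?expR_ge0// lerDl.
have : (\esum_(i in I) (a i * expR (q * (k i)%:R))%:E <= (K / (1 - r))%:E)%E.
  have {1}-> : I = \bigcup_m (I `&` [set i | k i = m]).
    by apply/seteqP; split => [i Ii|i [m _ []//]]; exists (k i).
  rewrite esum_bigcupT; last 2 first.
  - by move=> i j _ _ [w [[_ /= <-] [_ /= <-]]].
  - by move=> i; rewrite lee_fin mulr_ge0// expR_ge0.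
  have -> : (fun m => \esum_(i in I `&` [set i | k i = m]) (a i * expR (q * (k i)%:R))%:E) =
      fun m => ((expR (q * m%:R))%:E * A m)%E.
    apply/funext => m; rewrite /A -esumZl ?expR_ge0//.
    by apply: eq_esum => i [_ /= ->]; rewrite mulrC EFinM.
  have t0 m : (0 <= (expR (q * m%:R))%:E * A m)%E by rewrite mule_ge0// lee_fin expR_ge0.
  rewrite -nneseries_esumT//.
  apply: lime_le; first by apply: is_cvg_nneseries.
  apply: nearW => N; apply: (@le_trans _ _ (\sum_(0 <= m < N) (K * r ^+ m)%:E)%E).
    by apply: lee_sum => m _.
  rewrite sumEFin lee_fin -mulr_sumr ler_wpM2l// sum_geometric_le// r0.
  by [].
by rewrite div// leye_eq.
Qed.

(** A letter of value [m] is appended to a word of average near [b], and [p_cat] bounds the weight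
    from below. The [+ 1] in the assumption is the move of the target from [n] to [n.+1]. *)
Lemma esum_near_jump b e' e n m :
  e' * n%:R + `|m%:R - n%:R * (1 - b)| + 1 <= e * n.+1%:R ->
  (c%:E * ((\esum_(w in near b e' n) (p w)%:E) *
      \esum_(i in I `&` [set i | f i = m%:R]) (p [:: i])%:E) <=
     \esum_(w in near 1 e n.+1) (p w)%:E)%E.
Proof.
move=> He; set A := (X in (_ * (_ * X))%E).
have ple1 : (\esum_(i in I) (p [:: i])%:E = 1)%E.
  by have := @p_rcons 0 [::]; rewrite words0 p_nil => ->.
have A0 : (0 <= A)%E by apply: esum_ge0 => i _; rewrite lee_fin.
have A1 : (A <= 1)%E.
  by rewrite -ple1; apply: esum_sub => [i|i []//]; rewrite lee_fin.
have AE : A = (fine A)%:E by rewrite fineK// ge0_fin_numE// (le_lt_trans A1)// ltry.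
have fA0 : 0 <= fine A by rewrite fine_ge0.
have cA0 : 0 <= c * fine A by rewrite mulr_ge0// ltW.
rewrite (muleC _ A) muleA AE -EFinM.
rewrite /near [in leRHS]esum_mkcondr.
rewrite esum_words_rcons; last by move=> w; case: ifP => _//; rewrite lee_fin.
rewrite -esumZl//.
rewrite esum_mkcondr; apply: le_esum => u [su Iu].
pose S : set (seq nat) := [set w | `|wsum f w - n.+1%:R * 1| <= e * n.+1%:R].
have a0 i : (0 <= if rcons u i \in S then (p (rcons u i))%:E else 0)%E.
  by case: ifP => _//; rewrite lee_fin.
case: ifPn => [|_]; last by apply: esum_ge0.
move=> /set_mem/= hu.
apply: le_trans (esum_sub a0 (@subIsetl _ I [set i | f i = m%:R])).
rewrite muleC EFinM -AE muleA -esumZl; last 2 first.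
- by rewrite mulr_ge0// ltW.
- by move=> i; rewrite lee_fin.
apply: le_esum => i [Ii /= fi].
rewrite mem_set/=.
  rewrite -EFinM lee_fin -cats1 -mulrA mulrCA.
  by apply: (@p_cat n 1); split=> // j; rewrite inE => /eqP ->.
rewrite /S/= -cats1 wsum_cat wsum1 fi mulr1.
apply: le_trans He.
have -> : wsum f u + m%:R - n.+1%:R =
   (wsum f u - n%:R * b) + (m%:R - n%:R * (1 - b)) - 1 by rewrite -natr1; ring.
rewrite (le_trans (ler_normB _ _))// normr1 lerD2r.
by rewrite (le_trans (ler_normD _ _))// lerD2r.
Qed.

(* If b < 1, a typical word of length n is completed by one letter of value
   m ~ n (1 - b); without exponential moments, such letters have weight at least
   exp (- e' m) for arbitrarily large m. *)
Lemma exists_balanced (k : nat -> nat) b : (forall i, f i = (k i)%:R) ->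
  mean I p 1 (wsum f) = b%:E -> b <= 1 ->
  (b < 1 -> forall q, 0 < q ->
     \esum_(i in I) (p [:: i] * expR (q * f i))%:E = +oo%E) ->
  forall e N, 0 < e -> exists2 n, (N <= n)%N &
    ((expR (- (e * n%:R)))%:E <= \esum_(w in near 1 e n) (p w)%:E)%E.
Proof.
move=> fk fb b1 div e N e0.
have b0 : 0 <= b.
  by rewrite -lee_fin -fb; apply: mean_ge0 => // w _; exact: wsum_ge0.
have [bE|b_neq1] := eqVneq b 1.
  have [N1 HN] := esum_near fb e0; rewrite bE in HN.
  exists (maxn (maxn N N1) (Num.truncn (2 / e)).+1); first by rewrite !leq_max leqnn.
  set n := maxn _ _.
  apply: le_trans (HN n _); last by rewrite !leq_max leqnn orbT.
  have n2 : 2 / e < n%:R.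
    by rewrite (lt_le_trans (truncnS_gt _))// ler_nat leq_maxr.
  have en : 2 < e * n%:R by rewrite mulrC -ltr_pdivrMr.
  have en0 : 0 < e * n%:R by rewrite (lt_trans _ en).
  by rewrite lee_fin (le_trans (expRN_le en0))// lef_pV2 ?posrE// ltW.
have {b_neq1}b1 : b < 1 by rewrite lt_neqAle b_neq1.
pose d := 1 - b; have d0 : 0 < d by rewrite subr_gt0.
have d1 : d <= 1 by rewrite gerBl.
pose e' := e / 4; have e'0 : 0 < e' by rewrite divr_gt0.
have [N1 HN] := esum_near fb e'0.
pose M := (maxn (maxn N N1) (maxn (Num.truncn (2 / e')) (Num.truncn (2 / (c * e'))))).+1.
have fin : (\esum_(i in I) (p [:: i])%:E < +oo)%E.
  by have := @p_rcons 0 [::]; rewrite words0 p_nil => ->//; rewrite ltry.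
have [|m Mm heavy] := exists_heavy_value (fun i => p0 [:: i]) fin _ M e'0 (k := k).
  by move=> q q0; rewrite -(div b1 q q0); apply: eq_esum => i _; rewrite fk.
(* The least [n] with [n * d > m], so that [m] and [n * (1 - b)] differ by at most 1. *)
pose n := (Num.truncn (m%:R / d)).+1.
have md : 0 <= m%:R / d by rewrite divr_ge0// ltW.
have nlo : m%:R < n%:R * d by rewrite -ltr_pdivrMr// truncnS_gt.
have nhi : n%:R * d <= m%:R + 1.
  have : (Num.truncn (m%:R / d))%:R <= m%:R / d by rewrite truncn_le.
  rewrite ler_pdivlMr// /n -natr1 mulrDl mul1r; lra.
have mn : (m < n)%N.
  rewrite -(ltr_nat R) (lt_le_trans nlo)// ler_piMr//.
have bigm (x : R) : (Num.truncn x < m)%N -> x < m%:R.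
  by move=> h; rewrite (lt_le_trans (truncnS_gt _))// ler_nat.
have [m1 m2 mN mN1] : [/\ 2 / e' < m%:R, 2 / (c * e') < m%:R, (N <= m)%N & (N1 <= m)%N].
  move: Mm; rewrite /M !gtn_max => /andP[/andP[h1 h2] /andP[h3 h4]].
  by split; [exact: bigm|exact: bigm|exact: ltnW|exact: ltnW].
have mnR : m%:R <= n%:R :> R by rewrite ler_nat ltnW.
have en : 2 < e' * n%:R by rewrite mulrC -ltr_pdivrMr// (lt_le_trans m1).
have cn : 2 < c * e' * n%:R by rewrite mulrC -ltr_pdivrMr ?mulr_gt0// (lt_le_trans m2).
exists n.+1; first by rewrite (leq_trans mN)// ltnW// ltnS ltnW.
have E4 : e = 4 * e' by rewrite /e'; field.
have nS : n.+1%:R = n%:R + 1 :> R by rewrite -natr1.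
apply: le_trans (@esum_near_jump b e' e n m _); last first.
  have : `|m%:R - n%:R * (1 - b)| <= 1 by rewrite -/d ler_norml; lra.
  have : 0 <= e' * 1 by rewrite mulr1 ltW.
  rewrite E4 nS; nra.
apply: (@le_trans _ _ (c%:E * ((2^-1)%:E * (expR (- (e' * m%:R)))%:E))%E); last first.
  rewrite lee_pmul2l ?lte_fin// lee_pmul ?lee_fin ?expR_ge0 ?invr_ge0//.
    by apply: HN; rewrite (leq_trans mN1)// ltnW.
  apply: (le_trans heavy); apply: esum_sub => [i|i [Ii /= ki]]; first by rewrite lee_fin.
  by split => //=; rewrite fk ki.
rewrite -!EFinM lee_fin mulrA.
apply: (@le_trans _ _ (expR (- (e' * n%:R)) * expR (- (e' * m%:R)))).
  rewrite -expRD ler_expR nS E4.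
  have : e' * m%:R <= e' * n%:R by rewrite ler_pM2l.
  by have := ltW e'0; nra.
have en0 : 0 < e' * n%:R by rewrite (lt_trans _ en).
rewrite ler_wpM2r ?expR_ge0// (le_trans (expRN_le en0))//.
by rewrite -div1r ler_pdivrMr// mulrAC ler_pdivlMr// mul1r mulrA ltW.
Qed.

End BalancedWords.

(** * Finite codes of words with zero drift *)

Section BalancedCode.
Context {R : realType} (J : nat -> set R) (F : R -> R) (I : set nat).
Variables D lam : R.
Hypothesis HB : base_map I J F.
Hypothesis HG : cyl_geometry J F I D lam.
Variable v : nat -> int.

Local Notation cyl := (cyl J F).
Local Notation len := (len J F).
Local Notation inner := (inner J F).
Local Notation g := (fun i => (v i)%:~R : R).

Let D0 : 0 < D. Proof. exact: geo_D0 HG. Qed.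

Lemma wsum_int w : wsum g w = (\sum_(i <- w) v i)%:~R.
Proof. by rewrite /wsum rmorph_sum. Qed.

Lemma wsum_nseq (f : nat -> R) n i : wsum f (nseq n i) = n%:R * f i.
Proof. by rewrite /wsum big_nseq iter_addr addr0 mulr_natl. Qed.

Lemma wsum_addr1 (f : nat -> R) w :
  wsum (fun i => f i + 1) w = wsum f w + (size w)%:R.
Proof. by rewrite /wsum big_split/= big_const_seq count_predT iter_addr addr0. Qed.

Variables i1 i2 : nat.
Hypotheses (Ii1 : I i1) (Ii2 : I i2) (vi1 : v i1 = -1) (vi2 : 0 < v i2).

(** The letters [i1], of value -1, and [i2], of positive value, realise every integer with a number
    of letters linear in its absolute value. Over these two letters each further letter shrinks the
    cylinder by a factor of at least [kap]. *)
Lemma exists_correction : exists k a : R, [/\ 0 <= k, 0 < a &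
  forall t : int, exists c, [/\ word I c, wsum g c = - t%:~R &
    a * expR (- (k * `|t%:~R|)) <= len c]].
Proof.
have I1 : word I [:: i1] by apply/word_cons.
have I2 : word I [:: i2] by apply/word_cons.
have [l1 l2] := (len_gt0 HB HG I1, len_gt0 HB HG I2).
pose m := Num.min (len [:: i1]) (len [:: i2]).
have m0 : 0 < m by rewrite lt_min l1.
pose kap := m / D.
have kap0 : 0 < kap by rewrite divr_gt0.
have kap1 : kap <= 1.
  rewrite ler_pdivrMr// mul1r (@le_trans _ _ 1)//.
    by rewrite ge_min (len_le1 HB I1).
  by have := geo_D HG; lra.
pose P := `|v i2|%N.
have vP : v i2 = P%:Z by rewrite /P gtz0_abs.
have P0 : (0 < P)%N by rewrite -ltz_nat -vP.
have lenk c : {subset c <= [:: i1; i2]} ->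
    word I c /\ len [::] * kap ^+ size c <= len c.
  elim: c => [|i c IH] sub; first by rewrite mulr1; split => //; exact: word_nil.
  have [|Ic lc] := IH; first by move=> j jc; apply: sub; rewrite inE jc orbT.
  have /orP : (i == i1) || (i == i2).
    by have := sub i (mem_head _ _); rewrite !inE.
  move=> i12; have Ii : word I [:: i].
    by case: i12 => /eqP ->.
  have li : m <= len [:: i].
    by case: i12 => /eqP ->; rewrite ge_min lexx ?orbT.
  split; first by apply/word_cons; split => //; apply: Ii; rewrite mem_head.
  have := len_cat_ge HB HG Ii Ic; rewrite cat1s => /(le_trans _) h.
  rewrite /= exprS mulrCA /kap mulrAC ler_pdivrMr// [leRHS]mulrC; apply: h.
  by rewrite ler_pM// ?(ltW m0)// mulr_ge0 ?len_ge0// exprn_ge0// ltW.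
have l00 : 0 < len [::] by apply: (len_gt0 HB HG); exact: word_nil.
exists (- ln kap * P%:R), (len [::]); split => //.
  by rewrite mulr_ge0// oppr_ge0 ln_le0.
move=> t; pose n := `|t|%N.
have tn : `|t%:~R| = n%:R :> R by rewrite -intr_norm /n -pmulrn natr_absz.
have expE : expR (- (- ln kap * P%:R * `|t%:~R|)) = kap ^+ (n * P).
  rewrite tn -{2}[kap]lnK ?posrE// -expRM_natr; congr expR.
  by rewrite natrM; ring.
(* For negative [t], [n] copies of [i2] and [n * (P - 1)] copies of [i1] add up to
   [n * P - n * (P - 1) = n]. *)
pose c := if 0 <= t then nseq n i1 else nseq n i2 ++ nseq (n * P.-1) i1.
have sub : {subset c <= [:: i1; i2]}.
  move=> j; rewrite /c !inE; case: ifP => _.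
    by rewrite mem_nseq => /andP[_ ->].
  by rewrite mem_cat !mem_nseq => /orP[] /andP[_ ->]; rewrite ?orbT.
have sc : (size c <= n * P)%N.
  rewrite /c; case: ifP => _; first by rewrite size_nseq leq_pmulr.
  by rewrite size_cat !size_nseq -mulnS prednK.
have [Ic lc] := lenk c sub.
exists c; split => //.
  rewrite /c; case: ifP => t0.
    rewrite wsum_nseq vi1 mulrN1; congr (- _).
    by rewrite -tn ger0_norm// ler0z.
  rewrite wsum_cat !wsum_nseq vi1 vP mulrN1 natrM -[P%:~R]/(P%:R) -{1}(prednK P0) -natr1.
  rewrite mulrDr mulr1 addrAC subrr add0r -tn ltr0_norm//.
  by rewrite ltrz0 ltNge t0.
rewrite expE (le_trans _ lc)// ler_pM2l//.
by apply: ler_wiXn2l => //; exact: ltW.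
Qed.

Variables (p : seq nat -> R) (delta C : R).
Hypothesis C0 : 0 < C.
Hypothesis p_le : forall w, word I w -> p w <= C * len w `^ delta.
Hypothesis p_near : forall e N, 0 < e -> exists2 n, (N <= n)%N &
  ((expR (- (e * n%:R)))%:E <=
     \esum_(w in near I (fun i => (v i)%:~R + 1)%R 1%R e n) (p w)%:E)%E.

(** Lowering the exponent from [delta] to [s] multiplies the term of a word of length [n] by at
    least [expR (h * n)]. The losses are [expR (- (e * n))] from the weight of the nearly balanced
    words and [expR (- (s * k * e * n))] from the corrections; the choice of [e] makes them use up
    exactly half of the gain. *)
Lemma exists_balanced_code s B : 0 < s -> s < delta ->
  exists K : seq (seq nat), [/\ uniq K,
    forall b, b \in K -> word I b /\ wsum g b = 0,
    forall b b' x, b \in K -> b' \in K -> b != b' -> cyl b x -> ~ cyl b' x &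
    B <= \sum_(b <- K) len b `^ s].
Proof.
move=> s0 sd; have [k [a [k0 a0 Hc]]] := exists_correction.
pose h := (delta - s) * ln lam.
have lam1 := geo_lam HG; have lam0 := geo_lam0 HG.
have h0 : 0 < h by rewrite mulr_gt0 ?subr_gt0// ln_gt0.
have sk0 : 0 < 1 + s * k by rewrite ltr_wpDr// mulr_ge0// ltW.
pose e := h / (2 * (1 + s * k)).
have e0 : 0 < e by rewrite divr_gt0// mulr_gt0.
have eE : e * (1 + s * k) = h / 2 by rewrite /e; field; rewrite gt_eqF.
pose aD := (a / D) `^ s.
have aD0 : 0 < aD by rewrite powR_gt0// divr_gt0.
pose A := aD / C / 2.
have A0 : 0 < A by rewrite !divr_gt0.
have [n Nn Hn] := p_near (Num.truncn (B / A * 2 / h)).+1 e0.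
have Bn : B <= A * expR (h / 2 * n%:R).
  rewrite -ler_pdivrMl// mulrC (@le_trans _ _ (h / 2 * n%:R))//; last first.
    by apply: le_trans (expR_ge1Dx _); rewrite lerDr.
  rewrite -ler_pdivrMl ?divr_gt0//.
  have -> : (h / 2)^-1 * (B / A) = B / A * 2 / h by field; rewrite !gt_eqF.
  by rewrite ltW// (lt_le_trans (truncnS_gt _))// ler_nat.
have [r [ur rS Hr]] : exists r : seq (seq nat), [/\ uniq r,
    forall w, w \in r -> near I (fun i => (v i)%:~R + 1)%R 1%R e n w &
    ((expR (- (e * n%:R)) / 2)%:E < \sum_(w <- r) (p w)%:E)%E].
  apply: esum_gt_seq; apply: lt_le_trans Hn.
  by rewrite lte_fin ltr_pdivrMr// ltr_pMr ?expR_gt0// ltr1n.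
rewrite sumEFin lte_fin in Hr.
have /choice[c cP] : forall w, exists c, [/\ word I c, wsum g c = - wsum g w &
    a * expR (- (k * `|wsum g w|)) <= len c].
  by move=> w; rewrite wsum_int; exact: Hc.
have rW w : w \in r -> [/\ size w = n, word I w & `|wsum g w| <= e * n%:R].
  move=> /rS[[sw Iw]] /=; rewrite wsum_addr1 sw mulr1.
  by rewrite addrK.
exists [seq w ++ c w | w <- r]; split.
- rewrite map_inj_in_uniq// => w w' /rW[sw _ _] /rW[sw' _ _] /eqP.
  by rewrite eqseq_cat ?sw ?sw'// => /andP[/eqP].
- move=> _ /mapP[w /rW[sw Iw _] ->]; have [Ic wc _] := cP w; split.
    by apply/word_cat.
  by rewrite wsum_cat wc subrr.
- move=> _ _ x /mapP[w /rW[sw Iw _] ->] /mapP[w' /rW[sw' Iw' _] ->] neq.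
  have [[Ic _ _] [Ic' _ _]] := (cP w, cP w').
  move=> /(cyl_cat HB _ _ Ic)[wx _] /(cyl_cat HB _ _ Ic')[w'x _].
  move/eqP: neq; apply; congr (_ ++ _); last congr c.
    by apply: (cyl_inj HB Iw Iw' _ wx w'x); rewrite sw sw'.
  by apply: (cyl_inj HB Iw Iw' _ wx w'x); rewrite sw sw'.
rewrite big_map; apply: (le_trans Bn).
pose x := h * n%:R - s * (k * (e * n%:R)).
have xE : x - e * n%:R = h / 2 * n%:R.
  have -> : x - e * n%:R = (h - e * (1 + s * k)) * n%:R by rewrite /x; ring.
  by rewrite eE; field.
apply: (@le_trans _ _ (aD / C * expR x * \sum_(w <- r) p w)).
  apply: (@le_trans _ _ (aD / C * expR x * (expR (- (e * n%:R)) / 2))); last first.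
    by rewrite ler_wpM2l ?(ltW Hr)// mulr_ge0 ?expR_ge0// divr_ge0 ?ltW.
  rewrite -xE expRD /A le_eqVlt; apply/orP; left; apply/eqP.
  by field; rewrite gt_eqF.
rewrite mulr_sumr big_seq [leRHS]big_seq; apply: ler_sum => w /rW[sw Iw wn].
have [Ic _ lc] := cP w.
have lw0 := len_gt0 HB HG Iw.
apply: (@le_trans _ _ (aD * expR x * len w `^ delta)).
  have -> : aD / C * expR x * p w = aD * expR x * (p w / C) by ring.
  by rewrite ler_pM2l ?mulr_gt0 ?expR_gt0// ler_pdivrMr// mulrC p_le.
have H1 : (len w * (a / D * expR (- (k * (e * n%:R))))) `^ s <= len (w ++ c w) `^ s.
  apply: ge0_ler_powR; rewrite ?nnegrE ?len_ge0 ?(ltW s0)//.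
    by rewrite !mulr_ge0 ?len_ge0 ?expR_ge0 ?invr_ge0 ?(ltW a0) ?(ltW D0).
  rewrite -(ler_pM2l D0) (le_trans _ (len_cat_ge HB HG Iw Ic))//.
  rewrite mulrCA ler_pM2l// (le_trans _ lc)//.
  have aDE y : D * (a / D * y) = a * y by field; rewrite gt_eqF.
  rewrite aDE ler_pM2l// ler_expR lerN2.
  by rewrite ler_wpM2l.
apply: le_trans H1.
rewrite powRM ?len_ge0//; last by rewrite !mulr_ge0 ?expR_ge0 ?invr_ge0 ?(ltW a0) ?(ltW D0).
rewrite powRM ?expR_ge0 ?divr_ge0 ?(ltW a0) ?(ltW D0)// -/aD.
rewrite -mulrA [leRHS]mulrCA ler_pM2l//.
rewrite -expRM mulNr /x expRD mulrAC [k * _ * s]mulrC ler_wpM2r ?expR_ge0//.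
have -> : delta = s + (delta - s) by rewrite addrC subrK.
rewrite powRD; last by rewrite (gt_eqF lw0) implybT.
rewrite mulrCA ler_piMr ?powR_ge0//.
apply: (@le_trans _ _ (expR (h * n%:R) * (lam ^- n) `^ (delta - s))).
  rewrite ler_wpM2l ?expR_ge0//; apply: ge0_ler_powR; rewrite ?nnegrE ?subr_ge0 ?(ltW sd)//.
  - exact: len_ge0.
  - by rewrite invr_ge0 exprn_ge0// ltW.
  - by rewrite -sw (len_lam HB HG Iw).
rewrite /powR gt_eqF ?invr_gt0 ?exprn_gt0// -expRD lnV ?posrE ?exprn_gt0// lnXn//.
by rewrite -(mulr_natr (ln lam)) mulrN mulrA subrr expR0.
Qed.

Lemma hausdorff_dim_ge_balanced (A : set R) s : 0 < s -> s < delta ->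
  (forall b : nat -> seq nat, (forall k, word I (b k)) ->
     (forall k, (0 < size (b k))%N) -> (forall k, wsum g (b k) = 0) ->
     forall x, (forall k, cyl (flatten (prefixes b k)) x) -> A x) ->
  (s%:E <= hausdorff_dim A)%E.
Proof.
move=> s0 sd HA.
have [e1 [Ie1 e10 ine1]] := exists_inner_word HB.
have [k [a [_ _ Hc]]] := exists_correction.
(* The separating inner word must itself have sum 0, so it is preceded by its own correction; the
   result is still inner because its suffix is. *)
have [c [Ic cs _]] := Hc (\sum_(i <- e1) v i).
pose e := c ++ e1.
have Ie : word I e by apply/word_cat.
have es : wsum g e = 0 by rewrite wsum_cat cs wsum_int addNr.
have ine : inner e by exact: (inner_cat HB).
have [K [uK KW Kd HK]] := exists_balanced_code ((D ^+ 2 / len e) `^ s) s0 sd.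
apply: (hausdorff_dim_ge HB HG s0 Ie ine uK _ Kd HK) => [b /KW[]//|d dK x].
apply: HA => j; have [Ib bs] := KW _ (dK j).
- by apply/word_cat.
- by rewrite !size_cat !addn_gt0 e10 !orbT.
- by rewrite wsum_cat bs es addr0.
Qed.

End BalancedCode.

(** * The skew-periodic map *)

Section SkewDynamics.
Context {R : realType} (I : set nat) (J : nat -> set R) (F0 : R -> R) (psi : R -> int).
Hypothesis HB : base_map I J F0.
Hypothesis HS : step_length I J psi.

Local Notation cyl := (cyl J F0).
Local Notation F := (FZ F0 psi).
Local Notation R0 := (repeller (Delta0 I J) F0).
Local Notation RZ := (repeller (DeltaZ I J) F).
Local Notation S n x := (\sum_(k < n) psi (iter k F0 x)).

Lemma Delta0_01 x : Delta0 I J x -> 0 < x < 1.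
Proof. by move=> [i Ii Jx]; exact: base_sub01 HB _ _ Ii Jx. Qed.

Lemma hausdorff_dim_repeller : hausdorff_dim R0 = (delta0 I J F0)%:E.
Proof.
rewrite /delta0 fineK// ge0_fin_numE ?hausdorff_dim_ge0//.
apply: (@le_lt_trans _ _ (2%:E)%E); last by rewrite ltry.
apply: hausdorff_dim_le => //; apply: hausdorff_null_sub (hausdorff_null_unit R).
by move=> x Rx; exact: Delta0_01 (Rx 0%N).
Qed.

Lemma delta0_ge0 : 0 <= delta0 I J F0.
Proof. by rewrite fine_ge0 ?hausdorff_dim_ge0. Qed.

(* 0 off I, so that every value is at least -1. *)
Definition letter_step (i : nat) : int := if i \in I then psi (xget 0 (J i)) else 0.

Lemma letter_stepE i x : I i -> J i x -> psi x = letter_step i.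
Proof.
move=> Ii Jx; rewrite /letter_step mem_set//; apply: (step_const HS Ii Jx).
exact: xgetI Jx.
Qed.

Lemma letter_step_pt i : I i -> exists2 x, J i x & psi x = letter_step i.
Proof. by move=> Ii; have [_ _ [x Jx] _] := base_interval HB Ii; exists x => //; exact: letter_stepE. Qed.

Lemma letter_step_ge i : -1 <= letter_step i.
Proof.
have [/set_mem Ii|nI] := boolP (i \in I); last by rewrite /letter_step (negbTE nI).
have [x Jx <-] := letter_step_pt Ii.
rewrite -(ler_int R) -lee_fin -(step_inf HS); apply: ereal_inf_lbound.
by exists x => //; exists i.
Qed.

Lemma exists_step_down : exists2 i, I i & letter_step i = -1.
Proof.
have /ereal_inf_lt[_ [x [i Ii Jx] <-] h] :
    (ereal_inf [set ((psi x)%:~R : R)%:E | x in Delta0 I J] < 0)%E.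
  by rewrite (step_inf HS) lte_fin ltrN10.
exists i => //; rewrite -(letter_stepE Ii Jx); move: h; rewrite lte_fin ltrz0.
by have := letter_step_ge i; rewrite -(letter_stepE Ii Jx); lia.
Qed.

Lemma exists_step_up : exists2 i, I i & 0 < letter_step i.
Proof.
have /ereal_sup_gt[_ [x [i Ii Jx] <-]] := step_sup HS.
by rewrite lte_fin ltr0z (letter_stepE Ii Jx) => h; exists i.
Qed.

Lemma floor_shift (y : R) m : 0 < y < 1 -> Num.floor (y + m%:~R) = m.
Proof.
by move=> /andP[y0 y1]; apply: floor_def; rewrite rmorphD/=; apply/andP; split; lra.
Qed.

Lemma FZ_shift (y : R) m : 0 < y < 1 -> F (y + m%:~R) = F0 y + (psi y + m)%:~R.
Proof. by move=> y01; rewrite /FZ floor_shift// addrK rmorphD/= addrA. Qed.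

Lemma DeltaZ_shift (y : R) m : 0 < y < 1 ->
  DeltaZ I J (y + m%:~R) <-> Delta0 I J y.
Proof.
move=> y01; split => [[x Dx [m' _ E]]|Dy]; last by exists y => //; exists m.
have x01 := Delta0_01 Dx.
have := congr1 Num.floor E; rewrite !floor_shift// => mm.
by move: E; rewrite mm => /addIr <-.
Qed.

Lemma iter01 n y : (forall k, (k < n)%N -> Delta0 I J (iter k F0 y)) ->
  0 < y < 1 -> 0 < iter n F0 y < 1.
Proof.
by case: n => [//|n] H _; have [i Ii Jx] := H n (leqnn _); exact: base_img01 HB _ _ Ii Jx.
Qed.

Lemma iter_FZ n y m : (forall k, (k < n)%N -> Delta0 I J (iter k F0 y)) ->
  0 < y < 1 -> iter n F (y + m%:~R) = iter n F0 y + (S n y + m)%:~R.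
Proof.
move=> + y01; elim: n => [_|n IH H]; first by rewrite big_ord0 add0r.
have Hn k : (k < n)%N -> Delta0 I J (iter k F0 y) by move=> kn; apply: H; exact: ltnW.
by rewrite iterS IH// FZ_shift ?iter01// big_ord_recr/= addrCA addrA.
Qed.

Lemma repeller_FZ z : RZ z <-> exists y m, R0 y /\ z = y + m%:~R.
Proof.
split=> [Rz|[y [m [Ry ->]]] n].
  have [y Dy [m _ E]] := Rz 0%N; exists y, m; split; last exact: esym E.
  have y01 := Delta0_01 Dy.
  move=> n; elim/ltn_ind: n => n IH.
  have := Rz n; rewrite [iter n F z](_ : _ = iter n F (y + m%:~R)); last by rewrite E.
  rewrite iter_FZ// => h.
  exact: (DeltaZ_shift _ (iter01 IH y01)).1 h.
have y01 := Delta0_01 (Ry 0%N).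
rewrite iter_FZ//.
by apply/DeltaZ_shift; [apply: iter01 => // k _|]; exact: Ry.
Qed.

Lemma step_sum_cyl w x : word I w -> cyl w x ->
  S (size w) x = \sum_(i <- w) letter_step i.
Proof.
move=> Iw wx; rewrite (big_nth 0%N) big_mkord; apply: eq_bigr => k _.
apply: letter_stepE; last exact: (cyl_nth Iw wx).
by apply: Iw; rewrite mem_nth.
Qed.

Lemma subset_repeller_FZ : R0 `<=` RZ.
Proof. by move=> x Rx; apply/repeller_FZ; exists x, 0; rewrite addr0. Qed.

(** Every integer translation is a difference of two naturals, so three unions indexed by [nat]
    suffice. *)
Lemma hausdorff_null_translates s (E : nat -> set R) (A : set R) :
  (forall M, hausdorff_measure s (E M) = 0%E) ->
  (forall z, A z -> exists y M (m : int), E M y /\ z = y + m%:~R) ->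
  hausdorff_measure s A = 0%E.
Proof.
move=> E0 AE; apply: (@hausdorff_null_sub _ _ _
  (\bigcup_M \bigcup_a \bigcup_b [set x + (a%:R - b%:R) | x in E M])).
  move=> z /AE[y [M [m [Ey ->]]]]; exists M => //.
  exists (if 0 <= m then `|m|%N else 0%N) => //.
  exists (if 0 <= m then 0%N else `|m|%N) => //.
  exists y => //; congr (_ + _).
  have mE : `|m|%:R = `|m|%:~R :> R by rewrite -natr_absz.
  case: ifP => m0; rewrite mE; first by rewrite subr0 ger0_norm.
  by rewrite sub0r ltr0_norm ?mulrNz ?opprK// ltNge m0.
do 3 (apply: hausdorff_null_bigcup => ?).
exact: hausdorff_null_shift.
Qed.

Lemma hausdorff_dim_repeller_FZ : hausdorff_dim RZ = hausdorff_dim R0.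
Proof.
apply/eqP; rewrite eq_le (hausdorff_dim_sub subset_repeller_FZ) andbT.
apply: ereal_inf_le_tmp => _ [s [s0 Hs] <-]; exists s => //; split => //.
apply: (@hausdorff_null_translates s (fun=> R0)) => // z /repeller_FZ[y [m [Ry ->]]].
by exists y, 0%N, m.
Qed.

Lemma recurrent_coded (b : nat -> seq nat) : (forall k, word I (b k)) ->
  (forall k, (0 < size (b k))%N) ->
  (forall k, wsum (fun i => (letter_step i)%:~R : R) (b k) = 0) ->
  forall x, (forall k, cyl (flatten (prefixes b k)) x) ->
  recurrent_set (DeltaZ I J) F x.
Proof.
move=> Ib b0 bs x bx.
have Rx : R0 x by exact: coded_repeller bx.
split; first exact: subset_repeller_FZ.
apply: (@le_lt_trans _ _ 1%E); last by rewrite ltry.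
apply: limn_einf_le => N; pose w := flatten (prefixes b N).
have Iw : word I w by exact: word_prefixes.
exists (size w).
  rewrite /w; elim: N {w Iw} => [//|N IH].
  by rewrite flatten_prefixesS size_cat; have := b0 N; lia.
have x01 := Delta0_01 (Rx 0%N).
have := @iter_FZ (size w) x 0 (fun k _ => Rx k) x01.
have ws : wsum (fun i => (letter_step i)%:~R : R) w = 0.
  rewrite /w; elim: N {w Iw} => [|N IH]; first by rewrite /wsum big_nil.
  by rewrite flatten_prefixesS wsum_cat IH bs addr0.
have := @wsum_int R letter_step w; rewrite ws => ws0.
rewrite mulr0z addr0 [X in _ + X%:~R]addr0 (step_sum_cyl Iw (bx N)) -ws0 => ->.
have /andP[h0 h1] := @iter01 (size w) x (fun k _ => Rx k) x01.
by rewrite addr0 lee_fin ger0_norm ltW.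
Qed.

Lemma recurrent_decomposition z : recurrent_set (DeltaZ I J) F z ->
  exists y M (m : int), (R0 y /\ forall N, exists2 n, (N <= n)%N &
    `|(S n y)%:~R : R| <= M%:R) /\ z = y + m%:~R.
Proof.
move=> [/repeller_FZ[y [m [Ry zE]]] lim].
have [x Hx] : exists x : R, (limn_einf (fun n => (`|iter n F z|)%:E) < x%:E)%E.
  case: limn_einf lim => [r _||]//; first by exists (r + 1); rewrite lte_fin ltrDl.
  by exists 0; rewrite ltNyr.
exists y, (Num.truncn (x + `|m%:~R| + 1)).+1, m; split => //; split => // N.
have [n Nn] := limn_einf_ltoo Hx N.
have y01 := Delta0_01 (Ry 0%N).
rewrite zE iter_FZ// => hn.
exists n => //; apply: ltW.
apply: lt_trans (truncnS_gt _).
have /andP[h0 h1] := @iter01 n y (fun k _ => Ry k) y01.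
move: hn; rewrite rmorphD/= => hn.
have -> : (S n y)%:~R = (iter n F0 y + ((S n y)%:~R + m%:~R)) - m%:~R - iter n F0 y by ring.
rewrite (le_lt_trans (ler_normB _ _))// (ger0_norm (ltW h0)).
rewrite ltrD// (le_lt_trans (ler_normB _ _))// ltrD2r//.
Qed.

(** On words with [|wsum g w| <= M] the tilt [expR (q * wsum g w)] is at least [expR (- (|q| * M))].
    Summability of the tilted terms for a single [q], of either sign, thus allows Borel-Cantelli for
    every [M]. *)
Lemma recurrent_null s q : 0 < s ->
  (\esum_(w in word I)
     (zterm J F0 (fun i => (letter_step i)%:~R) s q w)%:E < +oo)%E ->
  hausdorff_measure s (recurrent_set (DeltaZ I J) F) = 0%E.
Proof.
move=> s0 fin; apply: hausdorff_null_translates recurrent_decomposition => M.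
pose g i : R := (letter_step i)%:~R.
pose G := word I `&` [set w | `|wsum g w| <= M%:R].
apply: (@hausdorff_null_limsup _ _ _ _ HB G) => //.
- by move=> w [].
- apply: (@le_lt_trans _ _ ((expR (`|q| * M%:R))%:E *
      \esum_(w in word I) (zterm J F0 g s q w)%:E)%E); last first.
    by rewrite lte_mul_pinfty// ?lee_fin ?expR_ge0.
  rewrite -esumZl ?expR_ge0//; last by move=> w; rewrite lee_fin zterm_ge0.
  apply: le_trans (esum_sub _ (@subIsetl _ _ [set w | `|wsum g w| <= M%:R])); last first.
    by move=> w; rewrite -EFinM lee_fin mulr_ge0 ?expR_ge0 ?zterm_ge0.
  apply: le_esum => w [Iw /= wM]; rewrite -EFinM lee_fin /zterm mulrCA -expRD.
  rewrite ler_peMr ?powR_ge0// (le_trans _ (expR_ge1Dx _))// lerDl.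
  have : `|q * wsum g w| <= `|q| * M%:R by rewrite normrM ler_wpM2l.
  by rewrite ler_norml => /andP[]; lra.
move=> x [Rx Hx] N; have [n Nn hn] := Hx N.
have [w [sw Iw] wx] := repeller_cyl HB n Rx.
exists w; split; rewrite ?sw//; split => //=.
by rewrite wsum_int -(step_sum_cyl Iw wx) sw.
Qed.

End SkewDynamics.

(** * The drift as a sum over letters *)

Section DriftIntegral.
Context {R : realType} (I : set nat) (J : nat -> set R) (F0 : R -> R) (psi : R -> int).
Hypothesis HB : base_map I J F0.
Hypothesis HS : step_length I J psi.
Variable mu : probability (measurableTypeR R) R.

Local Notation cyl := (cyl J F0).
Local Notation R0 := (repeller (Delta0 I J) F0).
Local Notation weight := (weight J F0 mu).

Hypothesis muR0 : mu R0 = 1%E.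

Let piece i : set (measurableTypeR R) := if i \in I then R0 `&` cyl [:: i] else set0.

Lemma piece_measurable i : measurable (piece i).
Proof.
rewrite /piece; case: ifPn => [/set_mem Ii|_]; last exact: measurable0.
apply: measurableI; first exact: repeller_measurable HB.
by apply: (cyl_measurable HB); apply/word_cons.
Qed.

Lemma piece_J i x : piece i x -> I i /\ J i x.
Proof. by rewrite /piece; case: ifPn => // /set_mem Ii [_ []]. Qed.

Lemma piece_bigcup : \bigcup_i piece i = R0.
Proof.
apply/seteqP; split => [x [i _]|x Rx].
  by rewrite /piece; case: ifP => // _ [].
have [w [sw Iw] wx] := repeller_cyl HB 1 Rx.
case: w sw Iw wx => [//|i [|//]] _ /word_cons[Ii _] ix.
by exists i => //; rewrite /piece mem_set.
Qed.

(** The repeller is a countable union of Borel pieces on each of which [h] is constant. *)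
Lemma measurable_letter (h : R -> \bar R) (b : nat -> \bar R) :
  (forall i x, I i -> J i x -> h x = b i) ->
  @measurable_fun _ _ (measurableTypeR R) (\bar R) R0 h.
Proof.
move=> hb; rewrite -piece_bigcup; apply/measurable_fun_bigcup => [i|i].
  exact: piece_measurable.
apply: (eq_measurable_fun (cst (b i))); last exact: measurable_cst.
by move=> x /set_mem/piece_J[Ii Jx]; rewrite /= (hb i).
Qed.

Lemma integral_letter (h : R -> \bar R) (b : nat -> R) :
  (forall i, I i -> 0 <= b i) -> (forall i x, I i -> J i x -> h x = (b i)%:E) ->
  (\int[mu]_(x in R0) h x = \esum_(i in I) (weight [:: i] * b i)%:E)%E.
Proof.
move=> b0 hb; rewrite -[in LHS]piece_bigcup ge0_integral_bigcup; last 4 first.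
- exact: piece_measurable.
- by rewrite piece_bigcup; apply: measurable_letter (fun i => (b i)%:E) hb.
- by move=> x [i _ /piece_J[Ii Jx]]; rewrite (hb i)// lee_fin b0.
- move=> i j _ _ [x [/piece_J[Ii Ji] /piece_J[Ij Jj]]].
  by apply: (base_disjoint HB) => //; exists x.
have E i : (\int[mu]_(x in piece i) h x =
    if i \in I then (weight [:: i] * b i)%:E else 0)%E.
  case: ifPn => [iI|nI]; last by rewrite /piece (negbTE nI) integral_set0.
  have Ii := set_mem iI.
  rewrite (eq_integral (cst (b i)%:E)); last first.
    by move=> x /set_mem/piece_J[_ Jx]; rewrite /= (hb i).
  rewrite integral_cst; last exact: piece_measurable.
  rewrite /piece iI muleC EFinM; congr (_ * _)%E.
  have I1 : word I [:: i] by apply/word_cons.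
  by rewrite -(weightE HB mu I1); apply: (mu_repellerI HB muR0); exact: (cyl_measurable HB I1).
rewrite (eq_eseriesr (fun i _ => E i)) nneseries_esumT -?esum_mkcond// => i.
by case: ifPn => // /set_mem Ii; rewrite lee_fin mulr_ge0 ?b0// weight_ge0.
Qed.

Local Notation v := (letter_step I J psi).

(** The integral of [psi] may be [+oo], but [psi >= -1] bounds the integral of its negative part by
    1. This finite quantity can be added to both sides and cancelled. *)
Lemma drift_integral :
  (\int[mu]_(x in R0) ((psi x)%:~R : R)%:E + 1 =
   \esum_(i in I) (weight [:: i] * ((v i)%:~R + 1))%:E)%E.
Proof.
have vE i x : I i -> J i x -> psi x = v i by move=> Ii Jx; exact: (letter_stepE HS Ii Jx).
pose f x : \bar R := ((psi x)%:~R + 1)%:E.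
pose g x : \bar R := ((psi x)%:~R : R)%:E.
have mR := repeller_measurable HB.
have mg : forall h : \bar R -> \bar R,
    @measurable_fun _ _ (measurableTypeR R) (\bar R) R0 (h \o g).
  move=> h; apply: (measurable_letter (b := fun i => h ((v i)%:~R : R)%:E)) => i x Ii Jx.
  by rewrite /g /= (vE i).
have gp : g^\+%E = (fun t => maxe t 0)%E \o g by apply/funext => x; rewrite funeposE.
have gn : g^\-%E = (fun t => maxe (- t) 0)%E \o g by apply/funext => x; rewrite funenegE.
have p0 x : (0 <= g^\+ x)%E by exact: funepos_ge0.
have n0 x : (0 <= g^\- x)%E by exact: funeneg_ge0.
have psi_ge x : R0 x -> -1 <= (psi x)%:~R :> R.
  move=> Rx; have [i Ii Jx] := Rx 0%N.
  by rewrite (vE i)// -[-1]/((-1)%:~R) ler_int (letter_step_ge HB HS).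
have fE : (\int[mu]_(x in R0) f x = \esum_(i in I) (weight [:: i] * ((v i)%:~R + 1))%:E)%E.
  apply: integral_letter => [i Ii|i x Ii Jx]; last by rewrite /f (vE i).
  have := letter_step_ge HB HS i; rewrite -(ler_int R); lra.
have mf : @measurable_fun _ _ (measurableTypeR R) (\bar R) R0 f.
  by apply: (measurable_letter (b := fun i => ((v i)%:~R + 1)%:E)) => i x Ii Jx; rewrite /f (vE i).
have i1 : (\int[mu]_(x in R0) (cst 1%E) x = 1)%E by rewrite integral_cst// mul1e.
have Nle : (\int[mu]_(x in R0) g^\- x <= 1)%E.
  rewrite -i1; apply: ge0_le_integral => //.
  - by rewrite gn; exact: mg.
  - by move=> x Rx; rewrite gn /g /= ge_max; apply/andP; split; rewrite lee_fin;
      have := psi_ge x Rx; lra.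
have N0 : (0 <= \int[mu]_(x in R0) g^\- x)%E by exact: integral_ge0.
have E : (\int[mu]_(x in R0) f x + \int[mu]_(x in R0) g^\- x =
          \int[mu]_(x in R0) g^\+ x + 1)%E.
  rewrite -[in RHS]i1 -!ge0_integralD//.
  - apply: eq_integral => x _; rewrite gp gn /f /g /= -?EFinN -!EFin_max -!EFinD.
    congr (_%:E); move: ((psi x)%:~R : R) => t.
    by case: (lerP t 0) => h; case: (lerP (- t) 0) => h'; lra.
  - by rewrite gp; exact: mg.
  - by move=> x Rx; rewrite lee_fin; have := psi_ge x Rx; lra.
  - by rewrite gn; exact: mg.
rewrite integralE -fE.
case: (\int[mu]_(x in R0) g^\- x)%E Nle N0 E => [r||]// _ _ E.
by rewrite addeAC -E addeK.
Qed.

End DriftIntegral.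

(** * The dimension gap *)

Section DimensionGap.
Context {R : realType} (I : set nat) (J : nat -> set R) (F0 : R -> R) (psi : R -> int).
Variables D lam : R.
Hypothesis HB : base_map I J F0.
Hypothesis HG : cyl_geometry J F0 I D lam.
Hypothesis HS : step_length I J psi.
Variable mu : probability (measurableTypeR R) R.

Local Notation cyl := (cyl J F0).
Local Notation len := (len J F0).
Local Notation inner := (inner J F0).
Local Notation R0 := (repeller (Delta0 I J) F0).
Local Notation p := (weight J F0 mu).
Local Notation v := (letter_step I J psi).
Local Notation g := (fun i => (v i)%:~R : R).
Local Notation f := (fun i => (v i)%:~R + 1 : R).
Local Notation phi := (geom_potential F0).
Local Notation recurrent := (recurrent_set (DeltaZ I J) (FZ F0 psi)).

Hypothesis muR0 : mu R0 = 1%E.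
Hypothesis mu_inv : forall A : set (measurableTypeR R), measurable A ->
  mu (R0 `&` F0 @^-1` A) = mu (R0 `&` A).

Variables C delta : R.
Hypothesis C0 : 0 < C.
Hypothesis delta0 : 0 <= delta.
Hypothesis p_len : forall w, word I w ->
  p w <= C * len w `^ delta /\ len w `^ delta <= C * p w.

Let D0 : 0 < D. Proof. exact: geo_D0 HG. Qed.
Let Dd0 : 0 < D `^ delta. Proof. exact: powR_gt0. Qed.
Let p0 w : 0 <= p w. Proof. exact: weight_ge0. Qed.
Let p_nil : p [::] = 1. Proof. exact: (weight_nil HB muR0). Qed.
Let p_rcons n w : words I n w -> \esum_(i in I) (p (rcons w i))%:E = (p w)%:E.
Proof. exact: (weight_rcons HB muR0). Qed.
Let p_cons n w : words I n w -> \esum_(i in I) (p (i :: w))%:E = (p w)%:E.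
Proof. exact: (weight_cons HB muR0 mu_inv). Qed.

(** Almost-multiplicativity of [p]: three comparisons of a weight with a length, one for each of the
    two factors and one for the concatenation, and one use of the distortion constant. *)
Let A := C ^+ 3 * D `^ delta.
Let A0 : 0 < A. Proof. by rewrite mulr_gt0// exprn_gt0. Qed.

Lemma weight_cat_ge n m u w : words I n u -> words I m w ->
  A^-1 * (p u * p w) <= p (u ++ w).
Proof.
move=> [_ Iu] [_ Iw]; have Iuw : word I (u ++ w) by apply/word_cat.
rewrite mulrC ler_pdivrMr//.
apply: (@le_trans _ _ ((C * len u `^ delta) * (C * len w `^ delta))).
  by rewrite ler_pM// (p_len _).1.
have h := (p_len Iuw).2.
have : len u `^ delta * len w `^ delta <= D `^ delta * len (u ++ w) `^ delta.
  rewrite -!powRM ?len_ge0 ?(ltW D0)//; apply: ge0_ler_powR => //.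
  - by rewrite nnegrE mulr_ge0 ?len_ge0.
  - by rewrite nnegrE mulr_ge0 ?len_ge0 ?(ltW D0).
  - exact: len_cat_ge HB HG _ _ Iu Iw.
move=> h2; rewrite mulrACA (@le_trans _ _ (C * C * (D `^ delta * (C * p (u ++ w)))))//.
  rewrite ler_pM2l ?mulr_gt0// (le_trans h2)// ler_pM2l//.
by rewrite le_eqVlt; apply/orP; left; apply/eqP; rewrite /A; ring.
Qed.

Lemma weight_cat_le n m u w : words I n u -> words I m w ->
  p (u ++ w) <= A * (p u * p w).
Proof.
move=> [_ Iu] [_ Iw]; have Iuw : word I (u ++ w) by apply/word_cat.
apply: (le_trans (p_len Iuw).1).
have h : len (u ++ w) `^ delta <= D `^ delta * (len u `^ delta * len w `^ delta).
  rewrite -!powRM ?mulr_ge0 ?len_ge0 ?(ltW D0)//; apply: ge0_ler_powR => //.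
  - by rewrite nnegrE len_ge0.
  - by rewrite nnegrE !mulr_ge0 ?len_ge0 ?(ltW D0).
  - exact: len_cat_le HB HG _ _ Iu Iw.
have h2 : len u `^ delta * len w `^ delta <= (C * p u) * (C * p w).
  by rewrite ler_pM ?powR_ge0// (p_len _).2.
rewrite (@le_trans _ _ (C * (D `^ delta * ((C * p u) * (C * p w)))))//.
  by rewrite ler_pM2l// (le_trans h)// ler_pM2l.
by rewrite le_eqVlt; apply/orP; left; apply/eqP; rewrite /A; ring.
Qed.

Let A'0 : 0 < A^-1. Proof. by rewrite invr_gt0. Qed.

Lemma letter_f_ge0 i : 0 <= f i.
Proof. by have := letter_step_ge HB HS i; rewrite -(ler_int R); lra. Qed.

Lemma mean1_letter : mean I p 1 (wsum f) = \esum_(i in I) (p [:: i] * f i)%:E.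
Proof. exact: (mean1 I p0 letter_f_ge0). Qed.

Lemma zsum_le_mean n q :
  (zsum J F0 I g n delta q <=
     C%:E * mean I p n (fun w => expR (q * (wsum f w - n%:R))))%E.
Proof.
rewrite /mean -esumZl ?(ltW C0)//; last by move=> w; rewrite lee_fin mulr_ge0 ?expR_ge0.
apply: le_esum => w [sw Iw]; rewrite -EFinM lee_fin /zterm wsum_addr1 sw addrK mulrA.
by rewrite ler_wpM2r ?expR_ge0// (p_len Iw).2.
Qed.

(** The bound on the mean is the threshold of [zsum_shift] divided by the constant [C] that relates
    weights to lengths. *)
Lemma recurrent_null_mean n q s1 : 0 < s1 -> s1 < delta ->
  (zsum J F0 I g 1 s1 0 < +oo)%E -> (0 < n)%N ->
  (mean I p n (fun w => expR (q * (wsum f w - n%:R))) <=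
     ((C * (4 * D `^ delta))^-1)%:E)%E ->
  (mean I p 1 (fun w => expR (q * (wsum f w - 1))) < +oo)%E ->
  exists s, [/\ 0 < s, s < delta & hausdorff_measure s recurrent = 0%E].
Proof.
move=> s10 s1d fin1 n0 small finq.
have [||s [q' [s1s sd fin]]] := zsum_shift HB HG (ltW s10) s1d n0 fin1 (q := q).
- apply: (le_lt_trans (zsum_le_mean 1 q)).
  by rewrite lte_mul_pinfty// lee_fin ltW.
- apply: (le_trans (zsum_le_mean n q)).
  apply: (@le_trans _ _ (C%:E * ((C * (4 * D `^ delta))^-1)%:E)%E).
    by rewrite lee_wpmul2l// lee_fin ltW.
  by rewrite -EFinM lee_fin invfM mulrA mulfV ?mul1r ?gt_eqF.
have s0 := lt_le_trans s10 s1s.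
by exists s; split => //; exact: (recurrent_null HB HS s0 fin).
Qed.

Lemma recurrent_null_pos s1 : 0 < s1 -> s1 < delta ->
  (zsum J F0 I g 1 s1 0 < +oo)%E ->
  (1 < \esum_(i in I) (p [:: i] * f i)%:E)%E ->
  exists s, [/\ 0 < s, s < delta & hausdorff_measure s recurrent = 0%E].
Proof.
move=> s10 s1d fin1 b1.
pose tau := (C * (4 * D `^ delta))^-1.
have tau0 : 0 < tau by rewrite invr_gt0 !mulr_gt0.
have [n [q [n0 small finq]]] := exists_small_mean_pos p0 p_nil p_rcons p_cons
  A'0 weight_cat_ge letter_f_ge0 b1 tau0.
exact: recurrent_null_mean s10 s1d fin1 n0 small finq.
Qed.

Lemma recurrent_null_neg s1 (b q0 : R) : 0 < s1 -> s1 < delta ->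
  (zsum J F0 I g 1 s1 0 < +oo)%E ->
  \esum_(i in I) (p [:: i] * f i)%:E = b%:E -> b < 1 -> 0 < q0 ->
  (\esum_(i in I) (p [:: i] * expR (q0 * f i))%:E < +oo)%E ->
  exists s, [/\ 0 < s, s < delta & hausdorff_measure s recurrent = 0%E].
Proof.
move=> s10 s1d fin1 bE b1 q00 finq0.
pose tau := (C * (4 * D `^ delta))^-1.
have tau0 : 0 < tau by rewrite invr_gt0 !mulr_gt0.
have fb : mean I p 1 (wsum f) = b%:E by rewrite mean1_letter.
have finm : (mean I p 1 (fun w => expR (q0 * wsum f w)) < +oo)%E.
  rewrite /mean esum_words1; last by move=> w; rewrite lee_fin mulr_ge0 ?expR_ge0.
  by under eq_esum do rewrite wsum1.
have [n [q [n0 small finq]]] := exists_small_mean_neg p0 p_nil p_rcons p_cons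
  A'0 weight_cat_ge A0 weight_cat_le letter_f_ge0 fb b1 q00 finm tau0.
exact: recurrent_null_mean s10 s1d fin1 n0 small finq.
Qed.

Lemma recurrent_dim_ge (b : R) :
  \esum_(i in I) (p [:: i] * f i)%:E = b%:E -> b <= 1 ->
  (b < 1 -> forall q, 0 < q ->
     \esum_(i in I) (p [:: i] * expR (q * f i))%:E = +oo%E) ->
  (delta%:E <= hausdorff_dim recurrent)%E.
Proof.
move=> bE b1 div.
have fb : mean I p 1 (wsum f) = b%:E by rewrite mean1_letter.
have fk i : f i = `|v i + 1|%:R.
  rewrite natr_absz ger0_norm ?rmorphD//.
  by have := letter_step_ge HB HS i; lia.
have near := exists_balanced p0 p_nil p_rcons p_cons A'0 weight_cat_ge letter_f_ge0
  fk fb b1 div.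
have [i1 Ii1 vi1] := exists_step_down HB HS.
have [i2 Ii2 vi2] := exists_step_up HS.
have H s : 0 < s -> s < delta -> (s%:E <= hausdorff_dim recurrent)%E.
  move=> s0 sd.
  apply: (hausdorff_dim_ge_balanced HB HG Ii1 Ii2 vi1 vi2 C0
    (fun w Iw => (p_len Iw).1) near s0 sd).
  by move=> c Ic c0 cs x cx; exact: (recurrent_coded HB HS Ic c0 cs cx).
rewrite leNgt; apply/negP => lt.
have := hausdorff_dim_ge0 recurrent.
case: (hausdorff_dim recurrent) H lt => [r||]// H.
rewrite lte_fin lee_fin => rd r0.
have := H ((r + delta) / 2); rewrite lee_fin; lra.
Qed.

Lemma Per1_letter x i : cyl [:: i] x -> I i ->
  birkhoff_sum F0 (fun x => delta * phi x) 1 x = delta * phi x /\ psi x = v i.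
Proof.
by move=> [Jx _] Ii; rewrite /birkhoff_sum big_ord1/= (letter_stepE HS Ii Jx).
Qed.

(** An inner letter has a fixed point, where the exponential of the potential is comparable to the
    weight of the letter; the remaining letters are finitely many and contribute a finite sum. *)
Lemma esum_letter_fin q :
  (\esum_(x in Per (Delta0 I J) F0 1)
     (expR (delta * phi x + q * (psi x)%:~R))%:E < +oo)%E ->
  (\esum_(i in I) (p [:: i] * expR (q * f i))%:E < +oo)%E.
Proof.
move=> fin; pose In := [set i | inner [:: i]].
have a0 i : (0 <= (p [:: i] * expR (q * f i))%:E)%E by rewrite lee_fin mulr_ge0 ?expR_ge0.
rewrite (esumID In)//; apply: lte_add_pinfty; last first.
  have [L HL] := noninner_finite HB.
  apply: (@le_lt_trans _ _ (\esum_(i in [set` L]) (p [:: i] * expR (q * f i))%:E)%E).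
    by apply: esum_sub => // i [Ii /= ni]; exact: HL.
  have finL : finite_set [set` L] by exact: finite_seq.
  rewrite esum_fset//; rewrite fsbig_finite//.
  by rewrite sumEFin ltry.
have /choice[X HX] : forall i, exists x, (I `&` In) i ->
    cyl [:: i] x /\ Per (Delta0 I J) F0 1 x.
  move=> i; have [[Ii ni]|nP] := pselect ((I `&` In) i); last by exists 0.
  have I1 : word I [:: i] by apply/word_cons.
  by have [x ix Px] := inner_periodic HB HG I1 isT ni; exists x.
pose K := C * D `^ delta * expR q.
have K0 : 0 <= K by rewrite mulr_ge0 ?expR_ge0// mulr_ge0 ?ltW.
pose b x := (K * expR (delta * phi x + q * (psi x)%:~R))%:E.
have b0 x : (0 <= b x)%E by rewrite lee_fin mulr_ge0 ?expR_ge0.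
apply: (@le_lt_trans _ _ (\esum_(i in I `&` In) b (X i))).
  apply: le_esum => i Hi; have [ix _] := HX i Hi; have [Ii _] := Hi.
  have I1 : word I [:: i] by apply/word_cons.
  have [bE vE] := Per1_letter ix Ii.
  have := birkhoff_len_ge HG delta0 I1 ix; rewrite /= bE => h.
  rewrite lee_fin vE expRD mulrDr mulr1 expRD.
  have h2 : len [:: i] `^ delta <= D `^ delta * expR (delta * phi (X i)).
    apply: (@le_trans _ _ (D `^ delta * (len [:: i] / D) `^ delta)).
      rewrite -powRM ?divr_ge0 ?len_ge0 ?(ltW D0)//.
      by rewrite [D * _]mulrC divfK ?gt_eqF.
    by rewrite ler_pM2l.
  have h3 : p [:: i] <= C * (D `^ delta * expR (delta * phi (X i))).
    by rewrite (le_trans (p_len I1).1)// ler_pM2l.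
  apply: (@le_trans _ _ (C * (D `^ delta * expR (delta * phi (X i))) *
      (expR (q * (v i)%:~R) * expR q))).
    by rewrite ler_wpM2r ?mulr_ge0 ?expR_ge0.
  by rewrite le_eqVlt; apply/orP; left; apply/eqP; rewrite /K; ring.
have injX : set_inj (I `&` In) X.
  move=> i j /set_mem Hi /set_mem Hj E.
  have [[Ji _] _] := HX i Hi; have [[Jj _] _] := HX j Hj.
  apply: (base_disjoint HB) => //; [exact: Hi.1|exact: Hj.1|].
  by exists (X i); split => //; rewrite E.
rewrite -(esum_image _ X b)//.
apply: (@le_lt_trans _ _ (\esum_(x in Per (Delta0 I J) F0 1) b x)).
  by apply: esum_sub => // _ [i Hi <-]; have [] := HX i Hi.
rewrite (_ : \esum_(x in _) b x = K%:E * \esum_(x in Per (Delta0 I J) F0 1)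
     (expR (delta * phi x + q * (psi x)%:~R))%:E)%E.
  by rewrite lte_mul_pinfty// lee_fin.
by rewrite -esumZl.
Qed.

(** In this direction a fixed point is sent to its letter, injectively by [Per_code]. *)
Lemma esum_Per_fin q :
  (\esum_(i in I) (p [:: i] * expR (q * f i))%:E < +oo)%E ->
  (\esum_(x in Per (Delta0 I J) F0 1)
     (expR (delta * phi x + q * (psi x)%:~R))%:E < +oo)%E.
Proof.
move=> fin.
have [code Hc inj] := Per_code HB HG (ltn0Sn 0).
pose K := D `^ delta * C * expR (- q).
have K0 : 0 <= K by rewrite mulr_ge0 ?expR_ge0// mulr_ge0 ?ltW.
pose b w := (K * (p w * expR (q * wsum f w)))%:E.
have b0 w : (0 <= b w)%E by rewrite lee_fin mulr_ge0// mulr_ge0 ?expR_ge0.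
apply: (@le_lt_trans _ _ (\esum_(x in Per (Delta0 I J) F0 1) b (code x))).
  apply: le_esum => x Px; have [] := Hc x Px; case: (code x) => [[]//|i [|j w] [//]] _ I1 ix.
  have /word_cons[Ii _] := I1.
  have [bE vE] := Per1_letter ix Ii.
  have := birkhoff_len_le HG delta0 I1 ix; rewrite /= bE => h.
  rewrite lee_fin vE expRD wsum1 mulrDr mulr1 expRD.
  have h2 : expR (delta * phi x) <= D `^ delta * (C * p [:: i]).
    rewrite (le_trans h)// powRM ?len_ge0 ?(ltW D0)// ler_pM2l//.
    exact: (p_len I1).2.
  apply: (@le_trans _ _ (D `^ delta * (C * p [:: i]) * expR (q * (v i)%:~R))).
    by rewrite ler_wpM2r ?expR_ge0.
  rewrite le_eqVlt; apply/orP; left; apply/eqP; rewrite /K expRN.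
  by field; rewrite gt_eqF ?expR_gt0.
rewrite -(esum_image _ code b)//.
apply: (@le_lt_trans _ _ (\esum_(w in words I 1) b w)).
  by apply: esum_sub => // _ [x Px <-]; have [] := Hc x Px.
rewrite esum_words1//.
rewrite (_ : \esum_(i in _) _ = K%:E * \esum_(i in I) (p [:: i] * expR (q * f i))%:E)%E.
  by rewrite lte_mul_pinfty// ?lee_fin//; apply: esum_ge0 => i _; rewrite lee_fin mulr_ge0 ?expR_ge0.
rewrite -esumZl//; last by move=> i; rewrite lee_fin mulr_ge0 ?expR_ge0.
by apply: eq_esum => i _; rewrite /b wsum1.
Qed.

End DimensionGap.

Unset Implicit Arguments.

Theorem theorem2p4 (R : realType) (I : set nat) (J : nat -> set R)
    (F0 : R -> R) (psi : R -> int) (i0 : nat)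
    (mu : probability (measurableTypeR R) R) :
  let R0 := repeller (Delta0 I J) F0 in
  let F := FZ F0 psi in
  let RZ := repeller (DeltaZ I J) F in
  let phi := geom_potential F0 in
  let d0 := delta0 I J F0 in
  let alpha_max := (\int[mu]_(x in R0) ((psi x)%:~R : R)%:E)%E in
  base_map I J F0 ->
  step_length I J psi ->
  topologically_transitive RZ F ->
  I i0 ->
  strongly_regular I J F0 i0 ->
  gibbs_measure I J F0 i0 (fun x => d0 * phi x) mu ->
  (\int[mu]_(x in R0) (- phi x)%:E < +oo)%E ->
  (hausdorff_dim (recurrent_set (DeltaZ I J) F) < hausdorff_dim RZ)%E
  <->
  ((0 < alpha_max)%E \/
   ((alpha_max < 0)%E /\
    exists q : R, 0 < q /\
      (\esum_(x in Per (Delta0 I J) F0 1)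
         (expR (d0 * phi x + q * (psi x)%:~R))%:E < +oo)%E)).
Proof.
move=> R0 F RZ phi d0 alpha HB HS _ Ii0 Hreg Hgibbs _.
have [D [lam HG]] := cyl_geometryP HB.
have [muR0 mu_inv _] := Hgibbs.
have d00 : 0 <= d0 by exact: delta0_ge0.
have Hdim := hausdorff_dim_repeller HB.
have [C [s1 [C0 s10 s1d fin1 p_len]]] := bowen HB HG muR0 d00 Ii0 Hgibbs Hreg Hdim.
rewrite (hausdorff_dim_repeller_FZ psi HB) Hdim -/d0.
(* The sign of [alpha] is read off the position of [beta] relative to 1. As a sum of nonnegative
   terms [beta] also excludes [alpha = -oo]. *)
pose beta := \esum_(i in I) (weight J F0 mu [:: i] * ((letter_step I J psi i)%:~R + 1))%:E.
have ab : (alpha + 1 = beta)%E by exact: drift_integral.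
have beta0 : (0 <= beta)%E.
  by apply: esum_ge0 => i _; rewrite lee_fin mulr_ge0 ?weight_ge0// (letter_f_ge0 HB HS).
have gap : (exists s, [/\ 0 < s, s < d0 &
    hausdorff_measure s (recurrent_set (DeltaZ I J) F) = 0%E]) ->
    (hausdorff_dim (recurrent_set (DeltaZ I J) F) < d0%:E)%E.
  move=> [s [s0 sd Hs]]; apply: (@le_lt_trans _ _ s%:E); last by rewrite lte_fin.
  exact: hausdorff_dim_le (ltW s0) Hs.
split; last first.
  case=> [apos|[aneg [q [q0 finq]]]]; apply: gap.
    apply: (recurrent_null_pos HB HG HS muR0 mu_inv C0 d00 p_len s10 s1d (fin1 _)).
    rewrite -/beta -ab; case: (alpha) apos => [a|_|]//; last by rewrite addye// ltry.
    by rewrite -EFinD !lte_fin ltrDr.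
  move: ab aneg; case: alpha => [a||]//; last by move=> ab; move: beta0; rewrite -ab.
  rewrite -EFinD lte_fin => bE aneg.
  apply: (recurrent_null_neg HB HG HS muR0 mu_inv C0 d00 p_len s10 s1d (fin1 _) (esym bE) _ q0).
    by rewrite gtrDr.
  exact: (esum_letter_fin HB HG HS C0 d00 p_len finq).
(* The negated condition says that [alpha <= 0] and that, if [alpha < 0], every exponential moment
   diverges; these are the assumptions under which the recurrent set has full dimension. *)
rewrite ltNge => /negP dimlt; apply: contrapT => /not_orP[/negP + noneg].
rewrite -leNgt => a0; apply: dimlt.
move: ab a0 noneg; case: alpha => [a||]//; last by move=> ab; move: beta0; rewrite -ab.
rewrite -EFinD lee_fin => bE a0 noneg.
apply: (recurrent_dim_ge HB HG HS muR0 mu_inv C0 d00 p_len (esym bE)).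
  by rewrite gerDr.
rewrite gtrDr => aneg q q0; apply/eqP; rewrite -leye_eq leNgt; apply/negP => finq.
apply: noneg; rewrite lte_fin; split => //; exists q; split => //.
exact: (esum_Per_fin HB HG HS C0 d00 p_len finq).
Qed.
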